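(* Let $\varepsilon$ be summable and let $F\in S_m(\mathcal B,\varepsilon)$ with $m\ge2$. Let $X\in H^2$. For all integers $1\le k\le m-1$, all $h>0$ and $p\in[1,+\infty[$, one has, as functions of $Y$ in $L^p(B^2,\mu_{B^2,h})$: $$\widetilde F(X+Y)=F(X)+\sum_{i=1}^{k-1}\frac1{i!}\sum_{J\in\Gamma^i,\ \delta\in\{0,1\}^i}\left(\prod_{r=1}^i\ell_{w_{j_r}^{\delta_r}}(Y)\right)\frac{\partial^iF}{\partial w_{j_1}^{\delta_1}\cdots\partial w_{j_i}^{\delta_i}}(X)$$ $$\qquad+\sum_{J\in\Gamma^k,\ \delta\in\{0,1\}^k}\left(\prod_{r=1}^k\ell_{w_{j_r}^{\delta_r}}(Y)\right)\int_0^1\frac{(1-s)^{k-1}}{(k-1)!}\,\mathcal P\left(\frac{\partial^kF}{\partial w_{j_1}^{\delta_1}\cdots\partial w_{j_k}^{\delta_k}}\right)(X+sY)\,ds .$$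
   Context: Wiener space. $H$ is a real, separable, infinite dimensional Hilbert space with scalar product $\langle\cdot,\cdot\rangle$ and norm $|\cdot|$; $B$ is the Banach space obtained by completing $H$ for a measurable norm (in the sense of Gross), and $H$ is identified with its dual, so that $B'\subset H\subset B$. For $h>0$, $\mu_{B,h}$ is the Gaussian probability measure of variance $h$ on the Borel $\sigma$-algebra of $B$: for $y_1,\dots,y_n\in B'$ orthonormal in $H$, the image of $\mu_{B,h}$ under $x\mapsto (y_1(x),\dots,y_n(x))$ is $(2\pi h)^{-n/2}e^{-|v|^2/(2h)}dv$ on $\mathbb R^n$. For $a\in H$, $\ell_a\in L^2(B,\mu_{B,h})$ is the image of $a$ under the continuous extension to $H$ of the map $B'\ni y\mapsto y(\cdot)$. For a finite dimensional subspace $E\subset H$ with orthonormal basis $(w_1,\dots,w_n)$, $\tilde\pi_E(x)=\sum_j\ell_{w_j}(x)w_j$ for $x\in B$. A Borel function $f$ on $H$ admits $\tilde f$ as a stochastic extension in $L^p(B,\mu_{B,h})$ if, for every increasing sequence $(E_n)$ of finite dimensional subspaces of $H$ with dense union, $f\circ\tilde\pi_{E_n}\in L^p(B,\mu_{B,h})$ and $f\circ\tilde\pi_{E_n}\to\tilde f$ in $L^p(B,\mu_{B,h})$. All this is used likewise for $(H^2,B^2,\mu_{B^2,h})$. Symbol classes. $\mathcal B=(e_j)_{j\in\Gamma}$ is a Hilbert basis of $H$ ($\Gamma$ countable) with all $e_j\in B'$; $u_j=(e_j,0)$, $v_j=(0,e_j)$, and $w_j^0=u_j$, $w_j^1=v_j$.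 For $m\in\mathbb N$, $M\ge0$ and a family $\varepsilon=(\varepsilon_j)_{j\in\Gamma}$ of nonnegative reals, $S_m(\mathcal B,M,\varepsilon)$ is the set of bounded continuous $F:H^2\to\mathbb C$ such that for every pair of finitely supported multi-indices $(\alpha,\beta)$ with $0\le\alpha_j,\beta_j\le m$ for all $j$, the derivative $\prod_{j}\partial_{u_j}^{\alpha_j}\partial_{v_j}^{\beta_j}F$ exists, is continuous on $H^2$ and is bounded in modulus by $M\prod_j\varepsilon_j^{\alpha_j+\beta_j}$. $S_m(\mathcal B,\varepsilon)=\bigcup_{M\ge0}S_m(\mathcal B,M,\varepsilon)$. Notation. $J=(j_1,\dots,j_i)\in\Gamma^i$, $\delta=(\delta_1,\dots,\delta_i)\in\{0,1\}^i$. For $G\in S_1(\mathcal B,\varepsilon)$ with $\varepsilon$ summable, $\widetilde G=\mathcal P(G)$ denotes a function on $B^2$ which is the stochastic extension of $G$ in $L^q(B^2,\mu_{B^2,h'})$ simultaneously for all $h'\in]0,2h]$ and all $q\in[1,+\infty[$ (such a function exists). *)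

(* Defs.v *)
From HB Require Import structures.
From mathcomp Require Import all_boot all_order all_algebra.
From mathcomp Require Import sesquilinear finmap.
From mathcomp Require Import all_classical all_reals all_analysis.
From mathcomp Require Import complex.

Set Implicit Arguments.
Unset Strict Implicit.
Unset Printing Implicit Defensive.

Import Order.TTheory GRing.Theory Num.Theory.
Import numFieldNormedType.Exports.

Local Open Scope classical_set_scope.
Local Open Scope ring_scope.
Local Open Scope complex_scope.

Definition lspan (R : realType) (V : lmodType R) (s : seq V) : set V :=
  [set v | exists c : nat -> R, v = \sum_(i < size s) c i *: s`_i].

Record hilbert (R : realType) (H : completeNormedModType R)
    (ip : {dot H for idfun}) : Prop := Hilbert {
  hilbert_norm : forall x, `|x| = Num.sqrt (ip x x);
  hilbert_separable : exists2 A : set H, countable A & dense A;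
  hilbert_infinite : forall s : seq H, lspan s <> [set: H] }.

Definition hilbert_basis (R : realType) (H : normedModType R)
    (ip : {dot H for idfun}) (Gamma : countType) (e : Gamma -> H) : Prop :=
  (forall j k, ip (e j) (e k) = (j == k)%:R) /\
  dense [set v | exists s : seq Gamma, lspan (map e s) v].

(* The library norm of [H * H] is the maximum norm, which is equivalent to the
   Hilbert norm of [H * H]: the topology is the right one, and the Euclidean
   structure is the scalar product below. *)
Section prod_dot.
Context {R : realType} {H : lmodType R} (ip : {dot H for idfun}).

Definition prod_dot (a b : H * H) : R := ip a.1 b.1 + ip a.2 b.2.

Let prod_dot_addl u' : zmod_morphism (prod_dot ^~ u').
Proof. by move=> a b; rewrite /prod_dot /= !linearBl /= opprD addrACA. Qed.
Let prod_dot_addr u : zmod_morphism (prod_dot u).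
Proof. by move=> a b; rewrite /prod_dot /= !linearBr /= opprD addrACA. Qed.
Let prod_dot_scalel u' : scalable_for *%R (prod_dot ^~ u').
Proof. by move=> c a; rewrite /prod_dot /= !linearZl_LR /= mulrDr. Qed.
Let prod_dot_scaler u : scalable_for (idfun \; *%R) (prod_dot u).
Proof. by move=> c a; rewrite /prod_dot /= !linearZr_LR /= mulrDr. Qed.
HB.instance Definition _ := isBilinear.Build R (H * H)%type (H * H)%type R
  *%R (idfun \; *%R) prod_dot
  prod_dot_addl prod_dot_addr prod_dot_scalel prod_dot_scaler.

Let prod_dot_sym x y : prod_dot x y = (-1) ^+ false * idfun (prod_dot y x).
Proof. by rewrite /prod_dot expr0 mul1r /= (hermC ip x.1) (hermC ip x.2) /= !expr0 !mul1r. Qed.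
HB.instance Definition _ :=
  isHermitianSesquilinear.Build R (H * H)%type false idfun prod_dot prod_dot_sym.

Let prod_dot_gt0 u : u != 0 -> 0 < prod_dot u u.
Proof.
have ge0 v : 0 <= ip v v.
  by have [->|/(neq0_dnorm_gt0 (s := ip))/ltW//] := eqVneq v 0; rewrite linear0r.
case: u => a b; rewrite /prod_dot /= -pair_eqE /= negb_and.
case/orP => h; first by rewrite ltr_wpDr// neq0_dnorm_gt0.
by rewrite ltr_wpDl// neq0_dnorm_gt0.
Qed.
HB.instance Definition _ := isDotProduct.Build R (H * H)%type prod_dot prod_dot_gt0.

End prod_dot.

Fixpoint iter_integral (R : realType) (n : nat) :
    (n.-tuple R -> \bar R) -> \bar R :=
  match n with
  | 0 => fun f => f [tuple]
  | n'.+1 => fun f =>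
      (\int[lebesgue_measure]_t iter_integral (fun v => f [tuple of t :: v]))%E
  end.

Definition gauss_density (R : realType) (h : R) (n : nat) (v : n.-tuple R) : R :=
  Num.sqrt (2 * pi * h) ^- n *
  expR (- (\sum_(k < n) tnth v k ^+ 2) / (2 * h)).

Definition gauss_law (R : realType) (h : R) (n : nat) (A : set (n.-tuple R)) :
    \bar R :=
  iter_integral (fun v => (gauss_density h v * \1_A v)%:E).

(* The probability below is that of [`|P x| > eps] for the canonical (variance
   1) cylindrical Gaussian measure on [H], [P] being the orthogonal projection
   on the span of [s]; finite dimensional projections are given by orthonormal
   sequences, and the norm of [B] is seen on [H] through [iota]. *)
Definition gross_measurable (R : realType) (H : normedModType R)
    (B : normedModType R) (ip : {dot H for idfun}) (iota : H -> B) : Prop :=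
  forall eps : R, 0 < eps ->
  exists2 s0 : seq H, orthonormal ip s0 &
  forall s : seq H, orthonormal ip s -> orthogonal ip s s0 ->
  (gauss_law 1 [set v : (size s).-tuple R |
     (eps < `| iota (\sum_(k < size s) tnth v k *: s`_k)%R |)%R] < eps%:E)%E.

Record wiener_space (R : realType) (H B : completeNormedModType R)
    (ip : {dot H for idfun}) (iota : {linear H -> B}) : Prop := WienerSpace {
  wiener_hilbert : hilbert ip;
  wiener_inj : injective iota;
  wiener_continuous : continuous iota;
  wiener_dense : dense (range iota);
  wiener_measurable : gross_measurable ip iota }.

(* The element of the dual [W'] given by the functional [y] is the vector [a] of
   [V] under the identifications [W' <= V' = V]. *)
Definition dual_vector (R : realType) (V W : normedModType R)
    (ip : V -> V -> R) (iota : V -> W) (y : W -> R) (a : V) : Prop :=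
  [/\ scalar y, continuous y & forall x, y (iota x) = ip a x].

Definition in_dual (R : realType) (V W : normedModType R)
    (ip : V -> V -> R) (iota : V -> W) (a : V) : Prop :=
  exists y, dual_vector ip iota y a.

Definition borel (R : realType) (T : normedModType R) : measurableType _ :=
  g_sigma_algebraType (@open T).

Definition gaussian_measure (R : realType) (V W : normedModType R)
    (ip : {dot V for idfun}) (iota : V -> W) (h : R)
    (mu : probability (borel W) R) : Prop :=
  forall (n : nat) (a : n.-tuple V) (y : 'I_n -> W -> R),
  (forall k, dual_vector ip iota (y k) (tnth a k)) ->
  orthonormal ip a ->
  forall A : set (n.-tuple R), measurable A ->
  pushforward mu (fun x : borel W => [tuple y k x | k < n]) A = gauss_law h A.

Section stochastic_extension.
Context {R : realType} {V W : normedModType R}.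
Variables (ip : {dot V for idfun}) (iota : V -> W).
Variable mu : probability (borel W) R.

(* [g] is the value at [a] of the continuous extension to [V] of the map
   [y |-> y(.)] from [W'] to [L^2]. *)
Definition is_ell (a : V) (g : borel W -> R) : Prop :=
  g \in Lfun mu 2%:E /\
  forall eps : R, 0 < eps ->
  \forall b \near a, forall y : W -> R, dual_vector ip iota y b ->
    ('N[mu]_2%:E[(fun x => (y x - g x)%:E)] < eps%:E)%E.

(* a version of the class [ell_a], which is unique up to a null set *)
Definition ell (a : V) : W -> R := xget (cst 0) [set g | is_ell a g].

Definition proj_ext (w : seq V) (x : W) : V :=
  \sum_(k < size w) ell w`_k x *: w`_k.

Definition cLfun (p : R) (f : W -> R[i]) : Prop :=
  [/\ measurable_fun setT (@complex.Re R \o f : borel W -> R),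
      measurable_fun setT (@complex.Im R \o f : borel W -> R) &
      ('N[mu]_p%:E[(fun x => (Normc.normc (f x))%:E)] < +oo)%E].

Definition cLdist (p : R) (f g : W -> R[i]) : \bar R :=
  'N[mu]_p%:E[(fun x => (Normc.normc (f x - g x))%:E)]%E.

Definition stoch_ext (p : R) (f : V -> R[i]) (ft : W -> R[i]) : Prop :=
  [/\ measurable_fun setT (@complex.Re R \o f : borel V -> R),
      measurable_fun setT (@complex.Im R \o f : borel V -> R),
      cLfun p ft &
      forall w : nat -> seq V,
        (forall n, orthonormal ip (w n)) ->
        (forall n, lspan (w n) `<=` lspan (w n.+1)) ->
        dense (\bigcup_n lspan (w n)) ->
        (forall n, cLfun p (f \o proj_ext (w n))) /\
        cLdist p (f \o proj_ext (w n)) ft @[n --> \oo] --> 0%E].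

(* Convergence in [L^p] of the net of finite partial sums: unordered summation. *)
Definition cLsum (p : R) (I : choiceType) (f : I -> W -> R[i]) (g : W -> R[i]) :
    Prop :=
  [/\ forall i, cLfun p (f i), cLfun p g &
      forall eps : R, 0 < eps -> exists A0 : {fset I},
      forall A : {fset I}, (A0 `<=` A)%fset ->
      (cLdist p (fun x => \sum_(i <- A) f i x)%R g < eps%:E)%E].

End stochastic_extension.

(* [R[i]] is not a normed module over [R] in the libraries: limits, derivatives
   and integrals of complex functions are taken on real and imaginary parts. *)
Section symbols.
Context {R : realType} {V : normedModType R}.

Definition cderivable (F : V -> R[i]) (x v : V) : Prop :=
  derivable (@complex.Re R \o F) x v /\ derivable (@complex.Im R \o F) x v.

Definition cderive (v : V) (F : V -> R[i]) (x : V) : R[i] :=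
  'D_v (@complex.Re R \o F) x +i* 'D_v (@complex.Im R \o F) x.

Definition ccontinuous (F : V -> R[i]) : Prop :=
  continuous (@complex.Re R \o F) /\ continuous (@complex.Im R \o F).

(* derivative along [v_1, ..., v_n], that is, [d_(v_1) (... (d_(v_n) F))] *)
Definition iter_deriv (s : seq V) (F : V -> R[i]) : V -> R[i] :=
  foldr cderive F s.

Fixpoint iter_derivable (s : seq V) (F : V -> R[i]) : Prop :=
  if s is v :: s' then
    iter_derivable s' F /\ forall x, cderivable (iter_deriv s' F) x v
  else True.

End symbols.

Section symbol_classes.
Context {R : realType} {H : normedModType R} {Gamma : countType}.
Variable e : Gamma -> H.

Definition wdir (l : Gamma * bool) : H * H :=
  if l.2 then (0, e l.1) else (e l.1, 0).

(* [s] lists, in some order, the variables of a monomial derivative of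
   multi-index [(alpha, beta)]; such an [s] exists if and only if [alpha] and
   [beta] are finitely supported. *)
Definition arrangement (alpha beta : Gamma -> nat) (s : seq (Gamma * bool)) :
    Prop :=
  forall j, count_mem (j, false) s = alpha j /\ count_mem (j, true) s = beta j.

Definition symbol_bound (m : nat) (M : R) (eps : Gamma -> R)
    (F : H * H -> R[i]) : Prop :=
  [/\ ccontinuous F,
      exists C : R, forall x, Normc.normc (F x) <= C &
      forall (alpha beta : Gamma -> nat) (s : seq (Gamma * bool)),
        (forall j, (alpha j <= m)%N /\ (beta j <= m)%N) ->
        arrangement alpha beta s ->
        [/\ iter_derivable (map wdir s) F,
            ccontinuous (iter_deriv (map wdir s) F) &
            forall x, Normc.normc (iter_deriv (map wdir s) F x) <=
              M * \big[*%R/1]_(j \in [set: Gamma]) eps j ^+ (alpha j + beta j)]].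

Definition symbol_class (m : nat) (eps : Gamma -> R) (F : H * H -> R[i]) : Prop :=
  exists2 M : R, 0 <= M & symbol_bound m M eps F.

End symbol_classes.

Definition map_pair (T U : Type) (f : T -> U) (x : T * T) : U * U :=
  (f x.1, f x.2).

Section taylor.
Context {R : realType} {H B : completeNormedModType R} {Gamma : countType}.
Variables (ip : {dot H for idfun}) (iota : H -> B) (e : Gamma -> H).
Variable mu : probability (borel (B * B)%type) R.

Definition multi_dir (i : nat) (l : i.-tuple Gamma * i.-tuple bool) :
    i.-tuple (H * H) :=
  [tuple wdir e (tnth l.1 r, tnth l.2 r) | r < i].

Definition ell_prod (i : nat) (l : i.-tuple Gamma * i.-tuple bool) (Y : B * B) :
    R :=
  \prod_(r < i) ell (prod_dot ip) (map_pair iota) mu (tnth (multi_dir l) r) Y.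

Definition partial (i : nat) (l : i.-tuple Gamma * i.-tuple bool)
    (F : H * H -> R[i]) : H * H -> R[i] :=
  iter_deriv (multi_dir l) F.

End taylor.

Definition cintegrable01 (R : realType) (f : R -> R[i]) : Prop :=
  lebesgue_measure.-integrable `[0, 1] (fun s : R => (@complex.Re R (f s))%:E) /\
  lebesgue_measure.-integrable `[0, 1] (fun s : R => (@complex.Im R (f s))%:E).

Definition cintegral01 (R : realType) (f : R -> R[i]) : R[i] :=
  (\int[lebesgue_measure]_(s in `[0, 1]) @complex.Re R (f s))%R +i*
  (\int[lebesgue_measure]_(s in `[0, 1]) @complex.Im R (f s))%R.

(* Main.v *)
(* Along a finite dimensional direction v = pi_n Y the classical Taylor formula
   with integral remainder holds for F, and one lets n tend to infinity in L^1(mu_h).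
   As sum eps < +oo and the products of i linear functionals are bounded in every
   L^q, uniformly in the functionals, all the sums are dominated termwise by a
   summable family (Tannery), so that only termwise convergence is needed.
   The obstruction is that P G is controlled under mu_h', whereas the remainder
   involves P G (iota X + s Y) with Y distributed as mu_h. The image N |-> mu_h {Y |
   iota X + s Y in N} is related to mu_(s^2 h) by
     mu_h {Y | iota X + s Y in N} <= lam exp(|X|^2 / (s^2 h)) + mu_(s^2 h)(N) / lam,
   for all lam > 0, which transports null sets and convergence in measure. For
   cylinders this is an inequality between Gaussian densities; it extends to all
   Borel sets because these are generated by countably many functionals (the space
   is separable: Hahn-Banach), all of which are represented in H (Riesz). *)
Require Import Defs.
From mathcomp Require Import all_boot all_order all_algebra.
From mathcomp Require Import sesquilinear finmap.
From mathcomp Require Import all_classical all_reals all_analysis.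
From mathcomp Require Import complex.
From mathcomp Require Import measurable_realfun ring lra.
Import Order.TTheory GRing.Theory Num.Theory.
Import numFieldNormedType.Exports.
Local Open Scope classical_set_scope.
Local Open Scope ring_scope.
Local Open Scope complex_scope.

Set Implicit Arguments.
Unset Strict Implicit.
Unset Printing Implicit Defensive.

(** Gaussian measures of different variances on an infinite dimensional space are mutually singular,
    so what is known of the extension under [mu h] alone says nothing about the points
    [iota X + s *: Y] with s < 1. The extension is therefore used under every variance s^2 h in ]0,
    h] at once. The time s = 0, where the law degenerates to a point mass, is dropped as a null set
    of times. The comparison of laws is additive, with a free [lam], because in this form its finite
    dimensional versions have one common constant, depending on [X] through |X| only, and it
    survives approximation of sets. No density is built in infinite dimension. The identity itself
    is obtained from uniqueness of limits in L^1. Summability in L^p is a separate matter of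
    domination, and one pointwise function, chosen without reference to the exponent, serves as the
    sum in both. The bound k <= m - 1 leaves one derivative in reserve: a derivative of order k is
    again a symbol of order 1, hence has an extension, and its own first derivatives control the
    replacement of [X] by its projections. Pairs (J, delta) are handled as words over
    [Gamma * bool], and real and imaginary parts separately. *)

(** * Norming functionals (Hahn-Banach) *)

Section hahn_banach.
Context {R : realType} {W : normedModType R}.

(** The graph of a partial linear functional below the norm. The last clause is conditional so that
    the empty set qualifies: it is the union of the empty chain in Zorn's lemma. *)
Definition dominated_graph (w0 : W) (G : set (W * R)) : Prop :=
  [/\ forall (a : R) u v, G u -> G v -> G (a *: u.1 + v.1, a * u.2 + v.2),
      forall u, G u -> u.2 <= `|u.1| &
      forall u, G u -> G (w0, `|w0|)].

Lemma maximal_dominated_graph (w0 : W) : exists G, dominated_graph w0 G /\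
  forall G', G `<` G' -> ~ dominated_graph w0 G'.
Proof.
apply: Zorn_bigcup => F FP Ftot; split.
- move=> a u v [A FA Au] [B FB Bv].
  have [AB|BA] := Ftot _ _ FA FB.
  + exists B => //; have [h _ _] := FP _ FB; apply: h => //; exact: AB.
  + exists A => //; have [h _ _] := FP _ FA; apply: h => //; exact: BA.
- by move=> u [A FA Au]; have [_ h _] := FP _ FA; apply: h.
- move=> u [A FA Au]; exists A => //; have [_ _ h] := FP _ FA; exact: h Au.
Qed.

(** The value at [x1] has to lie above all [u.2 - |u.1 - x1|] and below all [|v.1 + x1| - v.2]. By
    the triangle inequality ([sep]) every lower bound is below every upper bound, and the supremum
    of the lower bounds is taken. *)
Lemma dominated_graph_extend (w0 x1 : W) (G : set (W * R)) :
  dominated_graph w0 G -> G !=set0 ->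
  exists c : R, dominated_graph w0
    [set u | exists (t : R) v, G v /\ u = (v.1 + t *: x1, v.2 + t * c)].
Proof.
move=> [Gl Gb G0] [g Gg].
have Gz : G (0, 0).
  have := Gl (-1) _ _ Gg Gg.
  by rewrite scaleN1r mulN1r !addNr.
have GZ a u : G u -> G (a *: u.1, a * u.2).
  by move=> Gu; have := Gl a _ _ Gu Gz; rewrite !addr0.
have GD u v : G u -> G v -> G (u.1 + v.1, u.2 + v.2).
  by move=> Gu Gv; have := Gl 1 _ _ Gu Gv; rewrite scale1r mul1r.
have sep u v : G u -> G v -> u.2 - `|u.1 - x1| <= `|v.1 + x1| - v.2.
  move=> Gu Gv; rewrite lerBlDr addrAC lerBrDr.
  apply: le_trans (Gb _ (GD _ _ Gu Gv)) _ => /=.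
  by rewrite (le_trans _ (ler_normD _ _))// addrACA subrr addr0 addrC.
pose S := [set u.2 - `|u.1 - x1| | u in G].
have Sub v : G v -> ubound S (`|v.1 + x1| - v.2).
  by move=> Gv _ [u Gu <-]; exact: sep.
have hsS : has_sup S.
  split; first by exists (g.2 - `|g.1 - x1|); exists g.
  by exists (`|g.1 + x1| - g.2); exact: Sub.
exists (sup S).
have lo u : G u -> u.2 - `|u.1 - x1| <= sup S.
  by move=> Gu; apply: (ub_le_sup hsS.2); exists u.
have hi v : G v -> sup S <= `|v.1 + x1| - v.2.
  by move=> Gv; apply: ge_sup; [exact: hsS.1|exact: Sub].
split.
- move=> a _ _ [t [v [Gv ->]]] [t' [v' [Gv' ->]]] /=.
  exists (a * t + t'), (a *: v.1 + v'.1, a * v.2 + v'.2); split; first exact: Gl.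
  congr pair => /=; last by ring.
  by rewrite scalerDr scalerDl scalerA addrACA.
- move=> _ [t [v [Gv ->]]] /=.
  (* Dividing by |t| reduces to the coefficients -1 and 1, which are the bounds [lo] and [hi]. *)
  have [t0|t0|->] := ltgtP t 0; last by rewrite scale0r mul0r !addr0; exact: Gb.
  + have := lo _ (GZ (- t^-1) _ Gv) => /=.
    have -> : - t^-1 *: v.1 - x1 = - t^-1 *: (v.1 + t *: x1).
      by rewrite scalerDr scalerA mulNr mulVf ?lt_eqF// scaleN1r.
    rewrite normrZ normrN normfV ltr0_norm//; set N := `|_|.
    rewrite -(ler_pM2l (_ : 0 < - t)) ?oppr_gt0//.
    have -> : - t * (- t^-1 * v.2 - (- t)^-1 * N) = v.2 - N.
      by field; rewrite lt_eqF.
    by lra.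
  + have := hi _ (GZ (t^-1) _ Gv) => /=.
    have -> : t^-1 *: v.1 + x1 = t^-1 *: (v.1 + t *: x1).
      by rewrite scalerDr scalerA mulVf ?gt_eqF// scale1r.
    rewrite normrZ normfV gtr0_norm// => h.
    rewrite -(ler_pM2l (_ : 0 < t^-1)) ?invr_gt0//.
    have -> : t^-1 * (v.2 + t * sup S) = t^-1 * v.2 + sup S.
      by field; rewrite gt_eqF.
    lra.
- move=> _ [t [v [Gv _]]]; exists 0, (w0, `|w0|); split; first exact: G0 Gv.
  by rewrite scale0r mul0r !addr0.
Qed.

Lemma hahn_banach_norming (w0 : W) : exists y : W -> R,
  [/\ scalar y, forall x, `|y x| <= `|x| & y w0 = `|w0|].
Proof.
have [G [PG Gmax]] := maximal_dominated_graph w0.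
have [Gl Gb G0] := PG.
have GN0 : G !=set0.
  (* The empty set is not maximal: the line through [w0], with the norm of [w0] as its value there,
     is a larger dominated graph. *)
  apply/set0P/negP => /eqP G00.
  pose G1 := [set u : W * R | exists t : R, u = (t *: w0, t * `|w0|)].
  apply: (Gmax G1); rewrite ?G00.
    split=> [u []|/(_ (0, 0)) h]; apply: h.
    by exists 0; rewrite scale0r mul0r.
  split.
  - move=> a _ _ [t ->] [t' ->] /=; exists (a * t + t').
    by rewrite scalerDl scalerA mulrDl mulrA.
  - move=> _ [t ->] /=; rewrite normrZ ler_wpM2r//; exact: ler_norm.
  - by move=> _ _; exists 1; rewrite scale1r mul1r.
have Gtot x : exists r, G (x, r).
  have [c PG'] := dominated_graph_extend x PG GN0.
  have [g Gg] := GN0.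
  have Gz : G (0, 0).
    by have := Gl (-1) _ _ Gg Gg; rewrite scaleN1r mulN1r !addNr.
  apply: contrapT => nx; apply: Gmax PG'; split.
    by move=> v Gv; exists 0, v; rewrite scale0r mul0r !addr0 -surjective_pairing.
  move=> /(_ (x, c)) h; apply: nx; exists c; apply: h.
  by exists 1, (0, 0); rewrite /= scale1r mul1r !add0r.
(* The difference of two points over [x] lies over 0, where domination makes its value at most 0.
   Exchanging the points gives equality. *)
have GF x r r' : G (x, r) -> G (x, r') -> r = r'.
  have aux a b : G (x, a) -> G (x, b) -> a <= b.
    move=> Ga Gc; have := Gb _ (Gl (-1) _ _ Gc Ga) => /=.
    by rewrite scaleN1r mulN1r addNr normr0; lra.
  by move=> h1 h2; apply/eqP; rewrite eq_le !aux.
have /choice [y Gy] := Gtot; exists y.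
have [g Gg] := GN0.
have ys : scalar y.
  by move=> a u v; apply: GF (Gy _) _; have := Gl a _ _ (Gy u) (Gy v).
split => // [x|].
  have yN : y (- x) = - y x.
    have := ys (-1) x 0; have := ys 1 0 0.
    by rewrite !scaler0 !addr0 scaleN1r/=; lra.
  rewrite ler_norml; have := Gb _ (Gy x); have := Gb _ (Gy (- x)).
  by rewrite /= yN normrN => h1 ->; rewrite andbT; lra.
exact: GF (Gy _) (G0 _ Gg).
Qed.

End hahn_banach.

Lemma le_of_eq d (T : porderType d) (x y : T) : x = y -> (x <= y)%O.
Proof. by move->. Qed.

(** * Scalar products, linear functionals and Riesz representation *)

Section dot_facts.
Context {R : realType} {H : lmodType R} (ip : {dot H for idfun}).

Lemma dotC x y : ip x y = ip y x.
Proof. by rewrite (hermC ip x y) /= expr0 mul1r. Qed.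
Lemma dotDl x y z : ip (x + y) z = ip x z + ip y z.
Proof. exact: linearDl. Qed.
Lemma dotDr x y z : ip x (y + z) = ip x y + ip x z.
Proof. exact: linearDr. Qed.
Lemma dotZl a x y : ip (a *: x) y = a * ip x y.
Proof. exact: linearZl_LR. Qed.
Lemma dotZr a x y : ip x (a *: y) = a * ip x y.
Proof. exact: linearZr_LR. Qed.
Lemma dotNl x y : ip (- x) y = - ip x y.
Proof. by rewrite -scaleN1r dotZl mulN1r. Qed.
Lemma dotNr x y : ip x (- y) = - ip x y.
Proof. by rewrite -scaleN1r dotZr mulN1r. Qed.
Lemma dot0l x : ip 0 x = 0.
Proof. by rewrite -(scale0r x) dotZl mul0r. Qed.
Lemma dot0r x : ip x 0 = 0.
Proof. by rewrite dotC dot0l. Qed.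
Lemma dot_ge0 x : 0 <= ip x x.
Proof.
by have [->|/(neq0_dnorm_gt0 (s := ip))/ltW//] := eqVneq x 0; rewrite dot0l.
Qed.
Lemma dot_gt0 x : x != 0 -> 0 < ip x x.
Proof. exact: neq0_dnorm_gt0. Qed.
Lemma dot_sumr (I : Type) (r : seq I) (P : pred I) (f : I -> H) x :
  ip x (\sum_(i <- r | P i) f i) = \sum_(i <- r | P i) ip x (f i).
Proof. exact: linear_sumr. Qed.
Lemma dot_suml (I : Type) (r : seq I) (P : pred I) (f : I -> H) x :
  ip (\sum_(i <- r | P i) f i) x = \sum_(i <- r | P i) ip (f i) x.
Proof. by rewrite dotC dot_sumr; apply: eq_bigr => i _; rewrite dotC. Qed.

End dot_facts.

Section scalar_functionals.
Context {R : realType} {W : normedModType R}.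
Variable y : W -> R.
Hypothesis ys : scalar y.

Lemma scalarD u v : y (u + v) = y u + y v.
Proof. by have := ys 1 u v; rewrite /= scale1r mul1r. Qed.
Lemma scalar0 : y 0 = 0.
Proof. by have := scalarD 0 0; rewrite addr0; lra. Qed.
Lemma scalarZ a u : y (a *: u) = a * y u.
Proof. by have := ys a u 0; rewrite /= scalar0 !addr0. Qed.
Lemma scalarN u : y (- u) = - y u.
Proof. by rewrite -scaleN1r scalarZ mulN1r. Qed.
Lemma scalarB u v : y (u - v) = y u - y v.
Proof. by rewrite scalarD scalarN. Qed.
Lemma scalar_continuous (K : R) : (forall x, `|y x| <= K * `|x|) -> continuous y.
Proof.
move=> yK x; apply/cvgrPdist_lt => e e0.
have K1 : 0 < `|K| + 1 by rewrite ltr_wpDl.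
near=> t; rewrite -scalarB; apply: le_lt_trans (yK _) _.
have : `|x - t| < e / (`|K| + 1).
  near: t; apply: cvgr_dist_lt => //; exact: divr_gt0.
rewrite ltr_pdivlMr// mulrC; apply: le_lt_trans.
by rewrite ler_wpM2r//; have := ler_norm K; lra.
Unshelve. all: end_near. Qed.

Lemma scalar_bounded : continuous y -> exists2 K, 0 <= K & forall x, `|y x| <= K * `|x|.
Proof.
move=> /(_ 0)/cvgrPdist_lt/(_ _ (ltr01))/nbhs_normP[d /= d0 hd].
exists (2 / d); first by rewrite divr_ge0// ltW.
move=> x; have [->|x0] := eqVneq x 0; first by rewrite scalar0 !normr0 mulr0.
have nx : 0 < `|x| by rewrite normr_gt0.
have c0 : 0 < d / 2 / `|x| by rewrite !divr_gt0.
have := hd ((d / 2 / `|x|) *: x); rewrite /= sub0r normrN scalar0 sub0r normrN.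
rewrite scalarZ normrZ [ `|_ * y x|]normrM (gtr0_norm c0) -[_ * `|x|]mulrA.
rewrite mulVf ?gt_eqF// mulr1.
have d2 : d / 2 < d by lra.
move=> /(_ d2) h.
have -> : 2 / d * `|x| = (d / 2 / `|x|)^-1 by field; rewrite !gt_eqF.
by rewrite -[leRHS]mulr1 ler_pdivlMl// ltW.
Qed.

End scalar_functionals.

Section riesz.
Context {R : realType} {H : completeNormedModType R} (ip : {dot H for idfun}).
Hypothesis ipE : forall x, `|x| = Num.sqrt (ip x x).

Let sqn x : `|x| ^+ 2 = ip x x.
Proof. by rewrite ipE sqr_sqrtr// dot_ge0. Qed.

(** The representing vector is the minimiser of [J]. The parallelogram identity at a midpoint
    ([par]) makes a minimising sequence Cauchy, completeness gives its limit, and the vanishing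
    first variation of [J] at the limit is the claim. *)
Lemma riesz_representation (phi : H -> R) : scalar phi -> continuous phi ->
  exists a, forall x, phi x = ip a x.
Proof.
move=> ps pc; have [K K0 pK] := scalar_bounded ps pc.
pose J x := `|x| ^+ 2 - 2 * phi x.
have Jlb x : - K ^+ 2 <= J x.
  have := pK x; rewrite ler_norml /J => /andP[_ h].
  have : 0 <= (`|x| - K) ^+ 2 by exact: sqr_ge0.
  rewrite sqrrB; lra.
have hi : has_inf (range J).
  by split; [exists (J 0); exists 0|exists (- K ^+ 2) => _ [x _ <-]].
set m := inf (range J).
have mJ x : m <= J x by apply: ge_inf; [exact: hi.2|exists x].
have /choice [u uP] : forall n, exists u, J u < m + n.+1%:R^-1.
  move=> n; have [|_ [x _ <-] h] := @inf_adherent _ (range J) n.+1%:R^-1 _ hi.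
    by rewrite invr_gt0.
  by exists x.
have par x z : `|x - z| ^+ 2 <= 2 * (J x - m) + 2 * (J z - m).
  have := mJ (2^-1 *: (x + z)); rewrite /J !sqn (scalarZ ps) (scalarD ps).
  rewrite !(dotDl, dotDr, dotZl, dotZr, dotNl, dotNr) (dotC ip z x); lra.
have uc : cvgn u.
  apply/cauchy_cvgP/cauchy_ballP => e e0.
  have e40 : 0 < e ^+ 2 / 4 by rewrite divr_gt0// exprn_gt0.
  have hn : \forall n \near \oo, J (u n) - m < e ^+ 2 / 4.
    have := near_infty_natSinv_lt (PosNum e40) => /=.
    by apply: filterS => n hn; rewrite ltrBlDl (lt_trans (uP n))// ltrD2l.
  near=> x y; rewrite -ball_normE /=.
  rewrite -(ltr_pXn2r (_ : (0 < 2)%N)) ?nnegrE// ?ltW//.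
  apply: le_lt_trans (par _ _) _.
  have hx : J x - m < e ^+ 2 / 4 by near: x; exact: hn.
  have hy : J y - m < e ^+ 2 / 4 by near: y; exact: hn.
  lra.
pose a := limn u; exists a => x.
have ua : u n @[n --> \oo] --> a by [].
have Ja : J a <= m.
  have cJ : J (u n) @[n --> \oo] --> J a.
    apply: cvgB; first by rewrite expr2; apply: cvgM; apply: cvg_norm.
    by apply: cvgMr; apply: continuous_cvg => //; exact: pc.
  apply/ler_addgt0Pr => e e0.
  rewrite -(cvg_lim _ cJ)//; apply: limr_le; first exact: cvgP cJ.
  have := near_infty_natSinv_lt (PosNum e0) => /=.
  by apply: filterS => n hn; rewrite ltW// (lt_trans (uP n))// ltrD2l.
have h (t : R) : 0 <= t ^+ 2 * ip x x + 2 * t * (ip a x - phi x).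
  have := mJ (a + t *: x); move: Ja; rewrite /J !sqn (scalarD ps).
  rewrite (scalarZ ps) !(dotDl, dotDr, dotZl, dotZr) (dotC ip x a).
  set A := ip a x; set C := phi x; set D := phi a; set E := ip a a.
  set G := ip x x; lra.
set c := ip a x - phi x in h *.
suff : c = 0 by rewrite /c; lra.
have q0 : 0 < ip x x + 1 by rewrite ltr_wpDl// dot_ge0.
(* Almost the minimiser -c / |x|^2 of the quadratic polynomial in t. The added 1 keeps the quotient
   meaningful at x = 0 and still makes the value negative unless c = 0. *)
have := h (- c / (ip x x + 1)).
have -> : (- c / (ip x x + 1)) ^+ 2 * ip x x + 2 * (- c / (ip x x + 1)) * c =
   - (c ^+ 2 * ((ip x x + 2) / (ip x x + 1) ^+ 2)).
  by field; rewrite gt_eqF.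
rewrite oppr_ge0 pmulr_lle0; last first.
  by rewrite divr_gt0 ?exprn_gt0//; have := dot_ge0 ip x; lra.
by move=> c2; apply/eqP; rewrite -sqrf_eq0 eq_le c2 sqr_ge0.
Unshelve. all: end_near. Qed.

End riesz.

Lemma cvge0_lt (R : realType) (u : nat -> \bar R) (e : R) :
  u n @[n --> \oo] --> 0%E -> 0 < e -> \forall n \near \oo, (u n < e%:E)%E.
Proof.
move=> u0 e0; apply: (u0 [set x | (x < e%:E)%E]).
by apply: open_nbhs_nbhs; split; [exact: open_ereal_lt_ereal|rewrite /= lte_fin].
Qed.

(** * Separable Banach spaces and their Borel sets *)

Section separable_norming.
Context {R : realType} {W : normedModType R}.

Lemma dense_sequence (A : set W) : countable A -> dense A ->
  exists w : nat -> W, forall x e, 0 < e -> exists n, `|x - w n| < e.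
Proof.
move=> cA dA; have [A0|[f]] := pfcard_geP cA.
  have [||x []] := dA setT; [by exists 0|exact: openT|by rewrite A0].
exists f => x e e0; have [||y [/= xy /(@surj _ _ _ _ f)[n _ fn]]] := dA (ball x e).
- by exists x; exact: ballxx.
- exact: ball_open.
by exists n; rewrite fn; move: xy; rewrite -ball_normE.
Qed.

(** One norming functional for each point of a dense sequence is enough: [y n] attains the norm at
    [w n], and both [y n] and the norm vary by at most |x - w n| between [x] and [w n]. *)
Lemma norming_sequence (w : nat -> W) :
  (forall x e, 0 < e -> exists n, `|x - w n| < e) ->
  exists y : nat -> W -> R, [/\ forall n, scalar (y n),
    forall n x, `|y n x| <= `|x| &
    forall x r, (forall n, y n x <= r) -> `|x| <= r].
Proof.
move=> wd; have /choice [y yP] := fun n => hahn_banach_norming (w n).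
exists y; split=> [n|n|x r h]; [by case: (yP n)|by case: (yP n)|].
apply/ler_addgt0Pr => e e0; have [|n xn] := wd x (e / 2); first by lra.
have [ys yb yw] := yP n.
have := h n; have := ler_normD (w n) (x - w n); rewrite subrKC -yw.
have -> : y n (w n) = y n x - y n (x - w n) by rewrite (scalarB ys); ring.
have := yb (x - w n); rewrite ler_norml => /andP[]; lra.
Qed.

(** A closed ball is a countable intersection of half-spaces of the [y n], and an open set is the
    countable union of the closed balls of radius 1/(k+1) about the [w n] that it contains. *)
Lemma borel_norming_generated (w : nat -> W) (y : nat -> W -> R)
  (M : set (set W)) :
  (forall x e, 0 < e -> exists n, `|x - w n| < e) ->
  (forall n, scalar (y n)) -> (forall n x, `|y n x| <= `|x|) ->
  (forall x r, (forall n, y n x <= r) -> `|x| <= r) ->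
  sigma_algebra setT M -> (forall n r, M [set x | y n x <= r]) ->
  forall A : set (borel W), measurable A -> M A.
Proof.
move=> wd ys yb yn sM My A; apply; split => // U Uo.
have [M0 MC MU] := sM.
have MI (F : nat -> set W) : (forall n, M (F n)) -> M (\bigcap_n F n).
  move=> MF; rewrite -[X in M X]setCK setC_bigcap -setTD; apply: (MC _).
  by apply: MU => n; rewrite -setTD; exact: MC.
have Mcl x r : M [set z | `|z - x| <= r].
  have -> : [set z | `|z - x| <= r] = \bigcap_n [set z | y n z <= r + y n x].
    apply/seteqP; split => [z /= zx n _ /=|z /= h].
      have := yb n (z - x); rewrite (scalarB (ys n)) ler_norml => /andP[_]; lra.
    by apply: yn => n; rewrite (scalarB (ys n)); have := h n I; rewrite /=; lra.
  exact: MI.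
pose Q n k := [set z | `|z - w n| <= k.+1%:R^-1].
have -> : U = \bigcup_n \bigcup_k (if `[< Q n k `<=` U >] then Q n k else set0).
  apply/seteqP; split => [x Ux|x [n _ [k _]]]; last first.
    by case: asboolP => // h /h.
  have /nbhs_normP[e /= e0 he] : nbhs x U by exact: open_nbhs_nbhs.
  have [k ke] : exists k : nat, k.+1%:R^-1 < e / 2.
    have e2 : 0 < e / 2 by lra.
    by have [k _ hk] := near_infty_natSinv_lt (PosNum e2); exists k; apply: (hk k) => /=.
  have [|n xn] := wd x k.+1%:R^-1; first by rewrite invr_gt0.
  exists n => //; exists k => //; case: asboolP => [_|]; first exact: ltW.
  case=> z /= zn; apply: he => /=.
  have := zn; rewrite /Q /= => zn'.
  have -> : x - z = (x - w n) - (z - w n) by rewrite opprB addrA subrK.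
  apply: le_lt_trans (ler_normB _ _) _.
  by rewrite (splitr e) ltrD ?(lt_trans xn)// (le_lt_trans zn').
by apply: (MU _) => n; apply: (MU _) => k; case: asboolP => _; [exact: Mcl|].
Qed.

End separable_norming.

Section approximation.
Context {d : measure_display} {T : measurableType d} {R : realType}.

(** The sets that elements of [A0] approximate in symmetric difference. An inequality between
    measures is not stable under complements, whereas this property is. It thus carries the
    inequality from an algebra of sets to the sigma-algebra that it generates. *)
Definition approximable (m : set T -> \bar R) (A0 : set (set T)) (N : set T) :=
  measurable N /\ forall e : R, 0 < e ->
    exists2 C, A0 C & (m ((N `\` C) `|` (C `\` N)) < e%:E)%E.

Lemma approximable_sigma_algebra (m : {measure set T -> \bar R})
    (A0 : set (set T)) : fin_num_fun m ->
  A0 `<=` measurable -> A0 set0 -> (forall C, A0 C -> A0 (~` C)) ->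
  (forall C D, A0 C -> A0 D -> A0 (C `|` D)) ->
  sigma_algebra setT (approximable m A0).
Proof.
move=> mfin A0m A00 A0C A0U.
have le_m A B : measurable A -> measurable B -> A `<=` B -> (m A <= m B)%E.
  by move=> mA mB; apply: le_measure; rewrite inE.
have mD N C : measurable N -> A0 C -> measurable ((N `\` C) `|` (C `\` N)).
  by move=> mN /A0m mC; apply: measurableU; exact: measurableD.
have app0 : approximable m A0 set0.
  split => // e e0; exists set0 => //.
  by rewrite setD0 setU0 measure0 lte_fin.
have appU A B : approximable m A0 A -> approximable m A0 B ->
    approximable m A0 (A `|` B).
  move=> [mA hA] [mB hB]; split; first exact: measurableU.
  move=> e e0; have [|C AC hC] := hA (e / 2); first by lra.
  have [|D AD hD] := hB (e / 2); first by lra.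
  exists (C `|` D); first exact: A0U.
  apply: le_lt_trans (_ : _ <= m ((A `\` C) `|` (C `\` A)) +
    m ((B `\` D) `|` (D `\` B)))%E _.
    apply: le_trans (measureU2 _ _ _); [|exact: mD|exact: mD].
    apply: le_m; [by apply: mD; [exact: measurableU|exact: A0U]| |].
      by apply: measurableU; exact: mD.
    move=> x [[[Ax|Bx] /not_orP[nC nD]]|[[Cx|Dx] /not_orP[nA nB]]].
    - by left; left.
    - by right; left.
    - by left; right.
    - by right; right.
  by rewrite (splitr e) EFinD; apply: lteD.
split => //.
  move=> A [mA hA]; rewrite setTD; split; first exact: measurableC.
  move=> e e0; have [C AC hC] := hA e e0; exists (~` C); first exact: A0C.
  by rewrite !setDE !setCK setUC (setIC (~` C)) (setIC (~` A)) -!setDE.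
move=> F FD; pose U n := \big[setU/set0]_(i < n) F i.
have UD n : approximable m A0 (U n).
  elim: n => [|n ih]; first by rewrite /U big_ord0.
  by rewrite /U big_ord_recr; apply: appU => //; exact: FD.
have mF : measurable (\bigcup_n F n).
  by apply: bigcup_measurable => n _; case: (FD n).
split => // e e0.
have e2 : 0 < e / 2 by lra.
have mUn n : measurable (U n) by case: (UD n).
(* What the first n sets leave out decreases to the empty set, so its measure, being finite, tends
   to 0. This reduces countable unions to finite ones. *)
pose G n := \bigcup_i F i `\` U n.
have Gc : m (G n) @[n --> \oo] --> m (\bigcap_n G n).
  apply: nonincreasing_cvg_mu.
  - by rewrite ltey_eq mfin//; exact: measurableD.
  - by move=> n; exact: measurableD.
  - by apply: bigcap_measurable => // n _; exact: measurableD.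
  - move=> n k nk; apply/subsetPset; apply: setDS.
    exact: subset_bigsetU.
have G0 : \bigcap_n G n = set0.
  rewrite -subset0 => x Gx; have [[i _ Fi] _] := Gx 0 I.
  have [_] := Gx i.+1 I; apply; rewrite /U -bigcup_mkord; by exists i => /=.
rewrite G0 measure0 in Gc.
have [n Gn] : exists n, (m (G n) < (e / 2)%:E)%E.
  have : \forall n \near \oo, (m (G n) < (e / 2)%:E)%E.
    exact: cvge0_lt.
  by case=> n _ h; exists n; apply: h => /=.
have [_ /(_ _ e2)[C AC hC]] := UD n; exists C => //.
apply: le_lt_trans (_ : _ <= m (G n) + m ((U n `\` C) `|` (C `\` U n)))%E _.
  apply: le_trans (measureU2 _ _ _); [|exact: measurableD|exact: mD].
  apply: le_m; [exact: mD| |].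
    by apply: measurableU; [exact: measurableD|exact: mD].
  move=> x [[Fx nC]|[Cx nF]]; last first.
    right; right; split => // Ux; apply: nF.
    by move: Ux; rewrite /U -bigcup_mkord => -[i _ Fi]; exists i.
  by have [Ux|nU] := pselect (U n x); [right; left|left].
by rewrite (splitr e) EFinD; apply: lteD.
Qed.

End approximation.

(** * Quasi-invariance of Gaussian measures *)

Section affine_change_of_variable.
Context {R : realType}.

(** Lebesgue measure and s times its image under t -> c + s t agree on half-open intervals, hence
    everywhere. *)
Lemma ge0_integral_affine (s c : R) (f : R -> \bar R) : 0 < s ->
  measurable_fun setT f -> (forall x, 0 <= f x)%E ->
  (\int[lebesgue_measure]_x f x =
   s%:E * \int[lebesgue_measure]_t f (c + s * t)%R)%E.
Proof.
move=> s0 mf f0.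
pose phi (t : R) : R := c + s * t.
have mphi : measurable_fun [set: measurableTypeR R] (phi : _ -> measurableTypeR R).
  by apply: (@measurable_funD _ (measurableTypeR R)) => //; exact: measurable_funM.
pose nu := measure_function_pushforward__canonical__measure_function_Measure
  (@lebesgue_measure R) mphi.
pose mu := mscale (NngNum (ltW s0)) nu.
have ocE a b : lebesgue_measure `]a, b]%classic =
    (s%:E * lebesgue_measure (phi @^-1` `]a, b]%classic))%E.
  have -> : phi @^-1` `]a, b]%classic = `](a - c) / s, (b - c) / s]%classic.
    apply/seteqP; split => x /=; rewrite !in_itv/= /phi;
      rewrite ltr_pdivrMr// ler_pdivlMr// (mulrC x) => /andP[? ?];
      by apply/andP; split; lra.
  rewrite !lebesgue_measure_itv/= !lte_fin ltr_pM2r ?invr_gt0// ltrD2r.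
  case: ifP => _; last by rewrite mule0.
  by rewrite -!EFinD -EFinM; congr EFin; field; rewrite gt_eqF.
have muE A : measurable A -> lebesgue_measure A = mu A.
  by move=> mA; apply: lebesgue_measure_unique => // _ [[a b]] _ <-; exact: ocE.
have -> : (\int[lebesgue_measure]_x f x = \int[mu]_x f x)%E.
  by apply: eq_measure_integral => A mA _; exact: muE.
rewrite ge0_integral_mscale//; congr (_ * _)%E.
by rewrite (ge0_integral_pushforward mphi).
Qed.

End affine_change_of_variable.

Section gauss_density1.
Context {R : realType}.

Definition gauss1 (h t : R) : R :=
  (Num.sqrt (2 * pi * h))^-1 * expR (- t ^+ 2 / (2 * h)).

Lemma gauss1_ge0 h t : 0 <= gauss1 h t.
Proof. by rewrite mulr_ge0 ?expR_ge0// invr_ge0 sqrtr_ge0. Qed.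

Lemma measurable_gauss1 h : measurable_fun setT (gauss1 h).
Proof.
apply: measurable_funM => //; apply: measurableT_comp => //.
by apply: measurable_funM => //; apply: measurableT_comp.
Qed.

Lemma normal_pdf_gauss1 (c h t : R) : 0 < h ->
  normal_pdf c (Num.sqrt h) t = gauss1 h (t - c).
Proof.
move=> h0; rewrite normal_pdfE ?gt_eqF ?sqrtr_gt0//.
rewrite /normal_peak /normal_fun /gauss1 sqr_sqrtr ?ltW//.
congr (_ ^-1 * expR _).
  by congr Num.sqrt; rewrite -mulr_natl; ring.
by congr (_ / _); rewrite -mulr_natl.
Qed.

Lemma integral_gauss1 (c h : R) : 0 < h ->
  (\int[lebesgue_measure]_t (gauss1 h (t - c))%:E = 1)%E.
Proof.
move=> h0; rewrite -(integral_normal_pdf c (Num.sqrt h)).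
by apply: eq_integral => t _; rewrite normal_pdf_gauss1.
Qed.

Lemma gauss1_scale (s h t : R) : 0 < s -> 0 < h ->
  gauss1 h t = s * gauss1 (s ^+ 2 * h) (s * t).
Proof.
move=> s0 h0; rewrite /gauss1.
have -> : 2 * pi * (s ^+ 2 * h) = s ^+ 2 * (2 * pi * h) by ring.
rewrite [Num.sqrt (s ^+ 2 * _)]sqrtrM ?sqr_ge0// sqrtr_sqr gtr0_norm//.
set q := Num.sqrt _.
have -> : - (s * t) ^+ 2 / (2 * (s ^+ 2 * h)) = - t ^+ 2 / (2 * h).
  by field; rewrite !gt_eqF.
by set e := expR _; rewrite invfM !mulrA mulfV ?gt_eqF// mul1r.
Qed.

Lemma gauss1_shift (c h u : R) : 0 < h ->
  gauss1 h (u - c) = gauss1 h u * expR (c * u / h - c ^+ 2 / (2 * h)).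
Proof.
move=> h0; rewrite /gauss1; set q := (Num.sqrt _)^-1.
rewrite -[RHS]mulrA -expRD; congr (_ * expR _).
by field; rewrite gt_eqF.
Qed.

(** Completing the square. The squared quotient of the densities turns the centred Gaussian into
    exp(c^2 / h) times a Gaussian centred at 2 c, so exp(c^2 / h) is the second moment of the
    quotient. *)
Lemma gauss1_shift2 (c h u : R) : 0 < h ->
  gauss1 h u * expR (c * u / h - c ^+ 2 / (2 * h)) ^+ 2 =
  expR (c ^+ 2 / h) * gauss1 h (u - 2 * c).
Proof.
move=> h0; rewrite /gauss1; set q := (Num.sqrt _)^-1.
rewrite [expR _ ^+ 2]expr2 -expRD -[LHS]mulrA -expRD [RHS]mulrCA -expRD.
by congr (_ * expR _); field; rewrite gt_eqF.
Qed.

End gauss_density1.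

Section iter_integral_facts.
Context {R : realType}.

Lemma iter_integral_ge0 n (f : n.-tuple R -> \bar R) :
  (forall v, 0 <= f v)%E -> (0 <= iter_integral f)%E.
Proof.
elim: n f => [|n ih] f f0 /=; first exact: f0.
by apply: integral_ge0 => t _; exact: ih.
Qed.

Lemma measurable_iter_integral d (T : measurableType d) n
    (f : T * n.-tuple R -> \bar R) :
  measurable_fun setT f -> (forall x, 0 <= f x)%E ->
  measurable_fun setT (fun x => iter_integral (fun v => f (x, v))).
Proof.
elim: n d T f => [|n ih] d T f mf f0 /=.
  by apply: (measurableT_comp mf); exact: measurable_fun_pair.
pose g (p : (T * measurableTypeR R) * n.-tuple R) := f (p.1.1, [tuple of p.1.2 :: p.2]).
have mg : measurable_fun setT g.
  apply: (measurableT_comp mf); apply: measurable_fun_pair => /=.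
    by apply: measurableT_comp.
  apply: measurable_cons; last exact: measurable_snd.
  by apply: measurableT_comp.
pose G (p : T * measurableTypeR R) := iter_integral (fun v => g (p, v)).
have mG : measurable_fun setT G by apply: ih => // p; exact: f0.
apply: (measurable_fun_fubini_tonelli_F G mG (m2 := lebesgue_measure)) => p.
by apply: iter_integral_ge0 => v; exact: f0.
Qed.

Lemma iter_integralZ n (k : R) (f : n.-tuple R -> \bar R) : 0 <= k ->
  measurable_fun setT f -> (forall v, 0 <= f v)%E ->
  iter_integral (fun v => k%:E * f v)%E = (k%:E * iter_integral f)%E.
Proof.
move=> k0; elim: n f => [//|n ih] f mf f0 /=.
have mcons : measurable_fun setT
    (fun x : R * n.-tuple R => f [tuple of x.1 :: x.2]).
  by apply: (measurableT_comp mf); apply: measurable_cons.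
pose I (t : R) := iter_integral (fun v => f [tuple of t :: v]).
have mI : measurable_fun setT I by exact: (measurable_iter_integral mcons).
have I0 t : (0 <= I t)%E by exact: iter_integral_ge0.
rewrite -[X in (_ * X)%E]/(\int[lebesgue_measure]_t I t)%E.
rewrite -(ge0_integralZl lebesgue_measure measurableT mI (fun t _ => I0 t)) ?lee_fin//.
apply: eq_integral => t _; rewrite -ih//.
by apply: (measurableT_comp mf); apply: measurable_cons.
Qed.

End iter_integral_facts.

Section gauss_shift.
Context {R : realType}.

Lemma measurable_gauss_density h n : measurable_fun setT (@gauss_density R h n).
Proof.
apply: measurable_funM => //; apply: measurableT_comp => //.
apply: measurable_funM => //; apply: measurableT_comp => //.
apply: measurable_sum => k; apply: measurable_funX.
exact: measurable_tnth.
Qed.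

Lemma gauss_density_ge0 h n v : 0 <= @gauss_density R h n v.
Proof. by rewrite mulr_ge0 ?expR_ge0// invr_ge0 exprn_ge0 ?sqrtr_ge0. Qed.

Lemma gauss_density_cons h n (t : R) (v : n.-tuple R) :
  @gauss_density R h n.+1 [tuple of t :: v] = gauss1 h t * gauss_density h v.
Proof.
rewrite /gauss_density /gauss1 big_ord_recl tnth0 exprS invfM.
under eq_bigr => k _ do rewrite tnthS.
set S := \sum_(_ < _) _.
have -> : - (t ^+ 2 + S) / (2 * h) = - t ^+ 2 / (2 * h) + - S / (2 * h).
  by rewrite opprD mulrDl.
by rewrite expRD mulrACA.
Qed.

Lemma gauss_density_nil h v : @gauss_density R h 0 v = 1.
Proof.
by rewrite /gauss_density big_ord0 expr0 invr1 mul1r oppr0 mul0r expR0.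
Qed.

Definition affine_tuple n (c : n.-tuple R) (s : R) (v : n.-tuple R) :=
  [tuple tnth c k + s * tnth v k | k < n].

Lemma affine_tuple_cons n c0 (c : n.-tuple R) s t (v : n.-tuple R) :
  affine_tuple [tuple of c0 :: c] s [tuple of t :: v] =
  [tuple of (c0 + s * t) :: affine_tuple c s v].
Proof.
apply: eq_from_tnth => i; rewrite tnth_mktuple.
have [->|[j ->]] : i = ord0 \/ exists j, i = lift ord0 j.
  by case: (unliftP ord0 i) => [j ->|->]; [right; exists j|left].
  by rewrite !tnth0.
by rewrite !tnthS tnth_mktuple.
Qed.

Lemma measurable_affine_tuple n (c : n.-tuple R) s :
  measurable_fun setT (affine_tuple c s).
Proof.
apply/measurable_fun_tnthP => i.
rewrite [X in measurable_fun _ X](_ : _ = fun v => tnth c i + s * tnth v i).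
  apply: measurable_funD => //; apply: measurable_funM => //.
  exact: measurable_tnth.
by apply/funext => v /=; rewrite tnth_mktuple.
Qed.

(* A form of the Cameron-Martin theorem: [u <= lam u^2 + 1 / lam], applied to the
   quotient [u] of the densities of the two Gaussian laws. *)
Lemma iter_gauss_shift_le n (c : n.-tuple R) (s h lam : R) (f : n.-tuple R -> R) :
  0 < s -> 0 < h -> 0 < lam -> measurable_fun setT f -> (forall v, 0 <= f v <= 1) ->
  (iter_integral (fun v => (gauss_density h v * f (affine_tuple c s v))%:E) <=
   (lam * expR (\sum_(k < n) tnth c k ^+ 2 / (s ^+ 2 * h)))%:E +
   lam^-1%:E * iter_integral (fun v => (gauss_density (s ^+ 2 * h) v * f v)%:E))%E.
Proof.
move=> s0 h0; have sh0 : 0 < s ^+ 2 * h by rewrite mulr_gt0// exprn_gt0.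
elim: n c lam f => [|n ih] c lam f lam0 mf f01 /=.
  rewrite big_ord0 expR0 mulr1 !gauss_density_nil !mul1r.
  have -> : affine_tuple c s [tuple] = [tuple] by exact: tuple0.
  have /andP[fa fb] := f01 [tuple]; rewrite -EFinM -EFinD lee_fin.
  (* In dimension 0 the claim is f <= lam + f / lam for f <= 1: the first term suffices if lam >= 1,
     the second otherwise. *)
  have [l1|l1] := leP 1 lam.
    rewrite (le_trans fb)// (le_trans l1)// lerDl mulr_ge0// invr_ge0 ltW//.
  rewrite -[leLHS]mul1r -[leLHS]add0r lerD ?(ltW lam0)// ler_wpM2r//.
  by rewrite invf_ge1// ltW.
case/tupleP: c => c0 c.
pose J u := iter_integral (fun v : n.-tuple R =>
  (gauss_density h v * f [tuple of u :: affine_tuple c s v])%:E).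
pose g u := iter_integral (fun v : n.-tuple R =>
  (gauss_density (s ^+ 2 * h) v * f [tuple of u :: v])%:E).
pose D u := expR (c0 * u / (s ^+ 2 * h) - c0 ^+ 2 / (2 * (s ^+ 2 * h))).
pose K := expR (\sum_(k < n) tnth c k ^+ 2 / (s ^+ 2 * h)).
have f0 v : 0 <= f v by case/andP: (f01 v).
have D0 u : 0 < D u by exact: expR_gt0.
(* [D u] is the quotient of the densities in the first coordinate. The induction hypothesis is used
   with [lam * D u] for [lam]: once multiplied by the density shifted by [c0], which contains a
   factor [D u], the first term carries the square of [D u], covered by [gauss1_shift2], and in the
   second [D u] cancels. *)
have JD u : (J u <= (lam * D u * K)%:E + (lam * D u)^-1%:E * g u)%E.
  apply: (ih c (lam * D u) (fun v => f [tuple of u :: v])).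
  - by rewrite mulr_gt0.
  - by apply: (measurableT_comp mf); exact: measurable_cons.
  - by move=> v; exact: f01.
have mfc : measurable_fun setT (fun p : R * n.-tuple R =>
    (gauss_density h p.2 * f [tuple of p.1 :: affine_tuple c s p.2])%:E).
  apply/measurable_EFinP; apply: measurable_funM.
    by apply: measurableT_comp => //; exact: measurable_gauss_density.
  apply: (measurableT_comp mf); apply: measurable_cons => //.
  by apply: measurableT_comp => //; exact: measurable_affine_tuple.
have mfg : measurable_fun setT (fun p : R * n.-tuple R =>
    (gauss_density (s ^+ 2 * h) p.2 * f [tuple of p.1 :: p.2])%:E).
  apply/measurable_EFinP; apply: measurable_funM.
    by apply: measurableT_comp => //; exact: measurable_gauss_density.
  by apply: (measurableT_comp mf); apply: measurable_cons.
have mJ : measurable_fun setT J.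
  apply: (measurable_iter_integral mfc) => p.
  by rewrite lee_fin mulr_ge0 ?gauss_density_ge0.
have mg : measurable_fun setT g.
  apply: (measurable_iter_integral mfg) => p.
  by rewrite lee_fin mulr_ge0 ?gauss_density_ge0.
have J0 u : (0 <= J u)%E.
  by apply: iter_integral_ge0 => v; rewrite lee_fin mulr_ge0 ?gauss_density_ge0.
have g0 u : (0 <= g u)%E.
  by apply: iter_integral_ge0 => v; rewrite lee_fin mulr_ge0 ?gauss_density_ge0.
pose Psi u := ((gauss1 (s ^+ 2 * h) (u - c0))%:E * J u)%E.
have Psi0 u : (0 <= Psi u)%E by rewrite mule_ge0// lee_fin gauss1_ge0.
have mPsi : measurable_fun setT Psi.
  apply: emeasurable_funM => //; apply/measurable_EFinP.
  by apply: measurableT_comp; [exact: measurable_gauss1|exact: measurable_funB].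
have mD : measurable_fun setT D.
  apply: measurableT_comp => //; apply: measurable_funB => //.
  by apply: measurable_funM => //; exact: measurable_funM.
have -> : (\int[lebesgue_measure]_t iter_integral (fun v : n.-tuple R =>
      (gauss_density h [tuple of t :: v] *
       f (affine_tuple [tuple of c0 :: c] s [tuple of t :: v]))%:E) =
    \int[lebesgue_measure]_u Psi u)%E.
  rewrite [RHS](@ge0_integral_affine _ s c0)//.
  rewrite -ge0_integralZl//; last 2 first.
  - by apply: (measurableT_comp mPsi); apply: measurable_funD => //; exact: measurable_funM.
  - by rewrite lee_fin ltW.
  apply: eq_integral => t _; rewrite /Psi addrAC subrr add0r muleA -EFinM.
  rewrite -gauss1_scale// -iter_integralZ ?gauss1_ge0//.
  - congr iter_integral; apply/funext => v.
    rewrite gauss_density_cons -EFinM; congr EFin; rewrite -mulrA.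
    by congr (_ * (_ * f _)); exact: affine_tuple_cons.
  - exact: (measurableT_comp mfc (measurable_pair1 (c0 + s * t : R))).
  - by move=> v; rewrite lee_fin mulr_ge0 ?gauss_density_ge0.
have -> : (\int[lebesgue_measure]_t iter_integral (fun v : n.-tuple R =>
      (gauss_density (s ^+ 2 * h) [tuple of t :: v] * f [tuple of t :: v])%:E) =
    \int[lebesgue_measure]_u ((gauss1 (s ^+ 2 * h) u)%:E * g u))%E.
  apply: eq_integral => t _; rewrite -iter_integralZ ?gauss1_ge0//.
  - congr iter_integral; apply/funext => v.
    by rewrite gauss_density_cons -EFinM -mulrA.
  - exact: (measurableT_comp mfg (measurable_pair1 (t : R))).
  - by move=> v; rewrite lee_fin mulr_ge0 ?gauss_density_ge0.
pose A u := ((lam * K * expR (c0 ^+ 2 / (s ^+ 2 * h)))%:E *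
  (gauss1 (s ^+ 2 * h) (u - 2 * c0))%:E)%E.
pose Bu u := (lam^-1%:E * ((gauss1 (s ^+ 2 * h) u)%:E * g u))%E.
have mA : measurable_fun setT A.
  apply/measurable_EFinP; apply: measurable_funM => //.
  by apply: measurableT_comp; [exact: measurable_gauss1|exact: measurable_funB].
have mgg : measurable_fun setT (fun u => (gauss1 (s ^+ 2 * h) u)%:E * g u)%E.
  by apply: emeasurable_funM => //; apply/measurable_EFinP; exact: measurable_gauss1.
have mB : measurable_fun setT Bu by exact: emeasurable_funM.
have lamK : 0 <= lam * K * expR (c0 ^+ 2 / (s ^+ 2 * h)).
  by rewrite !mulr_ge0 ?expR_ge0// ltW.
have A0 u : (0 <= A u)%E by rewrite mule_ge0// lee_fin// gauss1_ge0.
have B0 u : (0 <= Bu u)%E.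
  by rewrite !mule_ge0// lee_fin ?gauss1_ge0// invr_ge0 ltW.
apply: (@le_trans _ _ (\int[lebesgue_measure]_u (A u + Bu u))%E).
  apply: ge0_le_integral => //.
  - exact: emeasurable_funD.
  - move=> u _; rewrite /Psi.
    apply: le_trans (lee_wpmul2l _ (JD u)) _; first by rewrite lee_fin gauss1_ge0.
    rewrite gauss1_shift// -/(D u) muleDr//.
    apply: leeD.
      rewrite -!EFinM lee_fin.
      rewrite [leRHS](_ : _ = lam * K * (gauss1 (s ^+ 2 * h) u * D u ^+ 2)).
        by apply: le_of_eq; ring.
      by rewrite gauss1_shift2//; ring.
    rewrite /Bu !muleA -!EFinM lee_wpmul2r// lee_fin.
    by apply: le_of_eq; field; rewrite !gt_eqF.
rewrite ge0_integralD//; apply: leeD.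
  rewrite ge0_integralZl//.
  - rewrite integral_gauss1// mule1 lee_fin big_ord_recl tnth0.
    under eq_bigr => k _ do rewrite tnthS.
    by rewrite expRD -/K; apply: le_of_eq; ring.
  - apply/measurable_EFinP.
    by apply: measurableT_comp; [exact: measurable_gauss1|exact: measurable_funB].
  - by move=> u _; rewrite lee_fin gauss1_ge0.
rewrite ge0_integralZl// ?lee_fin ?invr_ge0 ?(ltW lam0)//.
by move=> u _; rewrite mule_ge0// lee_fin gauss1_ge0.
Qed.

Lemma gauss_law_shift_le n (c : n.-tuple R) (s h lam : R) (A : set (n.-tuple R)) :
  0 < s -> 0 < h -> 0 < lam -> measurable A ->
  (gauss_law h (affine_tuple c s @^-1` A) <=
   (lam * expR (\sum_(k < n) tnth c k ^+ 2 / (s ^+ 2 * h)))%:E +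
   lam^-1%:E * gauss_law (s ^+ 2 * h) A)%E.
Proof.
move=> s0 h0 lam0 mA.
have := @iter_gauss_shift_le n c s h lam (\1_A) s0 h0 lam0.
apply; first exact: measurable_indic.
by move=> v; rewrite indicE; case: (_ \in _); rewrite ?ler01 lexx.
Qed.

End gauss_shift.

(** * Orthonormal families of functionals and cylinder sets *)

Section orthonormal_seq.
Context {R : realType} {V : lmodType R} (ip : {dot V for idfun}).

Lemma orthonormal_consE v s : orthonormal ip (v :: s) =
  [&& ip v v == 1, all (fun u => ip v u == 0) s & orthonormal ip s].
Proof. by rewrite /orthonormal /= andbT -!andbA; do !bool_congr. Qed.

Lemma orthonormal_consP v s : reflect
  [/\ ip v v = 1, forall u, u \in s -> ip v u = 0 & orthonormal ip s]
  (orthonormal ip (v :: s)).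
Proof.
rewrite orthonormal_consE; apply: (iffP and3P) => [[/eqP vv /allP vs os]|[vv vs os]].
  by split => // u /vs /eqP.
by split; [exact/eqP|apply/allP => u /vs ->|].
Qed.

Lemma dot_orthonormal_projection s a b : orthonormal ip s -> b \in s ->
  ip b (\sum_(u <- s) ip u a *: u) = ip b a.
Proof.
elim: s => // v s ih /orthonormal_consP[vv vs os].
rewrite inE big_cons dotDr dotZr => /predU1P[->|bs].
  rewrite vv mulr1 dot_sumr big_seq big1 ?addr0// => u us.
  by rewrite dotZr vs// mulr0.
by rewrite (dotC ip b v) (vs b)// mulr0 add0r ih.
Qed.

Lemma bessel s x : orthonormal ip s -> \sum_(u <- s) ip u x ^+ 2 <= ip x x.
Proof.
elim: s x => [|v s ih] x; first by rewrite big_nil dot_ge0.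
move=> /orthonormal_consP[vv vs os]; rewrite big_cons.
have := ih (x - ip v x *: v) os.
rewrite (eq_big_seq (fun u => ip u x ^+ 2)) => [|u us]; last first.
  by rewrite dotDr dotNr dotZr (dotC ip u v) (vs u)// mulr0 oppr0 addr0.
rewrite !(dotDl, dotDr, dotNl, dotNr, dotZl, dotZr) vv (dotC ip x v).
set S := \sum_(_ <- _) _; set p := ip v x; set q := ip x x; nra.
Qed.

End orthonormal_seq.

Section borel_measurability.
Context {R : realType}.

Lemma continuous_borel_measurable (V1 V2 : normedModType R) (f : V1 -> V2) :
  continuous f -> measurable_fun setT (f : borel V1 -> borel V2).
Proof.
move=> /continuousP cf; apply: (@measurability _ _ (borel V1) (borel V2) _ _ (@open V2)) => //.
by move=> _ [U Uo <-]; rewrite setTI; apply: sub_sigma_algebra; exact: cf.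
Qed.

Lemma continuous_borel_measurableR (V : normedModType R) (f : V -> R) :
  continuous f -> measurable_fun setT (f : borel V -> R).
Proof.
move=> /continuousP cf.
apply: (@measurability _ _ (borel V) R _ _ _ (RGenOpens.measurableE R)) => //.
move=> _ [_ [a [b ->]] <-]; rewrite setTI; apply: sub_sigma_algebra; apply: cf.
exact: interval_open.
Qed.

End borel_measurability.

Section dual_vectors.
Context {R : realType} {V W : normedModType R} (ip : {dot V for idfun}).
Variable iota : V -> W.
Hypothesis iota_dense : dense (range iota).

Let dual := dual_vector ip iota.

Lemma dual_vector0 : dual (cst 0) 0.
Proof.
by split => [a u v||x]; [rewrite mulr0 addr0|exact: cst_continuous|rewrite dot0l].
Qed.

Lemma dual_vectorZD (c : R) y a z b : dual y a -> dual z b ->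
  dual (fun x => c * y x + z x) (c *: a + b).
Proof.
move=> [ys yc ya] [zs zc zb]; split => [k u v|x|x].
- by rewrite (scalarD ys) (scalarZ ys) (scalarD zs) (scalarZ zs) /=; ring.
- by apply: cvgD; [apply: cvgMr; exact: yc|exact: zc].
- by rewrite ya zb dotDl dotZl.
Qed.

Lemma dual_vector_unique y z a x : dual y a -> dual z a -> y x = z x.
Proof.
move=> [ys yc ya] [zs zc za].
have dc : continuous (y - z) by move=> t; apply: continuousB; [exact: yc|exact: zc].
apply/eqP; rewrite -subr_eq0; apply/negPn/negP => yz.
have [||w [/= yzO [v _ vw]]] := iota_dense (O := (y - z) @^-1` [set r | r != 0]).
- by exists x.
- move/continuousP : dc; apply; exact: open_neq.
by move: yzO; rewrite -vw !fctE ya za subrr eqxx.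
Qed.

Fixpoint dual_family (M : seq ((W -> R) * V)) : Prop :=
  if M is q :: M' then dual q.1 q.2 /\ dual_family M' else True.

Lemma dual_family_nth M k : dual_family M -> (k < size M)%N ->
  dual (nth (cst 0, 0) M k).1 (nth (cst 0, 0) M k).2.
Proof. by elim: M k => // q M ih [|k] [dq dM]//= kM; exact: ih. Qed.

Definition in_span (M : seq ((W -> R) * V)) (y : W -> R) : Prop :=
  exists c : nat -> R, forall x,
    y x = \sum_(j < size M) c j * (nth (cst 0, 0) M j).1 x.

Lemma in_span_cons q M y : in_span M y -> in_span (q :: M) y.
Proof.
move=> [c cE]; exists (fun j => if j is j'.+1 then c j' else 0) => x.
by rewrite big_ord_recl /= mul0r add0r cE.
Qed.

Lemma dual_projection M a : dual_family M -> exists y,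
  [/\ dual y (\sum_(u <- map snd M) ip u a *: u) & in_span M y].
Proof.
elim: M => [_|q M ih [dq /ih [y [dy [c cE]]]]].
  exists (cst 0); rewrite big_nil; split; first exact: dual_vector0.
  by exists (fun=> 0) => x; rewrite big_ord0.
exists (fun x => ip q.2 a * q.1 x + y x); split.
  by rewrite /= big_cons; exact: dual_vectorZD.
exists (fun j => if j is j'.+1 then c j' else ip q.2 a) => x.
by rewrite big_ord_recl /= cE.
Qed.

(** Functionals and vectors are orthonormalised together, because [gaussian_measure] describes only
    orthonormal vectors that come from functionals. If the residual vector is 0, the residual
    functional vanishes on the dense range of [iota], hence everywhere, and the family is left as it
    is. *)
Lemma gram_schmidt (y : nat -> W -> R) (a : nat -> V) n :
  (forall k, (k < n)%N -> dual (y k) (a k)) -> exists M : seq ((W -> R) * V),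
  [/\ dual_family M, orthonormal ip (map snd M) &
    forall k, (k < n)%N -> in_span M (y k)].
Proof.
elim: n => [_|n ih dy]; first by exists [::].
have [|M [dM oM sM]] := ih; first by move=> k kn; apply: dy; exact: ltnW.
have [z [dz sz]] := dual_projection (a n) dM.
have dyn := dy n (ltnSn n).
pose r := a n - \sum_(u <- map snd M) ip u (a n) *: u.
have dr : dual (fun x => y n x - z x) r.
  have := dual_vectorZD (-1) dz dyn; rewrite /r scaleN1r addrC.
  by congr dual; apply/funext => x; ring.
have [r0|rN0] := eqVneq r 0.
  exists M; split => // k; rewrite ltnS leq_eqVlt => /predU1P[->|/sM//].
  case: sz => c cE; exists c => x; rewrite -cE; apply/eqP; rewrite -subr_eq0.
  rewrite r0 in dr; apply/eqP; exact: (dual_vector_unique _ dr dual_vector0).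
pose l := Num.sqrt (ip r r).
have rr : 0 < ip r r by exact: dot_gt0.
have l0 : 0 < l by rewrite sqrtr_gt0.
have ll : l ^+ 2 = ip r r by rewrite sqr_sqrtr// ltW.
exists ((fun x => l^-1 * (y n x - z x), l^-1 *: r) :: M); split => /=.
- split => //; have := dual_vectorZD l^-1 dr dual_vector0; rewrite addr0.
  by congr dual; apply/funext => x; rewrite addr0.
- apply/orthonormal_consP; split => //.
    by rewrite dotZl dotZr -ll; field; rewrite gt_eqF.
  move=> u us; rewrite dotZl dotC /r dotDr dotNr dot_orthonormal_projection//.
  by rewrite subrr mulr0.
- move=> k; rewrite ltnS leq_eqVlt => /predU1P[->|/sM h]; last exact: in_span_cons.
  case: sz => c cE; exists (fun j => if j is j'.+1 then c j' else l) => x.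
  rewrite big_ord_recl /= -cE; field; rewrite ?gt_eqF//.
Qed.

End dual_vectors.

Section cylinders.
Context {R : realType} {V W : normedModType R} (ip : {dot V for idfun}).
Variable iota : V -> W.
Hypothesis iota_dense : dense (range iota).

Definition cylinder (C : set W) : Prop :=
  exists n (a : n.-tuple V) (y : 'I_n -> W -> R) (A : set (n.-tuple R)),
  [/\ forall k, dual_vector ip iota (y k) (tnth a k), orthonormal ip a,
      measurable A & C = [set x | A [tuple y k x | k < n]]].

(** Cylinders are defined over orthonormal families, the ones whose law is given. This lifts the
    restriction by an orthonormalisation and a linear change of coordinates, so that two cylinders
    over unrelated families have a common description and the cylinders form an algebra. *)
Lemma cylinder_preimage n (y : 'I_n -> W -> R) (a : 'I_n -> V)
    (A : set (n.-tuple R)) :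
  (forall k, dual_vector ip iota (y k) (a k)) -> measurable A ->
  cylinder [set x | A [tuple y k x | k < n]].
Proof.
(* The empty family is already orthonormal; [inord] below asks for a nonempty index type. *)
case: n y a A => [|n] y a A ya mA.
  exists 0%N, [tuple], y, A; split => // -[] //.
have [|M [dM oM sM]] := @gram_schmidt R V W ip iota iota_dense
    (fun k => y (inord k)) (fun k => a (inord k)) n.+1.
  by move=> k kn; exact: ya.
have /choice [c cE] k : exists c : nat -> R, forall x,
    y k x = \sum_(j < size M) c j * (nth (cst 0, 0) M j).1 x.
  by have [c cE] := sM k (ltn_ord k); exists c => x; rewrite -cE inord_val.
pose L (v : (size M).-tuple R) :=
  [tuple \sum_(j < size M) c k j * tnth v j | k < n.+1].
have mL : measurable_fun setT L.
  apply/measurable_fun_tnthP => k.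
  rewrite [X in measurable_fun _ X](_ : _ =
      fun v => \sum_(j < size M) c k j * tnth v j); last first.
    by apply/funext => v /=; rewrite tnth_mktuple.
  apply: measurable_sum => j; apply: measurable_funM => //.
  exact: measurable_tnth.
exists (size M), (map_tuple snd (in_tuple M)),
  (fun k => (nth (cst 0, 0) M k).1), (L @^-1` A); split => //.
- move=> k; rewrite tnth_map (tnth_nth (cst 0, 0)) /=.
  exact: dual_family_nth.
- by rewrite -[X in measurable X]setTI; exact: mL.
apply/seteqP; split => x /=; congr (A _); apply: eq_from_tnth => k.
  rewrite !tnth_mktuple cE; apply: eq_bigr => j _.
  by rewrite tnth_mktuple.
rewrite !tnth_mktuple cE; apply: eq_bigr => j _.
by rewrite tnth_mktuple.
Qed.

Lemma cylinder0 : cylinder set0.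
Proof.
exists 0%N, [tuple], (fun=> cst 0), set0; split => // -[] //.
Qed.

Lemma cylinderC C : cylinder C -> cylinder (~` C).
Proof.
move=> [n [a [y [A [ya oa mA ->]]]]]; exists n, a, y, (~` A); split => //.
exact: measurableC.
Qed.

Lemma cylinderU C D : cylinder C -> cylinder D -> cylinder (C `|` D).
Proof.
move=> [n [a [y [A [ya _ mA ->]]]]] [m [b [z [B [zb _ mB ->]]]]].
pose yz (k : 'I_(n + m)) := match fintype.split k with inl i => y i | inr j => z j end.
pose ab (k : 'I_(n + m)) :=
  match fintype.split k with inl i => tnth a i | inr j => tnth b j end.
pose pl (v : (n + m).-tuple R) := [tuple tnth v (lshift m i) | i < n].
pose pr (v : (n + m).-tuple R) := [tuple tnth v (rshift n i) | i < m].
have mpl : measurable_fun setT pl.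
  apply/measurable_fun_tnthP => i.
  rewrite [X in measurable_fun _ X](_ : _ = @tnth _ _ ^~ (lshift m i)).
    exact: measurable_tnth.
  by apply/funext => v /=; rewrite tnth_mktuple.
have mpr : measurable_fun setT pr.
  apply/measurable_fun_tnthP => i.
  rewrite [X in measurable_fun _ X](_ : _ = @tnth _ _ ^~ (rshift n i)).
    exact: measurable_tnth.
  by apply/funext => v /=; rewrite tnth_mktuple.
have := @cylinder_preimage _ yz ab (pl @^-1` A `|` pr @^-1` B).
have -> : [set x | (pl @^-1` A `|` pr @^-1` B) [tuple yz k x | k < n + m]] =
    [set x | A [tuple y k x | k < n]] `|` [set x | B [tuple z k x | k < m]].
  have plE x : pl [tuple yz k x | k < n + m] = [tuple y k x | k < n].
    by apply: eq_from_tnth => i; rewrite !tnth_mktuple /yz (unsplitK (inl i : 'I_n + 'I_m)).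
  have prE x : pr [tuple yz k x | k < n + m] = [tuple z k x | k < m].
    by apply: eq_from_tnth => i; rewrite !tnth_mktuple /yz (unsplitK (inr i : 'I_n + 'I_m)).
  by apply/seteqP; split => x /=; rewrite plE prE.
apply.
  by move=> k; rewrite /yz /ab; case: fintype.split.
apply: measurableU; first by rewrite -[X in measurable X]setTI; exact: mpl.
by rewrite -[X in measurable X]setTI; exact: mpr.
Qed.

Lemma cylinder_le y a r : dual_vector ip iota y a -> cylinder [set x | y x <= r].
Proof.
move=> ya; have := @cylinder_preimage 1 (fun=> y) (fun=> a)
  [set v | tnth v ord0 <= r] (fun=> ya).
have -> : [set x | [set v : 1.-tuple R | tnth v ord0 <= r] [tuple y x | _ < 1]] =
    [set x | y x <= r] by apply/seteqP; split => x /=; rewrite tnth_mktuple.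
apply; rewrite (_ : [set _ | _] = (@tnth _ _ ^~ ord0) @^-1` `]-oo, r]%classic).
  by rewrite -[X in measurable X]setTI; apply: measurable_tnth.
by apply/seteqP; split => v /=; rewrite in_itv.
Qed.

Lemma measurable_cylinder C : cylinder C -> measurable (C : set (borel W)).
Proof.
move=> [n [a [y [A [ya _ mA ->]]]]].
have my : measurable_fun setT (fun x : borel W => [tuple y k x | k < n]).
  apply/measurable_fun_tnthP => i.
  rewrite [X in measurable_fun _ X](_ : _ = y i).
    by apply: continuous_borel_measurableR; case: (ya i).
  by apply/funext => v /=; rewrite tnth_mktuple.
by rewrite -[X in measurable X]setTI; exact: my.
Qed.

End cylinders.

Section quasi_invariance.
Context {R : realType} {V W : normedModType R} (ip : {dot V for idfun}).
Variable iota : V -> W.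
Hypothesis iota_dense : dense (range iota).
Hypothesis W_separable :
  exists w : nat -> W, forall x e, 0 < e -> exists n, `|x - w n| < e.
Hypothesis W_dual : forall y : W -> R, scalar y -> continuous y ->
  exists a, forall x, y (iota x) = ip a x.

Lemma affine_continuous (x0 : W) (s : R) : continuous (fun Y : W => x0 + s *: Y).
Proof. by move=> Y; apply: cvgD; [exact: cvg_cst|exact: cvgZr]. Qed.

(** On a cylinder over an orthonormal family [a], the map Y -> iota X + s Y acts on coordinates as
    an affine map whose translation part consists of the coordinates of [X]. Bessel's inequality
    bounds their squares by |X|^2, so the constant is the same for all cylinders and approximation
    gives every Borel set. *)
Lemma gaussian_quasi_invariance (s h lam : R) (X : V)
    (mu nu : probability (borel W) R) (N : set (borel W)) :
  0 < s -> 0 < h -> 0 < lam ->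
  gaussian_measure ip iota h mu -> gaussian_measure ip iota (s ^+ 2 * h) nu ->
  measurable N ->
  (mu [set Y | N (iota X + s *: Y)%R] <=
   (lam * expR (ip X X / (s ^+ 2 * h)))%:E + lam^-1%:E * nu N)%E.
Proof.
move=> s0 h0 lam0 gmu gnu mN; have sh0 : 0 < s ^+ 2 * h by rewrite mulr_gt0// exprn_gt0.
pose phi (Y : borel W) : borel W := iota X + s *: Y.
have mphi : measurable_fun setT phi.
  by apply: continuous_borel_measurable; exact: affine_continuous.
pose K := expR (ip X X / (s ^+ 2 * h)).
have cyl C : cylinder ip iota C ->
    (mu (phi @^-1` C) <= (lam * K)%:E + lam^-1%:E * nu C)%E.
  move=> [n [a [y [A [ya oa mA ->]]]]].
  pose c := [tuple ip (tnth a k) X | k < n].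
  have -> : phi @^-1` [set x | A [tuple y k x | k < n]] =
      [set x | (affine_tuple c s @^-1` A) [tuple y k x | k < n]].
    have E x : [tuple y k (phi x) | k < n] = affine_tuple c s [tuple y k x | k < n].
      apply: eq_from_tnth => k; rewrite !tnth_mktuple.
      by have [ys _ ye] := ya k; rewrite (scalarD ys) (scalarZ ys) ye.
    by apply/seteqP; split => x /=; rewrite E.
  have -> : mu [set x | (affine_tuple c s @^-1` A) [tuple y k x | k < n]] =
      gauss_law h (affine_tuple c s @^-1` A).
    apply: (gmu n a y ya oa).
    by rewrite -[X in measurable X]setTI; exact: measurable_affine_tuple.
  have -> : nu [set x | A [tuple y k x | k < n]] = gauss_law (s ^+ 2 * h) A.
    exact: gnu.
  apply: le_trans (gauss_law_shift_le _ s0 h0 lam0 mA) _.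
  rewrite leeD2r// lee_fin ler_pM2l// ler_expR -mulr_suml ler_pM2r ?invr_gt0//.
  apply: le_trans (bessel X oa).
  by rewrite [leRHS]big_tuple; under eq_bigr => k _ do rewrite tnth_mktuple.
have mphiI D : measurable D -> measurable (phi @^-1` D).
  by move=> ?; rewrite -[X in measurable X]setTI; exact: mphi.
(* The sum of the two measures, so that one cylinder approximates [N] for both at once. *)
pose m : {measure set (borel W) -> \bar R} := measure_add
  (measure_function_pushforward__canonical__measure_function_Measure mu mphi) nu.
have mE C : m C = (mu (phi @^-1` C) + nu C)%E by exact: measure_addE.
have mfin : fin_num_fun m.
  by move=> C mC; rewrite mE fin_numD !fin_num_measure//; exact: mphiI.
have sA : sigma_algebra setT (approximable m (cylinder ip iota)).
  apply: approximable_sigma_algebra => //.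
  - exact: measurable_cylinder.
  - exact: cylinder0.
  - exact: cylinderC.
  - exact: cylinderU.
have [w wd] := W_separable; have [y [ys yb yn]] := norming_sequence wd.
have yc n : continuous (y n).
  by apply: (scalar_continuous (ys n) (K := 1)) => x; rewrite mul1r.
have [_ hN] : approximable m (cylinder ip iota) N.
  apply: (borel_norming_generated wd ys yb yn sA _ mN) => n r.
  have [a ya] := W_dual (ys n) (yc n).
  have cy : cylinder ip iota [set x | y n x <= r] by exact: (cylinder_le _ (a := a)).
  split; first exact: measurable_cylinder cy.
  move=> e e0; exists [set x | y n x <= r] => //.
  by rewrite !setDv setU0 measure0 lte_fin.
apply/lee_addgt0Pr => e e0.
(* An error d is made in the image of [mu] and an error d / lam through [nu]. *)
pose d := e / (1 + lam^-1).
have l1 : 0 < 1 + lam^-1 by rewrite addr_gt0// invr_gt0.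
have d0 : 0 < d by rewrite divr_gt0.
have [C cC hC] := hN d d0.
have mC := measurable_cylinder cC.
have mD : measurable ((N `\` C) `|` (C `\` N)).
  by apply: measurableU; exact: measurableD.
have hC2 : (mu (phi @^-1` ((N `\` C) `|` (C `\` N))) +
    nu ((N `\` C) `|` (C `\` N)) < d%:E)%E by rewrite -mE.
have muN : (mu (phi @^-1` N) <= mu (phi @^-1` C) + d%:E)%E.
  apply: le_trans (_ : _ <= mu (phi @^-1` C) + mu (phi @^-1` ((N `\` C) `|` (C `\` N))))%E _.
    apply: le_trans (measureU2 _ _ _); [|exact: mphiI..].
    apply: le_measure; rewrite ?inE; [exact: mphiI|by apply: measurableU; exact: mphiI|].
    move=> x Nx; have [Cx|nC] := pselect (C (phi x)); first by left.
    by right; left.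
  by rewrite leeD2l//; apply: le_trans (ltW hC2); rewrite leeDl.
have nuC : (nu C <= nu N + d%:E)%E.
  apply: le_trans (_ : _ <= nu N + nu ((N `\` C) `|` (C `\` N)))%E _.
    apply: le_trans (measureU2 _ _ _) => //.
    apply: le_measure; rewrite ?inE//; first by apply: measurableU.
    move=> x Nx; have [Cx|nC] := pselect (N x); first by left.
    by right; right.
  by rewrite leeD2l//; apply: le_trans (ltW hC2); rewrite leeDr.
apply: le_trans muN _; apply: le_trans (leeD (cyl _ cC) (lexx _)) _.
have nuN : nu N \is a fin_num by exact: fin_num_measure.
have nuCf : nu C \is a fin_num by exact: fin_num_measure.
move: nuC; rewrite -(fineK nuN) -(fineK nuCf) -?EFinM -!EFinD -?EFinM -?EFinD !lee_fin => nuC.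
have : lam^-1 * fine (nu C) <= lam^-1 * (fine (nu N) + d) by rewrite ler_pM2l ?invr_gt0.
have : d * (1 + lam^-1) = e by rewrite /d divfK// gt_eqF.
rewrite mulrDr mulr1 (mulrDr lam^-1) (mulrC d) -/K => <- h1.
by move: h1; set u := lam^-1 * _; set v := lam^-1 * _; set q := lam^-1 * d; lra.
Qed.

End quasi_invariance.

(** * Moments of the linear functionals *)

Section gauss_moments.
Context {R : realType}.

(** The change of density holds for the Radon-Nikodym derivative of [normal_prob], and this
    derivative is almost everywhere [gauss1], both having the same integral over every measurable
    set. *)
Lemma ge0_integral_normal_prob (h : R) (f : R -> \bar R) : 0 < h ->
  measurable_fun setT f -> (forall t, 0 <= f t)%E ->
  (\int[normal_prob 0 (Num.sqrt h)]_t f t =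
   \int[lebesgue_measure]_t (f t * (gauss1 h t)%:E))%E.
Proof.
move=> h0 mf f0; have dom := normal_prob_dominates 0 (Num.sqrt h).
rewrite -(Radon_Nikodym_SigmaFinite.change_of_variables dom f0)//.
have mg : measurable_fun setT (fun t => (gauss1 h t)%:E).
  by apply/measurable_EFinP; exact: measurable_gauss1.
have RN := integral_ae_eq measurableT
  (Radon_Nikodym_SigmaFinite.f_integrable dom) mg.
apply: ge0_ae_eq_integral => //.
- apply: emeasurable_funM => //.
  exact: measurable_int (Radon_Nikodym_SigmaFinite.f_integrable dom).
- exact: emeasurable_funM.
- by move=> t _; rewrite mule_ge0// Radon_Nikodym_SigmaFinite.f_ge0.
- by move=> t _; rewrite mule_ge0// lee_fin gauss1_ge0.
apply: ae_eqe_mul2l; apply: RN => E _ mE.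
rewrite -(Radon_Nikodym_SigmaFinite.f_integral dom)// /normal_prob.
by apply: eq_integral => t _; rewrite normal_pdf_gauss1// subr0.
Qed.

(** The n-th power of x / n <= exp(x / n). *)
Lemma expn_le_expR (x : R) n : 0 <= x -> x ^+ n <= n%:R ^+ n * expR x.
Proof.
move=> x0; case: n => [|n]; first by rewrite !expr0 mul1r -expR0 ler_expR.
have n0 : 0 < n.+1%:R :> R by [].
rewrite -ler_pdivrMl ?exprn_gt0// mulrC -expr_div_n.
have -> : expR x = expR (x / n.+1%:R) ^+ n.+1.
  by rewrite -expRM_natl mulrC divfK ?gt_eqF.
apply: lerXn2r; rewrite ?nnegrE ?expR_ge0 ?divr_ge0//.
by apply: le_trans (expR_ge1Dx _); rewrite lerDr.
Qed.

Definition gauss_moment (h : R) N : \bar R :=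
  (\int[normal_prob 0 (Num.sqrt h)]_t (t ^+ N.*2)%:E)%E.

(** The power is absorbed by half of the exponent: t^(2N) is at most a constant times exp(t^2 / (4
    h)), which turns the density of variance h into a multiple of the density of variance 2 h. The
    constant [c] collects this factor and the ratio of the two normalisations. *)
Lemma gauss_moment_fin_num (h : R) N : 0 < h -> gauss_moment h N \is a fin_num.
Proof.
move=> h0; have h4 : 0 < 4 * h by rewrite mulr_gt0.
have ev (t : R) : 0 <= t ^+ N.*2 by rewrite -mul2n exprM exprn_ge0// sqr_ge0.
rewrite ge0_fin_numE; last by apply: integral_ge0 => t _; rewrite lee_fin.
pose c := (4 * h) ^+ N * N%:R ^+ N *
  (Num.sqrt (2 * pi * h))^-1 * Num.sqrt (2 * pi * (2 * h)).
have c0 : 0 <= c by rewrite !mulr_ge0 ?invr_ge0 ?sqrtr_ge0 ?exprn_ge0// ltW.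
rewrite /gauss_moment ge0_integral_normal_prob//; last first.
  by apply/measurable_EFinP; exact: measurable_funX.
apply: le_lt_trans (_ : _ <= \int[lebesgue_measure]_t (c%:E * (gauss1 (2 * h) (t - 0))%:E))%E _.
  apply: ge0_le_integral => //.
  - by move=> t _; rewrite lee_fin mulr_ge0// gauss1_ge0.
  - apply: emeasurable_funM; first by apply/measurable_EFinP; exact: measurable_funX.
    by apply/measurable_EFinP; exact: measurable_gauss1.
  - apply/measurable_EFinP; apply: measurable_funM => //.
    by apply: measurableT_comp; [exact: measurable_gauss1|exact: measurable_funB].
  move=> t _; rewrite -!EFinM lee_fin subr0.
  have := @expn_le_expR (t ^+ 2 / (4 * h)) N.
  rewrite divr_ge0 ?sqr_ge0 ?(ltW h4)// => /(_ isT).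
  rewrite expr_div_n ler_pdivrMr ?exprn_gt0// -exprM mul2n => le1.
  apply: le_trans (ler_wpM2r (gauss1_ge0 _ _) le1) _.
  rewrite /c /gauss1; have -> : - t ^+ 2 / (2 * h) = - (t ^+ 2 / (4 * h)) + - t ^+ 2 / (2 *
    (2 * h)).
    by field; rewrite gt_eqF.
  rewrite expRD expRN.
  set E := expR _; set E' := expR _; set q := Num.sqrt _; set q' := Num.sqrt _.
  have q'0 : 0 < q' by rewrite sqrtr_gt0 !mulr_gt0// pi_gt0.
  have q0 : 0 < q by rewrite sqrtr_gt0 !mulr_gt0// pi_gt0.
  have E0 : 0 < E by exact: expR_gt0.
  apply: le_of_eq; field.
  by rewrite !gt_eqF.
rewrite ge0_integralZl//.
- by rewrite integral_gauss1 ?mulr_gt0// mule1 ltry.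
- apply/measurable_EFinP.
  by apply: measurableT_comp; [exact: measurable_gauss1|exact: measurable_funB].
- by move=> t _; rewrite lee_fin gauss1_ge0.
Qed.

End gauss_moments.

Section dual_moments.
Context {R : realType} {V W : normedModType R} (ip : {dot V for idfun}).
Variable iota : V -> W.
Hypothesis iota_dense : dense (range iota).
Variables (h : R) (mu : probability (borel W) R).
Hypotheses (h0 : 0 < h) (gmu : gaussian_measure ip iota h mu).

Lemma dual_vector_measurable y a : dual_vector ip iota y a ->
  measurable_fun setT (y : borel W -> R).
Proof. by move=> [_ yc _]; exact: continuous_borel_measurableR. Qed.

Lemma integral_dual_unit y a (f : R -> \bar R) : dual_vector ip iota y a ->
  ip a a = 1 -> measurable_fun setT f -> (forall t, 0 <= f t)%E ->
  (\int[mu]_x f (y x) = \int[normal_prob 0 (Num.sqrt h)]_t f t)%E.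
Proof.
move=> ya aa mf f0.
have my := dual_vector_measurable ya.
have my' : measurable_fun setT (y : borel W -> measurableTypeR R) by exact: my.
have := @ge0_integral_pushforward _ _ (borel W) (measurableTypeR R) R y my' mu
  setT f measurableT mf (fun t _ => f0 t).
rewrite preimage_setT => <-.
pose P := measure_function_pushforward__canonical__measure_function_Measure mu my'.
apply/esym; apply: (eq_measure_integral P) => A mA _; apply/esym.
pose A1 : set (1.-tuple R) := (@tnth _ _ ^~ ord0) @^-1` A.
have mA1 : measurable A1.
  by rewrite -[X in measurable X]setTI; apply: measurable_tnth.
have oa : orthonormal ip [tuple a] by apply/orthonormal_consP; split.
have := gmu (n := 1) (a := [tuple a]) (y := fun=> y) _ oa mA1.
have -> : pushforward mu (fun x : borel W => [tuple y x | _ < 1]) A1 = mu (y @^-1` A).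
  by rewrite /pushforward; congr (mu _); apply/seteqP; split => x; rewrite /A1 /= tnth_mktuple.
move=> E; transitivity (gauss_law h A1).
  by apply: E => k; rewrite (ord1 k) tnth0.
rewrite /gauss_law /= /normal_prob.
rewrite [RHS]integral_mkcond; apply: eq_integral => t _.
rewrite gauss_density_cons gauss_density_nil mulr1 patchE indicE.
rewrite normal_pdf_gauss1// subr0.
have -> : ([tuple of t :: [tuple]] \in A1) = (t \in A).
  by apply/idP/idP => /set_mem tA; exact/mem_set.
by case: (t \in A); rewrite ?mulr1 ?mulr0.
Qed.

Lemma dual_moment y a N : dual_vector ip iota y a -> (0 < N)%N ->
  (\int[mu]_x ((y x) ^+ N.*2)%:E = (ip a a ^+ N)%:E * gauss_moment h N)%E.
Proof.
move=> ya N0; have [a0|aN0] := eqVneq a 0.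
  rewrite a0 dot0l expr0n gtn_eqF// mul0e.
  rewrite a0 in ya; have y0 x : y x = 0.
    exact: (dual_vector_unique iota_dense x ya (dual_vector0 ip iota)).
  under eq_integral => x _ do rewrite y0 expr0n double_eq0 gtn_eqF//.
  by rewrite integral0.
have aa := dot_gt0 ip aN0.
pose l := Num.sqrt (ip a a); have l0 : 0 < l by rewrite sqrtr_gt0.
have ll : l ^+ 2 = ip a a by rewrite sqr_sqrtr// ltW.
have := dual_vectorZD l^-1 ya (dual_vector0 ip iota); rewrite addr0 => dy.
have mf : measurable_fun [set: R] (fun t : R => (t ^+ N.*2)%:E).
  by apply/measurable_EFinP; exact: measurable_funX.
have ev (t : R) : 0 <= t ^+ N.*2 by rewrite -mul2n exprM exprn_ge0// sqr_ge0.
rewrite /gauss_moment -(integral_dual_unit dy _ mf) => [|//|t]; last 2 first.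
- by rewrite dotZl dotZr -ll; field; rewrite gt_eqF.
- by rewrite lee_fin.
have my := dual_vector_measurable dy.
rewrite -ge0_integralZl//; last 3 first.
- exact: (measurableT_comp mf my).
- by move=> x _; rewrite lee_fin.
- by rewrite lee_fin exprn_ge0// ltW.
apply: eq_integral => x _; rewrite -EFinM -ll addr0 -exprM mul2n -exprMn.
by rewrite mulrA mulfV ?mul1r// gt_eqF.
Qed.

End dual_moments.

(** * L^p norms, and the functions [ell] of vectors of the dual *)

Section Lnorm_bounds.
Context {d : measure_display} {T : measurableType d} {R : realType}.
Variable mu : {measure set T -> \bar R}.

Lemma measurable_normr_powR (f : T -> R) (p : R) : measurable_fun setT f ->
  measurable_fun setT (fun x => `|f x| `^ p).
Proof.
move=> mf; apply: (measurableT_comp (measurable_powR _)).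
exact: measurableT_comp.
Qed.

Lemma Lnorm_EFinE (f : T -> R) (p : R) :
  ('N[mu]_p%:E[(fun x => (f x)%:E)] = (\int[mu]_x (`|f x| `^ p)%:E) `^ p^-1)%E.
Proof.
by rewrite unlock; congr (_ `^ _)%E; apply: eq_integral.
Qed.

Lemma Lnorm_le_of_integral (f : T -> R) (p c : R) : 0 < p -> 0 <= c ->
  (\int[mu]_x (`|f x| `^ p)%:E <= (c `^ p)%:E)%E ->
  ('N[mu]_p%:E[(fun x => (f x)%:E)] <= c%:E)%E.
Proof.
move=> p0 c0 h; rewrite Lnorm_EFinE.
have -> : c%:E = ((c `^ p)%:E `^ p^-1)%E.
  by rewrite poweR_EFin -powRrM mulfV ?gt_eqF// powRr1.
apply: gt0_ler_poweR => //; first by rewrite invr_ge0 ltW.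
- by rewrite in_itv/= leey andbT integral_ge0// => x _; rewrite lee_fin powR_ge0.
- by rewrite in_itv/= leey andbT lee_fin powR_ge0.
Qed.

Lemma Lnorm_mono (f g : T -> R) (p : R) : 0 < p ->
  measurable_fun setT f -> measurable_fun setT g ->
  {ae mu, forall x, `|f x| <= `|g x|} ->
  ('N[mu]_p%:E[(fun x => (f x)%:E)] <= 'N[mu]_p%:E[(fun x => (g x)%:E)])%E.
Proof.
move=> p0 mf mg fg; rewrite !Lnorm_EFinE.
apply: gt0_ler_poweR; first by rewrite invr_ge0 ltW.
- by rewrite in_itv/= leey andbT integral_ge0// => x _; rewrite lee_fin powR_ge0.
- by rewrite in_itv/= leey andbT integral_ge0// => x _; rewrite lee_fin powR_ge0.
apply: ae_ge0_le_integral => //.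
- by apply/measurable_EFinP; exact: measurable_normr_powR.
- by apply/measurable_EFinP; exact: measurable_normr_powR.
apply: filterS fg => x fgx _; rewrite lee_fin.
by apply: ge0_ler_powR; rewrite ?nnegrE// ltW.
Qed.

End Lnorm_bounds.

Section ell_of_dual.
Context {R : realType} {V W : normedModType R} (ip : {dot V for idfun}).
Variable iota : V -> W.
Hypothesis iota_dense : dense (range iota).
Variables (h : R) (mu : probability (borel W) R).
Hypotheses (h0 : 0 < h) (gmu : gaussian_measure ip iota h mu).
Variable K : R.
Hypothesis ip_le : forall v, ip v v <= K * `|v| ^+ 2.

Lemma dual_Lnorm2 y a (c : R) : 0 <= c -> dual_vector ip iota y a ->
  ip a a * fine (gauss_moment h 1) <= c ^+ 2 ->
  ('N[mu]_2%:E[(fun x => (y x)%:E)] <= c%:E)%E.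
Proof.
move=> c0 ya hc; apply: Lnorm_le_of_integral => //.
rewrite powR_mulrn//; apply: le_trans (_ : _ <= \int[mu]_x (y x ^+ 1.*2)%:E)%E _.
  apply: le_of_eq; apply: eq_integral => x _.
  by rewrite powR_mulrn// real_normK// num_real.
rewrite (dual_moment iota_dense h0 gmu ya)// expr1.
by rewrite -(fineK (gauss_moment_fin_num 1 h0)) -EFinM lee_fin.
Qed.

(** The squared L^2 distance of two functionals is the squared distance of their vectors times the
    second moment of the Gaussian, and [ip_le] compares the scalar product with the norm that
    defines the topology of [V]. *)
Lemma dual_is_ell y a : dual_vector ip iota y a -> is_ell ip iota mu a y.
Proof.
move=> ya; set q := fine (gauss_moment h 1).
have q0 : 0 <= q.
  rewrite fine_ge0// integral_ge0// => t _; rewrite lee_fin.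
  by rewrite -mul2n exprM exprn_ge0// sqr_ge0.
have my := dual_vector_measurable ya.
split.
  apply/andP; split; first by rewrite inE.
  rewrite inE /finLfun /finite_norm /=.
  apply: (@le_lt_trans _ _ (Num.sqrt (ip a a * q))%:E); last exact: ltry.
  apply: (dual_Lnorm2 _ ya); rewrite ?sqrtr_ge0// sqr_sqrtr// mulr_ge0//.
  exact: dot_ge0.
move=> eps eps0.
(* With [dl * (D + 1)] equal to eps / 2, the bound |K| q dl^2 is at most the square of eps / 2,
   since |K| q = D - 1 <= (D + 1)^2. *)
pose D := `|K| * q + 1.
have D0 : 0 < D by rewrite ltr_wpDl// mulr_ge0.
pose dl := eps / 2 / (D + 1).
have dl0 : 0 < dl by rewrite !divr_gt0// addr_gt0.
near=> b => z zb.
have zy := dual_vectorZD (-1) ya zb.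
have -> : (fun x : borel W => (z x - y x)%:E) = (fun x => (-1 * y x + z x)%:E).
  by apply/funext => x; congr EFin; ring.
apply: (@le_lt_trans _ _ (eps / 2)%:E); last by rewrite lte_fin; lra.
have ab : `|a - b| < dl by near: b; exact: cvgr_dist_lt.
apply: (dual_Lnorm2 _ zy); first by rewrite divr_ge0// ltW.
rewrite -/q scaleN1r addrC.
have h1 : ip (b - a) (b - a) <= `|K| * dl ^+ 2.
  apply: le_trans (ip_le _) _; rewrite distrC.
  apply: le_trans (_ : _ <= `|K| * `|a - b| ^+ 2) _.
    by rewrite ler_wpM2r ?sqr_ge0 ?ler_norm.
  by rewrite ler_wpM2l// lerXn2r ?nnegrE// ltW.
apply: le_trans (ler_wpM2r q0 h1) _.
have dE : eps / 2 = dl * (D + 1) by rewrite /dl divfK// gt_eqF// addr_gt0.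
rewrite dE [leRHS]exprMn [leLHS]mulrAC mulrC ler_wpM2l ?sqr_ge0//.
have -> : `|K| * q = D - 1 by rewrite /D; ring.
have D1 : 1 <= D + 1 by rewrite lerDr ltW.
rewrite (@le_trans _ _ (D + 1))//; last by rewrite expr2 ler_peMl// (le_trans ler01).
by rewrite lerD2l (le_trans _ ler01)// lerN10.
Unshelve. all: end_near. Qed.

(** The neighbourhood condition is read at its centre, b = a, for the functional [y] itself: the L^2
    distance of [y] and [g] is below every eps. *)
Lemma is_ell_unique y a g : dual_vector ip iota y a -> is_ell ip iota mu a g ->
  {ae mu, forall x, g x = y x}.
Proof.
move=> ya [/andP[/[!inE] mg _] hg].
have my := dual_vector_measurable ya.
have N0 : ('N[mu]_2%:E[(fun x : borel W => (y x - g x)%:E)] = 0)%E.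
  apply/eqP; rewrite eq_le Lnorm_ge0 andbT; apply/lee_addgt0Pr => e e0.
  by rewrite add0e ltW//; have /nbhs_singleton := hg _ e0; apply.
have mf : measurable_fun setT (fun x : borel W => (y x - g x)%:E).
  by apply/measurable_EFinP; exact: measurable_funB.
have t2 : (0 < 2%:E :> \bar R)%E by rewrite lte_fin.
have := Lnorm_eq0_eq0 mf t2 N0.
by apply: filterS => x /(_ I) /= [] /eqP; rewrite subr_eq0 => /eqP ->.
Qed.

Lemma ell_is_ell y a : dual_vector ip iota y a ->
  is_ell ip iota mu a (ell ip iota mu a).
Proof. by move=> ya; apply: xgetPex; exists y; exact: dual_is_ell. Qed.

Lemma ell_dual_ae y a : dual_vector ip iota y a ->
  {ae mu, forall x, ell ip iota mu a x = y x}.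
Proof. by move=> ya; exact: is_ell_unique ya (ell_is_ell ya). Qed.

Lemma measurable_ell y a : dual_vector ip iota y a ->
  measurable_fun setT (ell ip iota mu a : borel W -> R).
Proof. by move=> /ell_is_ell[/andP[/[!inE]]]. Qed.

End ell_of_dual.

(** * Unordered series in L^p *)

Lemma cvg_powR_nondecreasing (R : realType) (u : nat -> R) (l p : R) : 0 < p ->
  (forall n, 0 <= u n <= l) -> u n @[n --> \oo] --> l ->
  (u n `^ p) @[n --> \oo] --> l `^ p.
Proof.
move=> p0 ul cu; have l0 : 0 <= l by have /andP[/le_trans h /h] := ul 0%N.
have [l00|lN0] := eqVneq l 0.
  have -> : (fun n => u n `^ p) = cst (l `^ p); last exact: cvg_cst.
  apply/funext => n /=; congr (_ `^ _); apply/eqP; have := ul n.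
  by rewrite l00 eq_le andbC.
have lp : 0 < l by rewrite lt_neqAle eq_sym lN0.
rewrite {2}/powR (negbTE lN0).
have h : expR (p * ln (u n)) @[n --> \oo] --> expR (p * ln l).
  apply: (@continuous_cvg _ _ _ _ _ _ expR); first exact: continuous_expR.
  apply: cvgMr; apply: (@continuous_cvg _ _ _ _ _ _ (@ln R)) => //.
  exact: continuous_ln.
apply: cvg_trans h; apply: near_eq_cvg.
move/cvgr_gt : cu => /(_ _ lp).
by apply: filterS => n un; rewrite /powR gt_eqF.
Qed.

Section series_in_Lp.
Context {d : measure_display} {T : measurableType d} {R : realType}.
Variable mu : {measure set T -> \bar R}.
Variables (F : nat -> T -> R) (b : nat -> R).
Hypothesis mF : forall n, measurable_fun setT (F n).
Hypothesis b0 : forall n, 0 <= b n.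
Hypothesis bsum : (\sum_(n <oo) (b n)%:E < +oo)%E.

Definition series_tail N x : \bar R := (\sum_(N <= n <oo) (`|F n x|)%:E)%E.
(** As [fine] sends +oo to 0, this is defined and measurable everywhere, without an exceptional set.
    It is the sum of the series wherever [series_tail 0] is finite. *)
Definition series_limit x : R :=
  fine (\sum_(0 <= n <oo) (Num.max (F n x) 0)%:E)%E -
  fine (\sum_(0 <= n <oo) (Num.max (- F n x) 0)%:E)%E.

Lemma measurable_series_tail N : measurable_fun setT (series_tail N).
Proof.
have -> : series_tail N = fun x => (\sum_(0 <= n <oo | (N <= n)%N) (`|F n x|)%:E)%E.
  apply/funext => x; rewrite /series_tail.
  congr (limn _); apply/funext => n.
  by rewrite (@big_nat_widenl _ _ _ N 0%N).
apply: ge0_emeasurable_sum => [n x _ _|n _]; first by rewrite lee_fin.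
by apply/measurable_EFinP; exact: measurableT_comp.
Qed.

Lemma measurable_series_limit : measurable_fun setT series_limit.
Proof.
have mx g : (forall n, measurable_fun setT (g n : T -> R)) ->
    measurable_fun setT (fun x => fine (\sum_(0 <= n <oo) (Num.max (g n x) 0)%:E)%E).
  move=> mg; apply: (measurableT_comp (fine_measurable measurableT)) => //.
  apply: ge0_emeasurable_sum => [n x _ _|n _]; first by rewrite lee_fin le_max lexx orbT.
  by apply/measurable_EFinP; exact: measurable_maxr.
apply: measurable_funB; first exact: mx.
by apply: (mx (fun n x => - F n x)) => n; exact: measurableT_comp.
Qed.

Hypothesis F1 : forall n, (\int[mu]_x (`|F n x|)%:E <= (b n)%:E)%E.

Lemma ae_series_tail_finite : {ae mu, forall x, (series_tail 0 x < +oo)%E}.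
Proof.
have i0 : mu.-integrable setT (series_tail 0).
  apply/integrableP; split; first exact: measurable_series_tail.
  under eq_integral => x _ do rewrite gee0_abs ?nneseries_ge0//.
  rewrite integral_nneseries//; last first.
    by move=> n; apply/measurable_EFinP; exact: measurableT_comp.
  apply: le_lt_trans bsum; apply: lee_nneseries => n _ //.
  by move=> _; exact: integral_ge0.
have := integrable_ae measurableT i0.
by apply: filterS => x /(_ I); rewrite ge0_fin_numE// nneseries_ge0.
Qed.

(** A partial sum long enough to contain [A] differs from the sum over [A] only by terms of index at
    least [N]. Terms of smaller index may be missing from [A] if they vanish: this allows for
    numbers that encode no index. *)
Lemma series_limit_tail x (A : seq nat) N : (series_tail 0 x < +oo)%E -> uniq A ->
  (forall n, (n < N)%N -> n \notin A -> F n x = 0) ->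
  `|series_limit x - \sum_(n <- A) F n x| <= fine (series_tail N x).
Proof.
move=> fin uA AN.
have finN N' : (series_tail N' x < +oo)%E.
  apply: le_lt_trans fin; rewrite /series_tail (nneseries_split 0 N')//.
  by rewrite leeDr// sume_ge0.
have cpart g : (forall n, 0 <= g n <= `|F n x|) ->
    (\sum_(0 <= n < K) g n) @[K --> \oo] -->
    fine (\sum_(0 <= n <oo) (g n)%:E)%E.
  move=> gF.
  have gfin : (\sum_(0 <= n <oo) (g n)%:E)%E \is a fin_num.
    rewrite ge0_fin_numE; last by apply: nneseries_ge0 => n _ _; rewrite lee_fin;
      case/andP: (gF n).
    apply: le_lt_trans fin; apply: lee_nneseries => n _.
      by move=> _; rewrite lee_fin; case/andP: (gF n).
    by rewrite lee_fin; case/andP: (gF n).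
  have : (\sum_(0 <= n < K) (g n)%:E)%E @[K --> \oo] -->
      (fine (\sum_(0 <= n <oo) (g n)%:E)%E)%:E.
    rewrite fineK//; apply: is_cvg_nneseries => n _ _.
    by rewrite lee_fin; case/andP: (gF n).
  move=> /fine_cvg; apply: cvg_trans; apply: near_eq_cvg; apply: nearW => K /=.
  by rewrite sumEFin.
have cF : (\sum_(0 <= n < K) F n x) @[K --> \oo] --> series_limit x.
  have h1 : forall n, 0 <= Num.max (F n x) 0 <= `|F n x|.
    by move=> n; rewrite le_max lexx orbT ge_max normr_ge0 andbT ler_norm.
  have h2 : forall n, 0 <= Num.max (- F n x) 0 <= `|F n x|.
    by move=> n; rewrite le_max lexx orbT ge_max normr_ge0 andbT -normrN ler_norm.
  have := cvgB (cpart _ h1) (cpart _ h2).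
  have -> : (fun K => \sum_(0 <= n < K) Num.max (F n x) 0) -
    (fun K => \sum_(0 <= n < K) Num.max (- F n x) 0) =
    (fun K => \sum_(0 <= n < K) F n x).
    apply/funext => K /=; rewrite !fctE -sumrB; apply: eq_bigr => n _.
    have [h|h] := leP (F n x) 0.
      by rewrite max_l ?oppr_ge0// sub0r opprK.
    by rewrite max_r ?subr0// oppr_le0 ltW.
  exact.
have bd : \forall K \near \oo,
    `|\sum_(0 <= n < K) F n x - \sum_(n <- A) F n x| <= fine (series_tail N x).
  exists (maxn N (\max_(n <- A) n.+1)) => // K /=; rewrite geq_max => /andP[NK AK].
  have AK' n : n \in A -> (n < K)%N.
    by move=> nA; apply: leq_trans AK; apply: (@leq_bigmax_seq _ A xpredT S).
  have -> : \sum_(n <- A) F n x = \sum_(0 <= n < K | n \in A) F n x.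
    rewrite -[RHS]big_filter; apply: perm_big; apply: uniq_perm => //.
      by rewrite filter_uniq// iota_uniq.
    move=> n; rewrite mem_filter mem_index_iota /=.
    by case: (boolP (n \in A)) => //= /AK' ->.
  rewrite [X in `|X - _|](bigID (fun n => n \in A)) /= addrAC subrr add0r.
  apply: le_trans (ler_norm_sum _ _ _) _.
  apply: le_trans (_ : _ <= \sum_(N <= n < K) `|F n x|) _.
    rewrite (big_cat_nat _ (n := N))//= [X in X + _]big_nat_cond big1 ?add0r.
      rewrite [leRHS](bigID (fun n => n \in A)) /= lerDr sumr_ge0//.
    by move=> n /andP[/andP[_ nN] nA]; rewrite AN ?normr0.
  rewrite -lee_fin fineK; last first.
    by rewrite ge0_fin_numE// nneseries_ge0.
  rewrite -sumEFin; apply: nneseries_lim_ge => n _ _; by rewrite lee_fin.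
have cK : `|\sum_(0 <= n < K) F n x - \sum_(n <- A) F n x| @[K --> \oo] -->
    `|series_limit x - \sum_(n <- A) F n x|.
  by apply: cvg_norm; apply: cvgB => //; exact: cvg_cst.
exact: (cvgr_to_le cK).
Qed.

(** Minkowski's inequality for the finite sums [P K], then monotone convergence of their q-th
    powers. The bounds on the L^1 norms make the tail finite almost everywhere. *)
Lemma Lnorm_series_tail (q : R) N : 1 <= q ->
  (forall n, ('N[mu]_q%:E[(fun x => (F n x)%:E)] <= (b n)%:E)%E) ->
  ('N[mu]_q%:E[(fun x => (fine (series_tail N x))%:E)] <=
    \sum_(N <= n <oo) (b n)%:E)%E.
Proof.
move=> q1 Fq; have q0 : 0 < q by exact: lt_le_trans q1.
have bN0 : (0 <= \sum_(N <= n <oo) (b n)%:E)%E.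
  by apply: nneseries_ge0 => n _ _; rewrite lee_fin.
have bNfin : (\sum_(N <= n <oo) (b n)%:E)%E \is a fin_num.
  rewrite ge0_fin_numE//; apply: le_lt_trans bsum.
  rewrite [leRHS](nneseries_split 0 N) => [|n _]; last by rewrite lee_fin.
  by rewrite leeDr// sume_ge0// => n _; rewrite lee_fin.
pose P K x := \sum_(N <= n < K) `|F n x|.
have mP K : measurable_fun setT (P K).
  by apply: measurable_sum => n; exact: measurableT_comp.
have P0 K x : 0 <= P K x by exact: sumr_ge0.
have PK K : ('N[mu]_q%:E[(fun x => (P K x)%:E)] <= \sum_(N <= n <oo) (b n)%:E)%E.
  apply: le_trans (_ : _ <= (\sum_(N <= n < K) b n)%:E)%E _; last first.
    by rewrite -sumEFin; apply: nneseries_lim_ge => n _ _; rewrite lee_fin.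
  elim: K => [|K ih].
    rewrite /P; under [X in Lnorm _ _ X]eq_fun => x do rewrite big_geq//.
    by rewrite Lnorm0 ?lee_fin ?sumr_ge0// eqe gt_eqF.
  have [KN|NK] := ltnP K N.
    rewrite /P; under [X in Lnorm _ _ X]eq_fun => x do rewrite big_geq//.
    by rewrite Lnorm0 ?lee_fin ?sumr_ge0// eqe gt_eqF.
  rewrite [in leRHS]big_nat_recr//= EFinD.
  apply: le_trans (leeD ih (Fq K)).
  have := @minkowski_EFin _ _ _ mu (P K) (fun x => `|F K x|) q (mP K).
  move=> /(_ (measurableT_comp (@normr_measurable _ _) (mF K)) q1).
  have -> : EFin \o (P K \+ (fun x => `|F K x|))%R = (fun x => (P K.+1 x)%:E).
    by apply/funext => x /=; rewrite /P [in RHS]big_nat_recr.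
  move=> /le_trans; apply; rewrite leeD2l//.
  by rewrite -(Lnorm_abse mu (fun x => (F K x)%:E)).
have Pint K : (\int[mu]_x ((P K x) `^ q)%:E <=
    ((fine (\sum_(N <= n <oo) (b n)%:E)%E) `^ q)%:E)%E.
  have := PK K; rewrite -(fineK bNfin) => h.
  have : ('N[mu]_q%:E[(fun x => (P K x)%:E)] `^ q <=
     ((fine (\sum_(N <= n <oo) (b n)%:E)%E)%:E `^ q))%E.
    apply: gt0_ler_poweR => //; first exact: ltW.
    - by rewrite in_itv/= leey andbT Lnorm_ge0.
    - by rewrite in_itv/= leey andbT lee_fin fine_ge0.
  rewrite (poweR_Lnorm _ _ (lt0r_neq0 q0)) poweR_EFin; apply: le_trans.
  apply: le_of_eq; apply: eq_integral => x _.
  by rewrite abse_EFin ger0_norm.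
rewrite -(fineK bNfin); apply: Lnorm_le_of_integral; rewrite ?fine_ge0//.
have mPq K : measurable_fun setT (fun x => ((P K x) `^ q)%:E).
  by apply/measurable_EFinP; exact: (measurableT_comp (measurable_powR _)).
have nd x : {homo (fun K => ((P K x) `^ q)%:E) : m n / (m <= n)%N >-> (m <= n)%E}.
  move=> m n mn; rewrite lee_fin; apply: ge0_ler_powR; rewrite ?nnegrE ?(ltW q0)//.
  rewrite /P; have [mN|Nm] := leqP m N; first by rewrite big_geq// sumr_ge0.
  have -> : \sum_(N <= i < n) `|F i x| = \sum_(N <= i < m) `|F i x| + \sum_(m <= i < n) `|F
    i x|.
    by rewrite (big_cat_nat _ (n := m))// ltnW.
  by rewrite lerDl sumr_ge0.
pose L x := limn (fun K => ((P K x) `^ q)%:E).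
apply: le_trans (_ : _ <= \int[mu]_x L x)%E _; last first.
  rewrite /L monotone_convergence//; last first.
    by move=> n x _; rewrite lee_fin powR_ge0.
  apply: lime_le; last by apply: nearW => K; exact: Pint.
  apply: ereal_nondecreasing_is_cvgn => m n mn; apply: ge0_le_integral => //.
  - by move=> x _; rewrite lee_fin powR_ge0.
  - by move=> x _; exact: nd.
apply: ae_ge0_le_integral => //.
- apply/measurable_EFinP; apply: measurable_normr_powR.
  apply: (measurableT_comp (fine_measurable measurableT)) => //.
  exact: measurable_series_tail.
- move=> x _; apply: lime_ge; first exact: ereal_nondecreasing_is_cvgn.
  by apply: nearW => K; rewrite lee_fin powR_ge0.
- by apply: (emeasurable_fun_cvg (fun K x => ((P K x) `^ q)%:E)) => // x _;
    exact: ereal_nondecreasing_is_cvgn.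
apply: filterS ae_series_tail_finite => x fin _.
have finN : series_tail N x \is a fin_num.
  rewrite ge0_fin_numE ?nneseries_ge0//.
  apply: le_lt_trans fin; rewrite /series_tail (nneseries_split 0 N)//.
  by rewrite leeDr// sume_ge0.
rewrite ger0_norm ?fine_ge0 ?nneseries_ge0//.
suff : ((P K x) `^ q)%:E @[K --> \oo] --> ((fine (series_tail N x)) `^ q)%:E.
  by move=> /cvg_lim; rewrite /L => ->.
apply: cvg_EFin; first by apply: nearW.
apply: cvg_powR_nondecreasing => // [K|].
  rewrite P0/= -lee_fin fineK// /P -sumEFin.
  by apply: nneseries_lim_ge => n _ _; rewrite lee_fin.
have : (\sum_(N <= n < K) (`|F n x|)%:E)%E @[K --> \oo] --> (fine (series_tail N x))%:E.
  by rewrite fineK//; apply: is_cvg_nneseries => n _ _; rewrite lee_fin.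
move=> /fine_cvg; apply: cvg_trans; apply: near_eq_cvg; apply: nearW => K /=.
by rewrite sumEFin.
Qed.

End series_in_Lp.

Section complex_parts.
Context {R : realType}.
Implicit Types (b : bool) (z : R[i]).

Definition cpart b z : R := if b then complex.Im z else complex.Re z.

Lemma cpartD b z z' : cpart b (z + z') = cpart b z + cpart b z'.
Proof. by case: b; case: z; case: z'. Qed.

Lemma cpartB b z z' : cpart b (z - z') = cpart b z - cpart b z'.
Proof. by case: b; case: z; case: z'. Qed.

Lemma cpart_sum b (I : Type) (s : seq I) (f : I -> R[i]) :
  cpart b (\sum_(i <- s) f i) = \sum_(i <- s) cpart b (f i).
Proof. by apply: (big_morph _ (cpartD b)); case: b. Qed.

Lemma cpartZ b (a : R) z : cpart b (a%:C * z) = a * cpart b z.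
Proof. by case: b; case: z => x y; rewrite /= mul0r ?subr0 ?addr0. Qed.

Lemma cpart_inj z z' : (forall b, cpart b z = cpart b z') -> z = z'.
Proof.
by move=> h; have := h true; have := h false; case: z {h}; case: z' => x y x' y' /= -> ->.
Qed.

Lemma normc_ge0 z : 0 <= Normc.normc z.
Proof. by case: z => x y; exact: sqrtr_ge0. Qed.

Lemma cpart_le b z : `|cpart b z| <= Normc.normc z.
Proof.
case: z => x y; rewrite -sqrtr_sqr; case: b => /=; rewrite ler_wsqrtr//.
  by rewrite lerDr sqr_ge0.
by rewrite lerDl sqr_ge0.
Qed.

Lemma normc_le_cpartD z :
  Normc.normc z <= `|cpart false z| + `|cpart true z|.
Proof.
case: z => x y /=; rewrite -[leRHS]ger0_norm ?addr_ge0// -sqrtr_sqr ler_wsqrtr//.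
by rewrite sqrrD !real_normK ?num_real// addrAC lerDl mulrn_wge0 ?mulr_ge0.
Qed.

Lemma normc_le_cparts z (C : R) : (forall b, `|cpart b z| <= C) ->
  Normc.normc z <= C + C.
Proof. by move=> h; apply: le_trans (normc_le_cpartD z) (lerD _ _). Qed.

Lemma normcZ (a : R) z : Normc.normc (a%:C * z) = `|a| * Normc.normc z.
Proof.
case: z => x y /=; rewrite !mul0r subr0 addr0 -sqrtr_sqr -sqrtrM ?sqr_ge0//.
by rewrite mulrDr !exprMn.
Qed.

Lemma measurable_normc d (T : measurableType d) (f : T -> R[i]) :
  (forall b, measurable_fun setT (fun x => cpart b (f x))) ->
  measurable_fun setT (fun x => Normc.normc (f x)).
Proof.
move=> mf; have -> : (fun x => Normc.normc (f x)) =
    fun x => Num.sqrt (cpart false (f x) ^+ 2 + cpart true (f x) ^+ 2).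
  by apply/funext => x; case: (f x).
have ms : measurable_fun setT (Num.sqrt : R -> R).
  by apply: continuous_measurable_fun; exact: sqrt_continuous.
apply: (measurableT_comp ms).
by apply: measurable_funD; exact: measurable_funX.
Qed.

End complex_parts.

Section unordered_series.
Context {R : realType} {W : normedModType R}.
Variable mu : probability (borel W) R.
Variables (I : countType) (f : I -> W -> R[i]) (b : I -> R) (Bd : R).
Hypothesis mf : forall b' i, measurable_fun setT
  (fun x : borel W => cpart b' (f i x)).
Hypothesis b0 : forall i, 0 <= b i.
Hypothesis bBd : forall A : {fset I}, \sum_(i <- A) b i <= Bd.
Hypothesis f1 : forall i,
  ('N[mu]_1%:E[(fun x : borel W => (Normc.normc (f i x))%:E)] <= (b i)%:E)%E.

(** Families over [I] become sequences through the enumeration of [I]; a number that encodes no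
    index contributes 0. *)
Let enc (U : Type) (g : I -> U -> R) n (x : U) : R :=
  if @pickle_inv I n is Some i then g i x else 0.
Let bn n : R := if @pickle_inv I n is Some i then b i else 0.
Let Fp b' := enc (fun i (x : borel W) => cpart b' (f i x)).

Let bn0 n : 0 <= bn n.
Proof. by rewrite /bn; case: pickle_inv => [i|]. Qed.

Let bn_sum : (\sum_(n <oo) (bn n)%:E < +oo)%E.
Proof.
apply: (@le_lt_trans _ _ Bd%:E); last exact: ltry.
apply: lime_le; first by apply: is_cvg_nneseries => n _ _; rewrite lee_fin.
apply: nearW => K; rewrite sumEFin lee_fin.
have -> : \sum_(0 <= n < K) bn n = \sum_(i <- pmap (@pickle_inv I) (iota 0 K)) b i.
  rewrite /index_iota subn0; elim: (iota 0 K) => [|n s ih]; first by rewrite !big_nil.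
  by rewrite big_cons ih /bn /=; case: pickle_inv => [i|]/=; rewrite ?big_cons ?add0r.
have us : uniq (pmap (@pickle_inv I) (iota 0 K)).
  by apply: (pmap_uniq (@pickle_invK I)); exact: iota_uniq.
have := bBd [fset i in pmap (@pickle_inv I) (iota 0 K)]%fset.
apply: le_trans; apply: le_of_eq.
apply: perm_big; apply: uniq_perm; rewrite ?fset_uniq// => i.
by rewrite in_fset.
Qed.

Let enc_sum (U : Type) (g : I -> U -> R) (A : seq I) x :
  \sum_(n <- map choice.pickle A) enc g n x = \sum_(i <- A) g i x.
Proof. by rewrite big_map; apply: eq_bigr => i _; rewrite /enc pickleK_inv. Qed.

Let menc (g : I -> W -> R) : (forall i, measurable_fun setT (g i : borel W -> R)) ->
  forall n, measurable_fun setT (enc g n : borel W -> R).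
Proof. by move=> mg n; rewrite /enc; case: pickle_inv => [i|]. Qed.

Let Lnorm_enc q b' : 1 <= q ->
  (forall i, ('N[mu]_q%:E[(fun x : borel W => (Normc.normc (f i x))%:E)] <= (b i)%:E)%E) ->
  forall n, ('N[mu]_q%:E[(fun x : borel W => (Fp b' n x)%:E)] <= (bn n)%:E)%E.
Proof.
move=> q1 fb n; have q0 : 0 < q by exact: lt_le_trans q1.
rewrite /Fp /enc /bn; case: pickle_inv => [i|]; last by rewrite Lnorm0// eqe gt_eqF.
apply: le_trans (fb i); apply: Lnorm_mono => //; first exact: measurable_normc.
by apply/aeW => x; rewrite (ger0_norm (normc_ge0 _)) cpart_le.
Qed.

(* The sum of the positive parts minus that of the negative parts, along an
   enumeration of [I]: it does not depend on [q], so that the sums in L^1 and in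
   L^p are given by the same function. *)
Definition unordered_sum (x : W) : R[i] :=
  series_limit (Fp false) x +i* series_limit (Fp true) x.

Let cpart_unordered b' x : cpart b' (unordered_sum x) = series_limit (Fp b') x.
Proof. by case: b'. Qed.

Let mFp b' := menc (mf b').

Let int1 b' n : (\int[mu]_x (`|(Fp b' n : borel W -> R) x|)%:E <= (bn n)%:E)%E.
Proof. by have := Lnorm_enc b' (lexx 1) f1 n; rewrite Lnorm1. Qed.

Let dist_le q N (A : {fset I}) : 1 <= q ->
  (forall i, ('N[mu]_q%:E[(fun x : borel W => (Normc.normc (f i x))%:E)] <= (b i)%:E)%E) ->
  (forall i, (choice.pickle i < N)%N -> i \in A) ->
  (cLdist mu q (fun x => \sum_(i <- A) f i x)%R unordered_sum <=
    \sum_(N <= n <oo) (bn n)%:E + \sum_(N <= n <oo) (bn n)%:E)%E.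
Proof.
move=> q1 fq AN; have q0 : 0 < q by exact: lt_le_trans q1.
have L b' := Lnorm_series_tail (mFp b') bn0 bn_sum (int1 b') N q1 (Lnorm_enc b' q1 fq).
have mt b' : measurable_fun setT (fun x : borel W => fine (series_tail (Fp b') N x)).
  apply: (measurableT_comp (fine_measurable measurableT)).
  exact: measurable_series_tail (mFp b') _.
apply: le_trans (leeD (L false) (L true)).
apply: le_trans (minkowski_EFin mu (mt false) (mt true) q1).
apply: Lnorm_mono => //.
- apply: measurable_normc => b'.
  rewrite (_ : (fun x => _) = fun x : borel W =>
      \sum_(i <- A) cpart b' (f i x) - series_limit (Fp b') x).
    apply: measurable_funB; first exact: measurable_sum.
    exact: measurable_series_limit (mFp b').
  by apply/funext => x; rewrite cpartB cpart_sum cpart_unordered.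
- exact: measurable_funD.
have ae b' := ae_series_tail_finite (mFp b') bn_sum (int1 b').
apply: filterS2 (ae false) (ae true) => x x0 x1.
have uA : uniq (map choice.pickle A).
  by rewrite map_inj_uniq ?fset_uniq//; exact: pcan_inj (@pickleK I).
have AN' (g : I -> W -> R) n : (n < N)%N -> n \notin map choice.pickle A -> enc g n x = 0.
  rewrite /enc; case E : pickle_inv => [i|//] nN; have := @pickle_invK I n.
  by rewrite E /= => pin; rewrite -pin map_f// AN// pin.
have le b' : `|cpart b' (\sum_(i <- A) f i x - unordered_sum x)| <=
    fine (series_tail (Fp b') N x).
  rewrite cpartB cpart_sum cpart_unordered distrC.
  rewrite -(enc_sum (fun i x => cpart b' (f i x))).
  by apply: series_limit_tail uA (AN' _); case: b'.
rewrite (ger0_norm (normc_ge0 _)) [leRHS]ger0_norm; last first.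
  by rewrite addr_ge0// fine_ge0// nneseries_ge0// => n _ _; rewrite lee_fin.
exact: le_trans (normc_le_cpartD _) (lerD (le false) (le true)).
Qed.

Lemma cLsum_unordered_sum q : 1 <= q ->
  (forall i, ('N[mu]_q%:E[(fun x : borel W => (Normc.normc (f i x))%:E)] <= (b i)%:E)%E) ->
  cLsum mu q f unordered_sum.
Proof.
move=> q1 fq; split.
- move=> i; split; [exact: (mf false)|exact: (mf true)|].
  by apply: le_lt_trans (fq i) _; exact: ltry.
- split; [exact: measurable_series_limit (mFp false)|exact: measurable_series_limit (mFp
  true)|].
  (* The distance to the empty sum is the norm of the sum itself, which is thereby finite. *)
  have := @dist_le q 0 fset0 q1 fq (fun i => _).
  rewrite /cLdist => /(_ (fun i h => False_ind _ (notF h))).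
  have -> : (fun x : borel W => (Normc.normc (\sum_(i <- fset0) f i x - unordered_sum x))%:E) =
    (fun x : borel W => (Normc.normc (unordered_sum x))%:E).
    apply/funext => x; rewrite big_seq_fset0 sub0r.
    by congr EFin; rewrite /Normc.normc /= !sqrrN.
  by move=> /le_lt_trans; apply; rewrite lte_add_pinfty.
move=> e e0.
have tl := @nneseries_tail_cvg R (fun n => (bn n)%:E) xpredT bn_sum (fun n _ => bn0 n).
have [|N _ hN] := cvge0_lt tl (_ : 0 < e / 2); first by rewrite divr_gt0.
exists [fset i in pmap (@pickle_inv I) (iota 0 N)]%fset => A A0A.
apply: le_lt_trans (@dist_le q N A q1 fq _) _.
  move=> i iN; apply: (fsubsetP A0A); rewrite in_fset /= mem_pmap.
  by apply/mapP; exists (choice.pickle i); rewrite ?mem_iota ?pickleK_inv.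
by rewrite (splitr e) EFinD; apply: lteD; exact: (hN N (leqnn N)).
Qed.

End unordered_series.

(** * Taylor formula along finitely many directions *)

Section directional_derivatives.
Context {R : realType} {V : normedModType R}.
Implicit Types (f L : V -> R) (x v w : V).

Lemma is_derive_line f x v (t L : R) : is_derive (x + t *: v) v f L ->
  is_derive t 1 (fun r : R => f (x + r *: v)) L.
Proof.
move=> [df <-]; rewrite /derivable /derive in df *.
have E : (fun h : R => h^-1 *: (((fun r : R => f (x + r *: v)) \o shift t) (h *: 1) - f (x
  + t *: v))) =
    (fun h : R => h^-1 *: ((f \o shift (x + t *: v)) (h *: v) - f (x + t *: v))).
  apply/funext => h /=; congr (_ *: (f _ - _)).
  by rewrite -[h%:A]/(h * 1) mulr1 scalerDl addrCA.
split; first by rewrite /derivable E.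
by rewrite /derive E.
Qed.

Lemma mean_value_direction f x v (a : R) : (forall z, derivable f z v) ->
  exists2 c : R, `|c| <= `|a| & f (x + a *: v) - f x = a * 'D_v f (x + c *: v).
Proof.
move=> df.
have dg (t : R) : is_derive t 1 (fun r : R => f (x + r *: v)) ('D_v f (x + t *: v)).
  by apply: is_derive_line; exact: derivableP.
have cg (b c : R) : {within `[b, c], continuous (fun r : R => f (x + r *: v))}.
  apply: continuous_subspaceT => t.
  by apply/differentiable_continuous/derivable1_diffP; case: (dg t).
have [a0|a0] := leP 0 a.
  have [c] := MVT_segment a0 (fun t _ => dg t) (cg 0 a).
  rewrite in_itv /= => /andP[c0 ca] fE; exists c; first by rewrite !ger0_norm.
  by move: fE; rewrite scale0r addr0 subr0 mulrC.
have [c] := MVT_segment (ltW a0) (fun t _ => dg t) (cg a 0).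
rewrite in_itv /= => /andP[ac c0] fE; exists c.
  by rewrite ler0_norm// ltr0_norm// lerN2.
move: fE; rewrite scale0r addr0 sub0r mulrN mulrC => fE.
by rewrite -opprB fE opprK.
Qed.

Lemma is_derive_cvg f x v (L : R) :
  h^-1 *: (f (h *: v + x) - f x) @[h --> 0^'] --> L -> is_derive x v f L.
Proof. by move=> h; split; [exact: cvgP h|exact: cvg_lim h]. Qed.

(** Directional derivatives need not be additive in the direction. Here the increment is split into
    a move along [v], treated by its derivative, and one along [w], treated by the mean value
    theorem. The intermediate points [xi] tend to 0, and the continuity of the derivative along [w]
    concludes. *)
Lemma is_derive_direction_add f L' v w (c : R) :
  (forall x, derivable f x w) -> continuous (fun x => 'D_w f x) ->
  (forall x, is_derive x v f (L' x)) ->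
  forall x, is_derive x (c *: w + v) f (c * 'D_w f x + L' x).
Proof.
move=> df cf dv x; apply: is_derive_cvg.
have /choice[xi xiP] (h : R) : exists c', `|c'| <= `|h * c| /\
    f ((x + h *: v) + (h * c) *: w) - f (x + h *: v) =
    (h * c) * 'D_w f ((x + h *: v) + c' *: w).
  by have [c' c1 c2] := mean_value_direction (x + h *: v) (h * c) df; exists c'.
have id0 : h @[h --> (0 : R)^'] --> (0 : R) by move=> A /nbhs_dnbhs.
have xi0 : xi h @[h --> 0^'] --> 0.
  apply/norm_cvg0P.
  apply: (@squeeze_cvgr _ _ _ _ (cst 0) (fun h => `|h * c|)).
  - by apply: nearW => h /=; rewrite normr_ge0 /=; case: (xiP h).
  - exact: cvg_cst.
  have : `|h * c| @[h --> (0 : R)^'] --> `|0 * c| by apply: cvg_norm; exact: cvgMl.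
  by rewrite mul0r normr0.
have h1 : c * 'D_w f ((x + h *: v) + xi h *: w) @[h --> 0^'] --> c * 'D_w f x.
  apply: cvgMr; apply: (@continuous_cvg _ _ _ _ _ _ (fun x => 'D_w f x)).
    exact: cf.
  have hv : h *: v @[h --> (0 : R)^'] --> (0 : R) *: v by exact: cvgZl.
  have hw : xi h *: w @[h --> (0 : R)^'] --> (0 : R) *: w by exact: cvgZl.
  have hvw : x + h *: v + xi h *: w @[h --> (0 : R)^'] --> x + (0 : R) *: v + (0 : R) *: w.
    by apply: cvgD => //; apply: cvgD => //; exact: cvg_cst.
  by rewrite !scale0r !addr0 in hvw.
have h2 : h^-1 *: (f (h *: v + x) - f x) @[h --> 0^'] --> L' x.
  by have [d1 d2] := dv x; rewrite -d2; exact: d1.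
apply: cvg_trans (cvgD h1 h2); apply: near_eq_cvg.
near=> h; have hN0 : h != 0 by near: h; exact: nbhs_dnbhs_neq.
rewrite !fctE; have [_ E] := xiP h.
have -> : h *: (c *: w + v) + x = (x + h *: v) + (h * c) *: w.
  by rewrite scalerDr scalerA addrC [(h * c) *: w + _]addrC addrA.
rewrite (addrC (h *: v)); move: E; set A := f _; set C := f _; set D := 'D_w f _ => E.
rewrite /GRing.scale/= -[A](subrK C) E; field; exact: hN0.
Unshelve. all: end_near. Qed.

Lemma is_derive_direction_sum (I : Type) (s : seq I) (w : I -> V) (c : I -> R) f :
  (forall i x, derivable f x (w i)) -> (forall i, continuous (fun x => 'D_(w i) f x)) ->
  forall x, is_derive x (\sum_(i <- s) c i *: w i) f
    (\sum_(i <- s) c i * 'D_(w i) f x).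
Proof.
move=> df cf; elim: s => [|i s ih] x.
  rewrite !big_nil; apply: is_derive_cvg.
  have -> : (fun h : R => h^-1 *: (f (h *: 0 + x) - f x)) = cst 0.
    by apply/funext => h; rewrite scaler0 add0r subrr scaler0.
  exact: cvg_cst.
rewrite !big_cons.
exact: (@is_derive_direction_add f (fun x => \sum_(i <- s) c i * 'D_(w i) f x)).
Qed.

End directional_derivatives.

Section taylor_formula.
Context {R : realType}.

(** The derivative of [Psi n] telescopes to the integrand of the remainder, so the formula is the
    fundamental theorem of calculus for [Psi n] on [0, 1]. At s = 1 only the term i = 0 survives,
    and at s = 0 the sum is the Taylor polynomial. *)
Lemma taylor_integral (phi : nat -> R -> R) n :
  (forall i (s : R), (i <= n)%N -> is_derive s (1 : R) (phi i) (phi i.+1 s)) ->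
  continuous (phi n.+1) ->
  phi 0%N 1 = \sum_(0 <= i < n.+1) i`!%:R^-1 * phi i 0 +
    (\int[lebesgue_measure]_(s in `[0, 1]) ((1 - s) ^+ n / n`!%:R * phi n.+1 s))%R.
Proof.
move=> dphi cphi.
pose Psi m (s : R) := \sum_(0 <= i < m.+1) i`!%:R^-1 * (1 - s) ^+ i * phi i s.
have dPsi m (s : R) : (m <= n)%N ->
    is_derive s (1 : R) (Psi m) ((1 - s) ^+ m / m`!%:R * phi m.+1 s).
  elim: m => [_|m ih mn].
    have -> : Psi 0%N = phi 0%N.
      by apply/funext => t; rewrite /Psi big_nat1 invr1 expr0 !mul1r.
    by rewrite expr0 mul1r invr1 mul1r; exact: dphi.
  have -> : Psi m.+1 = Psi m + (fun t => m.+1`!%:R^-1 * (1 - t) ^+ m.+1) * phi m.+1.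
    by apply/funext => t; rewrite /Psi big_nat_recr.
  have d1 : is_derive s (1 : R) (fun t : R => 1 - t) (-1).
    have -> : (fun t : R => 1 - t) = cst 1 - id by [].
    by apply: is_derive_eq; rewrite sub0r.
  have d2 : is_derive s (1 : R) (fun t : R => m.+1`!%:R^-1 * (1 - t) ^+ m.+1)
      (- (m`!%:R^-1 * (1 - s) ^+ m)).
    have -> : (fun t : R => m.+1`!%:R^-1 * (1 - t) ^+ m.+1) =
        m.+1`!%:R^-1 \*: (fun t : R => 1 - t) ^+ m.+1.
      by apply/funext => t; rewrite !fctE.
    apply: (is_derive_eq (is_deriveZ _ (is_deriveX m.+1 d1))) => /=.
    rewrite /GRing.scale/= factS natrM; field.
    by rewrite !pnatr_eq0 -lt0n fact_gt0 /=.
  by apply: (is_derive_eq (is_deriveD (ih (ltnW mn)) (is_deriveM d2 (dphi m.+1 s mn)))) =>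
    /=; rewrite /GRing.scale/=; ring.
have cphin : continuous (fun s : R => (1 - s) ^+ n / n`!%:R * phi n.+1 s).
  move=> s; apply: cvgM; last exact: cphi.
  apply: cvgMl; apply: (@continuous_comp _ _ _ (fun t : R => 1 - t) (fun t : R => t ^+ n)).
    by apply: cvgB; [exact: cvg_cst|exact: cvg_id].
  exact: exprn_continuous.
have cPsi : continuous (Psi n).
  move=> s; apply/differentiable_continuous/derivable1_diffP.
  by case: (dPsi n s (leqnn n)).
have FTC : (\int[lebesgue_measure]_(s in `[0%R, 1%R]) ((1 - s) ^+ n / n`!%:R * phi n.+1 s)%:E =
    (Psi n 1)%:E - (Psi n 0)%:E)%E.
  apply: continuous_FTC2 => //.
  - exact: continuous_subspaceT.
  - split.
    + by move=> s _; case: (dPsi n s (leqnn n)).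
    + by apply: cvg_at_right_filter; exact: cPsi.
    + by apply: cvg_at_left_filter; exact: cPsi.
  - by move=> s _; rewrite derive1E; case: (dPsi n s (leqnn n)).
rewrite /Rintegral FTC /= [Psi n 0]/Psi.
under [X in _ - X]eq_bigr => i _ do rewrite subr0 expr1n mulr1.
rewrite addrC subrK /Psi big_nat_recl//= subrr expr0 invr1 !mul1r.
by rewrite big1 ?addr0// => i _; rewrite expr0n /= mulr0 mul0r.
Qed.

End taylor_formula.

(** * Translation and time averages of stochastic extensions *)

Lemma cvge0P (R : realType) (u : nat -> \bar R) : (forall n, 0 <= u n)%E ->
  (forall e : R, 0 < e -> \forall n \near \oo, (u n <= e%:E)%E) ->
  u n @[n --> \oo] --> 0%E.
Proof.
move=> u0 ue; apply/fine_cvgP; split.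
  apply: filterS (ue 1 ltr01) => n un.
  by rewrite ge0_fin_numE// (le_lt_trans un)// ltry.
apply/cvgrPdist_le => e e0; apply: filterS (ue e e0) => n un /=.
rewrite sub0r normrN ger0_norm ?fine_ge0// -lee_fin fineK//.
by rewrite ge0_fin_numE// (le_lt_trans un)// ltry.
Qed.

Section quasi_invariant_transport.
Context {d : measure_display} {T : measurableType d} {R : realType}.
Variables (mu nu : probability T R) (phi : T -> T) (K : R).
Hypothesis mphi : measurable_fun setT phi.
Hypothesis quasi : forall (lam : R) N, 0 < lam -> measurable N ->
  (mu (phi @^-1` N) <= (lam * K)%:E + lam^-1%:E * nu N)%E.

Let mphiI N : measurable N -> measurable (phi @^-1` N).
Proof. by move=> mN; rewrite -[X in measurable X]setTI; exact: mphi. Qed.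

(** The bound reduces to [lam * K] with [lam] arbitrarily small. *)
Lemma quasi_null N : measurable N -> nu N = 0%E -> mu (phi @^-1` N) = 0%E.
Proof.
move=> mN N0; apply/eqP; rewrite eq_le measure_ge0 andbT.
apply/lee_addgt0Pr => e e0; rewrite add0e.
have K1 : 0 < `|K| + 1 by rewrite ltr_wpDl.
apply: le_trans (quasi (divr_gt0 e0 K1) mN) _.
rewrite N0 mule0 adde0 lee_fin mulrAC ler_pdivrMr// ler_pM2l//.
by have := ler_norm K; lra.
Qed.

Lemma ae_quasi (P : T -> Prop) :
  {ae nu, forall x, P x} -> {ae mu, forall x, P (phi x)}.
Proof.
move=> [N [mN N0 PN]]; exists (phi @^-1` N); split; first exact: mphiI.
  exact: quasi_null.
by move=> x /= nP; apply: PN.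
Qed.

Variables (a : nat -> T -> R) (a0 : T -> R) (C : R).
Hypothesis ma : forall n, measurable_fun setT (a n).
Hypothesis ma0 : measurable_fun setT a0.
Hypothesis aC : forall n x, `|a n x| <= C.
Hypothesis acvg :
  (\int[nu]_x (`|a n x - a0 x|)%:E)%E @[n --> \oo] --> 0%E.

Let C0 : 0 <= C.
Proof. by have := aC 0 point; apply: le_trans. Qed.

Let mdist n : measurable_fun setT (fun x => `|a n x - a0 x|).
Proof. by apply: measurableT_comp => //; exact: measurable_funB. Qed.

Let mset n (e : R) : measurable [set x | e < `|a n x - a0 x|].
Proof.
have -> : [set x | e < `|a n x - a0 x|] = setT `&` (fun x => `|a n x - a0 x|) @^-1` `]e,
  +oo[%classic.
  by apply/seteqP; split => x /=; rewrite in_itv/= andbT; [|case].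
exact: mdist.
Qed.

Let markov n (e : R) : 0 < e ->
  (nu [set x | (e < `|a n x - a0 x|)%R] <= e^-1%:E * \int[nu]_x (`|a n x - a0 x|)%:E)%E.
Proof.
move=> e0; rewrite -(@lee_pmul2l _ e%:E)// ?lte_fin// muleA -EFinM mulfV ?gt_eqF// mul1e.
rewrite -integral_cst//.
apply: (@le_trans _ _ (\int[nu]_(x in [set x | (e < `|a n x - a0 x|)%R]) (`|a n x - a0
  x|)%:E)%E).
  apply: ge0_le_integral => //.
  - by move=> x _; rewrite lee_fin ltW.
  - by apply/measurable_EFinP; apply: measurable_funTS.
  - by move=> x /= /ltW; rewrite lee_fin.
apply: ge0_subset_integral => //.
by apply/measurable_EFinP.
Qed.

(** By Markov's inequality a limit in L^1(nu) of functions bounded by [C] is bounded by [C] off a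
    [nu]-null set, and the preimage of this set is [mu]-null. *)
Lemma ae_bounded_transport : {ae mu, forall x, `|a0 (phi x)| <= C}.
Proof.
apply: (ae_quasi (P := fun x => `|a0 x| <= C)).
have mk k : measurable [set x | C + k.+1%:R^-1 < `|a0 x|].
  have -> : [set x | C + k.+1%:R^-1 < `|a0 x|] = setT `&` (fun x => `|a0 x|) @^-1` `]C +
    k.+1%:R^-1, +oo[%classic.
    by apply/seteqP; split => x /=; rewrite in_itv/= andbT; [|case].
  have : measurable_fun setT (fun x => `|a0 x|) by exact: measurableT_comp.
  exact.
have nk k : nu [set x | C + k.+1%:R^-1 < `|a0 x|] = 0%E.
  apply/eqP; rewrite eq_le measure_ge0 andbT.
  apply/lee_addgt0Pr => e e0; rewrite add0e.
  have k0 : 0 < k.+1%:R^-1 :> R by rewrite invr_gt0.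
  have [n _ hn] := cvge0_lt acvg (mulr_gt0 k0 e0).
  apply: (@le_trans _ _ (nu [set x | k.+1%:R^-1 < `|a n x - a0 x|])).
    apply: le_measure; rewrite ?inE//= => x /=.
    have := aC n x; have := ler_normD (a0 x - a n x) (a n x); rewrite subrK distrC.
    by set q := _^-1; lra.
  apply: le_trans (markov n k0) _.
  apply: le_trans (lee_wpmul2l _ (ltW (hn n (leqnn n)))) _.
    by rewrite lee_fin invr_ge0 ltW.
  by rewrite -EFinM lee_fin mulrA mulVf ?mul1r// gt_eqF.
exists (\bigcup_k [set x | C + k.+1%:R^-1 < `|a0 x|]); split.
- exact: bigcup_measurable.
- apply/(negligibleP nu (bigcup_measurable (fun k _ => mk k))).
  by apply: negligible_bigcup => k; apply/(negligibleP nu (mk k)); exact: nk.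
move=> x /= /negP; rewrite -ltNge => Cx.
have Cx0 : 0 < `|a0 x| - C by rewrite subr_gt0.
have [k _ /(_ k (leqnn k)) /= hk] := near_infty_natSinv_lt (PosNum Cx0).
by exists k => //=; move: hk; set q := _^-1; lra.
Qed.

(** Convergence in L^1(nu) gives convergence in [nu]-measure, which the comparison of measures
    transports to [mu]. Since all functions are bounded by [C], convergence in measure gives
    convergence in L^1(mu). *)
Lemma cvg_L1_transport :
  (\int[mu]_x (`|a n (phi x) - a0 (phi x)|)%:E)%E @[n --> \oo] --> 0%E.
Proof.
have bound n (dl lam : R) : 0 < dl -> 0 < lam ->
    (\int[mu]_x (`|a n (phi x) - a0 (phi x)|)%:E <=
     dl%:E + (2 * C)%:E * ((lam * K)%:E + lam^-1%:E * (dl^-1%:E *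
       \int[nu]_x (`|a n x - a0 x|)%:E)))%E.
  move=> dl0 lam0; pose N := [set x | dl < `|a n x - a0 x|].
  have mpN : measurable (phi @^-1` N) by apply: mphiI; exact: mset.
  apply: (@le_trans _ _ (\int[mu]_x (dl%:E + (2 * C)%:E * (\1_(phi @^-1` N) x)%:E))%E).
    apply: ae_ge0_le_integral => //.
    - apply/measurable_EFinP; apply: (measurableT_comp (mdist n) mphi).
    - by move=> x _; rewrite -EFinM -EFinD lee_fin addr_ge0 ?mulr_ge0// ltW.
    - apply: emeasurable_funD => //; apply: emeasurable_funM => //.
      by apply/measurable_EFinP; apply: measurable_indic; exact: mpN.
    apply: filterS ae_bounded_transport => x ax _.
    rewrite -EFinM -EFinD lee_fin indicE.
    have [/set_mem xN|/negP xN] := boolP (x \in phi @^-1` N).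
      rewrite mulr1; apply: le_trans (ler_normB _ _) _.
      by have := aC n (phi x); lra.
    rewrite mulr0 addr0 leNgt; apply/negP => h; apply: xN; exact/mem_set.
  rewrite ge0_integralD//; last 3 first.
  - by move=> x _; rewrite lee_fin ltW.
  - by move=> x _; rewrite -EFinM lee_fin !mulr_ge0.
  - apply: emeasurable_funM => //.
    by apply/measurable_EFinP; apply: measurable_indic; exact: mpN.
  rewrite integral_cst// [X in (_ * X + _)%E]probability_setT mule1 leeD2l//.
  rewrite ge0_integralZl//; last 2 first.
  - by apply/measurable_EFinP; apply: measurable_indic; exact: mpN.
  - by rewrite lee_fin mulr_ge0.
  rewrite integral_indic ?setIT//.
  apply: lee_wpmul2l; first by rewrite lee_fin mulr_ge0.
  apply: le_trans (quasi lam0 (mset n dl)) _.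
  by rewrite leeD2l//; apply: lee_wpmul2l; [rewrite lee_fin invr_ge0 ltW|exact: markov].
apply: cvge0P => [n|e e0]; first exact: integral_ge0.
have CK : 0 < 2 * C * `|K| + 1 by rewrite ltr_wpDl// !mulr_ge0.
(* [lam] makes the term in K at most e / 3. It is fixed before [dd], which then makes the Markov
   term, divided by [lam], at most e / 3; the threshold [dl] is the last e / 3. *)
pose lam := e / 3 / (2 * C * `|K| + 1).
have e3 : 0 < e / 3 by rewrite divr_gt0.
have lam0 : 0 < lam by rewrite divr_gt0.
have C1 : 0 < 2 * C + 1 by rewrite ltr_wpDl// mulr_ge0.
pose dd := lam * (e / 3) * (e / 3) / (2 * C + 1).
have dd0 : 0 < dd by apply: divr_gt0 => //; apply: mulr_gt0 => //; exact: mulr_gt0.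
have hd := cvge0_lt acvg dd0.
near=> n; apply: le_trans (bound n _ _ e3 lam0) _.
have : (\int[nu]_x (`|a n x - a0 x|)%:E < dd%:E)%E by near: n.
set r := (\int[nu]_x _)%E => rdd.
have r_ge0 : (0 <= r)%E by exact: integral_ge0.
have rfin : r \is a fin_num.
  by rewrite ge0_fin_numE ?integral_ge0// (lt_trans rdd)// ltry.
move: rdd; rewrite -(fineK rfin) lte_fin => rdd.
move: (fine r) rdd (fine_ge0 r_ge0) => t tdd t0.
suff: e / 3 + 2 * C * (lam * K + lam^-1 * ((e / 3)^-1 * t)) <= e by [].
have h1 : 2 * C * (lam * K) <= e / 3.
  apply: (@le_trans _ _ (lam * (2 * C * `|K| + 1))); last by rewrite /lam divfK ?gt_eqF.
  rewrite mulrCA ler_pM2l//; apply: (@le_trans _ _ (2 * C * `|K|)); last by rewrite lerDl.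
  by rewrite ler_wpM2l ?ler_norm// mulr_ge0.
have h2 : 2 * C * (lam^-1 * ((e / 3)^-1 * t)) <= e / 3.
  rewrite mulrCA ler_pdivrMl// mulrCA ler_pdivrMl// (mulrC (e / 3)).
  apply: (@le_trans _ _ ((2 * C + 1) * dd)).
    apply: ler_pM => //; [by rewrite mulr_ge0|by rewrite lerDl|exact: ltW].
  by rewrite /dd; apply: le_of_eq; field; rewrite gt_eqF.
by rewrite mulrDr; lra.
Unshelve. all: end_near. Qed.

End quasi_invariant_transport.

(** * Orthogonal projections on an increasing sequence of spans *)

Section best_approximation.
Context {R : realType} {V : normedModType R} (ip : {dot V for idfun}).
Variable K : R.
Hypothesis normr_le : forall v, `|v| ^+ 2 <= ip v v.
Hypothesis ip_le : forall v, ip v v <= K * `|v| ^+ 2.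

Lemma lspan_projection (s : seq V) v : orthonormal ip s -> lspan s v ->
  \sum_(u <- s) ip u v *: u = v.
Proof.
move=> os [c vE]; apply/eqP; rewrite -subr_eq0; apply/negPn/negP => z0.
have := dot_gt0 ip z0; set z := _ - v.
have uz u : u \in s -> ip u z = 0.
  by move=> us; rewrite dotDr dotNr dot_orthonormal_projection// subrr.
rewrite {1}/z dotDl dotNl dot_suml big_seq big1 => [|u us]; last first.
  by rewrite dotZl uz ?mulr0.
rewrite {1}vE dot_suml big1 ?subrr ?ltxx// => i _.
by rewrite dotZl uz ?mulr0// mem_nth.
Qed.

(** By density some [v] in one of the spans is close to [X]. Later projections fix [v], and the
    projection error of [z = X - v] is not longer than [z] for the scalar product. The two norm
    comparisons translate this into the norm of [V]. *)
Lemma cvg_orthonormal_projection (w : nat -> seq V) (X : V) :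
  (forall n, orthonormal ip (w n)) ->
  (forall n, lspan (w n) `<=` lspan (w n.+1)) ->
  dense (\bigcup_n lspan (w n)) ->
  \sum_(u <- w n) ip u X *: u @[n --> \oo] --> X.
Proof.
move=> ow sw dw; apply/cvgrPdist_lt => e e0.
have K1 : 0 < `|K| + 1 by rewrite ltr_wpDl.
(* The norm comparisons cost at most a factor |K| + 1, because K <= (|K| + 1)^2. *)
pose d := e / (`|K| + 1).
have d0 : 0 < d by exact: divr_gt0.
have [||v [/= Xv [N _ vN]]] := dw (ball X d).
- by exists X; exact: ballxx.
- exact: ball_open.
have inc n : (N <= n)%N -> lspan (w n) v.
  by move=> /subnK <-; elim: (n - N)%N => // k /sw.
exists N => // n /= /inc vn.
pose z := X - v; pose pz := \sum_(u <- w n) ip u z *: u.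
have -> : X - \sum_(u <- w n) ip u X *: u = z - pz.
  have -> : \sum_(u <- w n) ip u X *: u = pz + v.
    rewrite -[in RHS](lspan_projection (ow n) vn) -big_split /=; apply: eq_bigr => u _.
    by rewrite -scalerDl -dotDr subrK.
  by rewrite opprD addrA addrAC.
have pzz : ip pz z = \sum_(u <- w n) ip u z ^+ 2.
  by rewrite dot_suml; apply: eq_bigr => u _; rewrite dotZl expr2.
have pzpz : ip pz pz = \sum_(u <- w n) ip u z ^+ 2.
  rewrite dot_suml big_seq [RHS]big_seq; apply: eq_bigr => u us.
  by rewrite dotZl dot_orthonormal_projection.
have zpz : ip (z - pz) (z - pz) <= ip z z.
  have E a b : ip (a - b) (a - b) = ip a a - 2 * ip b a + ip b b.
    by rewrite dotDl !dotDr !dotNl !dotNr (dotC ip a b); ring.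
  rewrite (E z pz) pzz pzpz.
  have : 0 <= \sum_(u <- w n) ip u z ^+ 2 by apply: sumr_ge0 => u _; exact: sqr_ge0.
  by lra.
have zd : `|z| < d by move: Xv; rewrite -ball_normE.
have h1 := normr_le (z - pz); have h2 := ip_le z.
have z0 : 0 <= `|z| by [].
rewrite -(@ltr_pXn2r _ 2)// ?nnegrE ?(ltW e0)//.
apply: (le_lt_trans (le_trans h1 (le_trans zpz h2))).
apply: (@le_lt_trans _ _ ((`|K| + 1) ^+ 2 * `|z| ^+ 2)).
  apply: ler_wpM2r; first exact: exprn_ge0.
  by have := ler_norm K; have : 0 <= `|K| by []; set k := `|K|; nra.
have pz0 : 0 <= (`|K| + 1) * `|z| by rewrite mulr_ge0// ltW.
by rewrite -exprMn ltr_pXn2r// ?nnegrE ?(ltW e0)// mulrC -ltr_pdivlMr.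
Qed.

End best_approximation.

(** * Integrals depending on a parameter *)

Section parametric_integrals.
Context {d d' : measure_display} {T : measurableType d} {S : measurableType d'}
  {R : realType}.
Variables (mu : probability T R) (L : {sigma_finite_measure set S -> \bar R}) (D : set S).
Hypotheses (mD : measurable D) (LD : L D = 1%E).

Section nonnegative.
Variable f : T * S -> \bar R.
Hypotheses (mf : measurable_fun setT f) (f0 : forall z, (0 <= f z)%E).

Let g (z : T * S) := (f z * (\1_D z.2)%:E)%E.

Let mg : measurable_fun setT g.
Proof.
apply: emeasurable_funM => //; apply/measurable_EFinP.
by apply: (measurableT_comp _ (measurable_snd)); exact: measurable_indic.
Qed.

Let g0 z : (0 <= g z)%E.
Proof. by rewrite mule_ge0// lee_fin. Qed.

Let fgE Y : (\int[L]_(s in D) f (Y, s) = \int[L]_s g (Y, s))%E.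
Proof. by rewrite integral_mkcond; apply: eq_integral => s _; rewrite epatch_indic. Qed.

Lemma measurable_section_integral :
  measurable_fun setT (fun Y => (\int[L]_(s in D) f (Y, s))%E).
Proof.
rewrite (_ : (fun _ => _) = fun Y => (\int[L]_s g (Y, s))%E).
  exact: (measurable_fun_fubini_tonelli_F _ mg g0).
by apply/funext => Y; exact: fgE.
Qed.

Lemma tonelli_section : (\int[mu]_Y \int[L]_(s in D) f (Y, s) =
  \int[L]_(s in D) \int[mu]_Y f (Y, s))%E.
Proof.
under eq_integral => Y _ do rewrite fgE.
rewrite (@fubini_tonelli _ _ _ _ _ mu L g mg g0) [RHS]integral_mkcond.
apply: eq_integral => s _; rewrite epatch_indic /g /=.
rewrite ge0_integralZr//; exact: measurableT_comp mf (measurable_pair2 s).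
Qed.

End nonnegative.

Lemma measurable_section_Rintegral (A : T * S -> R) : measurable_fun setT A ->
  measurable_fun setT (fun Y => \int[L]_(s in D) A (Y, s))%R.
Proof.
move=> mA.
have mE : measurable_fun setT (EFin \o A) by exact/measurable_EFinP.
have hp := @measurable_section_integral _ (measurable_funepos mE) (fun z => funepos_ge0 _ z).
have hn := @measurable_section_integral _ (measurable_funeneg mE) (fun z => funeneg_ge0 _ z).
rewrite (_ : (fun Y => _) = fun Y => fine (
    \int[L]_(s in D) (EFin \o A)^\+ (Y, s) - \int[L]_(s in D) (EFin \o A)^\- (Y, s))%E).
  by apply: (measurableT_comp (fine_measurable measurableT)); exact: emeasurable_funB.
apply/funext => Y; rewrite /Rintegral integralE; congr (fine (_ - _)%E).
  by apply: eq_integral => s _; rewrite !funeposE.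
by apply: eq_integral => s _; rewrite !funenegE.
Qed.

Let cstE a : (\int[L]_(s in D) (cst a%:E s) = a%:E)%E.
Proof. by rewrite integral_cst// [X in (_ * X)%E]LD mule1. Qed.

Variable A : T * S -> R.
Hypothesis mA : measurable_fun setT A.
Variable C : R.
Hypothesis AC : {ae L, forall s, D s -> {ae mu, forall Y, `|A (Y, s)| <= C}}.

Let mA1 Y : measurable_fun setT (fun s => A (Y, s)).
Proof. exact: measurableT_comp mA (measurable_pair1 Y). Qed.

Let c Y := (\int[L]_(s in D) A (Y, s))%R.

(* By Tonelli, [A] and its truncation at [C] agree for almost all [(Y, s)]; the
   truncation is bounded everywhere. *)
Let clamp Y s := Num.max (- C) (Num.min C (A (Y, s))).

Let E (z : T * S) := (`|A z - clamp z.1 z.2|)%:E.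

Let mclamp : measurable_fun setT (fun z : T * S => clamp z.1 z.2).
Proof.
rewrite /clamp; under eq_fun do rewrite -surjective_pairing.
by apply: measurable_maxr => //; apply: measurable_minr.
Qed.

Let mE : measurable_fun setT E.
Proof.
apply/measurable_EFinP; apply: measurableT_comp => //.
exact: measurable_funB.
Qed.

Let E0 z : (0 <= E z)%E. Proof. by rewrite lee_fin. Qed.

Lemma ae_section_bounded : {ae mu, forall Y, {ae L, forall s, D s -> `|A (Y, s)| <= `|C|}}.
Proof.
have h : (\int[mu]_Y \int[L]_(s in D) E (Y, s) = 0)%E.
  rewrite (tonelli_section mE E0).
  transitivity (\int[L]_(s in D) (cst 0%E s))%E; last by rewrite integral0.
  apply: ge0_ae_eq_integral => //.
  - apply: measurable_funTS; by apply: (measurable_fun_fubini_tonelli_G _ mE) => z;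
    rewrite lee_fin.
  - by move=> s _; apply: integral_ge0 => Y _; rewrite lee_fin.
  apply: filterS AC => s sC0 Ds; have {}sC := sC0 Ds.
  transitivity (\int[mu]_Y (cst 0%E Y))%E; last by rewrite integral0.
  apply: ge0_ae_eq_integral => //.
    exact: measurableT_comp mE (measurable_pair2 s).
  apply: filterS sC => Y YC _; rewrite /E /clamp /=.
  move: YC; rewrite ler_norml => /andP[h1 h2].
  by rewrite (min_idPr h2) (max_idPr h1) subrr normr0.
have {}h : ae_eq mu setT (fun Y => (\int[L]_(s in D) E (Y, s))%E) (cst 0%E).
  apply/ae_eq_integral_abs => //; first exact: (measurable_section_integral mE E0).
  under eq_integral => Y _ do rewrite gee0_abs ?integral_ge0//.
  exact: h.
apply: filterS h => Y /(_ Logic.I) h.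
have : ae_eq L D (fun s => E (Y, s)) (cst 0%E).
  apply/ae_eq_integral_abs => //.
    exact/measurable_funTS/(measurableT_comp mE (measurable_pair1 Y)).
  by rewrite -[RHS]h; apply: eq_integral => s _; rewrite gee0_abs.
apply: filterS => s /[apply] /= [] [] /normr0_eq0/eqP; rewrite subr_eq0 /clamp => /eqP ->.
rewrite ler_norml le_max lerN2 ler_norm /= ge_max ge_min ler_norm /= andbT.
by rewrite -normrN ler_norm.
Qed.

Lemma ae_section_integrable :
  {ae mu, forall Y, L.-integrable D (fun s => (A (Y, s))%:E)}.
Proof.
apply: filterS ae_section_bounded => Y YC; apply/integrableP; split.
  by apply/measurable_EFinP; exact: measurable_funTS.
apply: (@le_lt_trans _ _ (\int[L]_(s in D) (cst (`|C|)%:E s))%E).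
  apply: ae_ge0_le_integral => //; last by move=> s _; rewrite lee_fin.
  by apply/measurable_EFinP; apply: measurableT_comp => //; exact: measurable_funTS.
by rewrite cstE; exact: ltry.
Qed.

Let le_Rint Y : L.-integrable D (fun s => (A (Y, s))%:E) ->
  (`|c Y|%:E <= \int[L]_(s in D) (`|A (Y, s)|)%:E)%E.
Proof.
move=> iA; rewrite /c /Rintegral.
have fA : (\int[L]_(s in D) (A (Y, s))%:E)%E \is a fin_num by exact: integrable_fin_num.
rewrite -fine_abse// fineK ?abse_fin_num//.
by apply: le_abse_integral => //; exact: measurable_int iA.
Qed.

Lemma ae_section_Rintegral_le : {ae mu, forall Y, `|c Y| <= `|C|}.
Proof.
apply: filterS2 ae_section_bounded ae_section_integrable => Y YC iA.
rewrite -lee_fin; apply: le_trans (le_Rint iA) _.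
apply: (@le_trans _ _ (\int[L]_(s in D) (cst (`|C|)%:E s))%E); last first.
  by rewrite cstE.
apply: ae_ge0_le_integral => //; last by move=> s _; rewrite lee_fin.
by apply/measurable_EFinP; apply: measurableT_comp => //; exact: measurable_funTS.
Qed.

Variable An : nat -> T * S -> R.
Hypothesis mAn : forall n, measurable_fun setT (An n).
Hypothesis AnC : forall n Y s, D s -> `|An n (Y, s)| <= C.
Hypothesis Acvg : {ae L, forall s, D s ->
  (\int[mu]_Y (`|An n (Y, s) - A (Y, s)|)%:E)%E @[n --> \oo] --> 0%E}.

Let mdiff n : measurable_fun setT (fun z => (`|An n z - A z|)%:E).
Proof.
apply/measurable_EFinP; apply: measurableT_comp => //; exact: measurable_funB.
Qed.

(** By Tonelli the distance is at most the integral over [D] of the L^1 distances at fixed s. These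
    tend to 0 for almost every s and are dominated by a constant, which is integrable since [D] has
    measure 1. *)
Lemma cvg_section_Rintegral :
  (\int[mu]_Y (`|(\int[L]_(s in D) An n (Y, s))%R - c Y|)%:E)%E @[n --> \oo] --> 0%E.
Proof.
have bnd n : (\int[mu]_Y (`|(\int[L]_(s in D) An n (Y, s))%R - c Y|)%:E <=
    \int[L]_(s in D) \int[mu]_Y (`|An n (Y, s) - A (Y, s)|)%:E)%E.
  rewrite -(tonelli_section (mdiff n))//.
  apply: ae_ge0_le_integral => //.
  - apply/measurable_EFinP; apply: measurableT_comp => //; apply: measurable_funB.
      exact: measurable_section_Rintegral.
    exact: measurable_section_Rintegral.
  - by move=> Y _; exact: integral_ge0.
  - exact: (measurable_section_integral (mdiff n)).
  apply: filterS ae_section_integrable => Y iA _.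
  have iAn : L.-integrable D (fun s => (An n (Y, s))%:E).
    apply/integrableP; split.
      by apply/measurable_EFinP;
        apply/measurable_funTS/(measurableT_comp (mAn n) (measurable_pair1 Y)).
    apply: (@le_lt_trans _ _ (\int[L]_(s in D) (cst C%:E s))%E).
      apply: ge0_le_integral => //.
      - by apply/measurable_EFinP; apply: measurableT_comp => //;
        apply/measurable_funTS/(measurableT_comp (mAn n) (measurable_pair1 Y)).
      - by move=> s Ds; rewrite /= lee_fin AnC.
    by rewrite cstE; exact: ltry.
  rewrite /c -RintegralB//.
  have iB := integrableB mD iAn iA.
  rewrite /Rintegral.
  have fB : (\int[L]_(s in D) (An n (Y, s) - A (Y, s))%:E)%E \is a fin_num by exact:
    integrable_fin_num.
  rewrite -fine_abse// fineK ?abse_fin_num//.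
  by apply: le_abse_integral => //; exact: measurable_int iB.
apply: (@squeeze_cvge _ _ _ _ (cst 0%E) _
  (fun n => \int[L]_(s in D) \int[mu]_Y (`|An n (Y, s) - A (Y, s)|)%:E)%E).
- by apply: nearW => n; rewrite bnd integral_ge0.
- exact: cvg_cst.
pose In n s := (\int[mu]_Y (`|An n (Y, s) - A (Y, s)|)%:E)%E.
have mIn n : measurable_fun D (In n).
  apply: measurable_funTS.
  by apply: (measurable_fun_fubini_tonelli_G _ (mdiff n)) => z; rewrite lee_fin.
have iC : L.-integrable D (cst (C + `|C|)%:E).
  apply/integrableP; split => //.
  under eq_integral => s _ do rewrite abse_EFin.
  by rewrite cstE; exact: ltry.
have dom : {ae L, forall s n, D s -> (`|In n s| <= (cst (C + `|C|)%:E s))%E}.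
  apply: filterS AC => s sC n Ds.
  rewrite gee0_abs ?integral_ge0//.
  apply: (@le_trans _ _ (\int[mu]_Y (cst (C + `|C|)%:E Y))%E); last first.
    by rewrite integral_cst// [X in (_ * X)%E]probability_setT mule1.
  apply: ae_ge0_le_integral => //.
  - exact: (measurableT_comp (mdiff n) (measurable_pair2 s)).
  - by move=> Y _; rewrite lee_fin addr_ge0//; exact: le_trans (AnC n Y Ds).
  apply: filterS (sC Ds) => Y YC _; rewrite lee_fin.
  apply: le_trans (ler_normB _ _) _; rewrite lerD ?AnC//.
  exact: le_trans (ler_norm _).
have [_ _] := dominated_convergence mD mIn (measurable_cst 0%E) Acvg iC dom.
by rewrite integral0.
Qed.

End parametric_integrals.

Section joint_measurability.
Context {R : realType} {W : normedModType R}.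
Hypothesis W_separable :
  exists w : nat -> W, forall x e, 0 < e -> exists n, `|x - w n| < e.

(** An open set is a countable union of boxes centred at points of dense sequences of both factors,
    and boxes are measurable rectangles. *)
Lemma open_prod_measurable (O : set (W * R)) : open O ->
  measurable (O : set (borel W * measurableTypeR R)).
Proof.
move=> oO; have [w wd] := W_separable.
have [q qd] : exists q : nat -> R, forall x e, 0 < e -> exists n, `|x - q n| < e.
  have [|q qd] := @dense_sequence R R _ _ (@dense_rat R); last by exists q.
  exact: (card_le_trans (card_image_le _ _) (countableP _)).
pose box (i : nat * nat * nat) : set (W * R) :=
  [set z | `|w i.1.1 - z.1| < i.2.+1%:R^-1 /\ `|q i.1.2 - z.2| < i.2.+1%:R^-1].
have -> : O = \bigcup_(i in [set i | box i `<=` O]) box i.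
  apply/seteqP; split => [z Oz|z [i /= iO /iO]//].
  have /nbhs_ballP[e /= e0 eO] : nbhs z O by exact: open_nbhs_nbhs.
  have e2 : 0 < e / 2 by rewrite divr_gt0.
  have [k _ /(_ k (leqnn k)) /= hk] := near_infty_natSinv_lt (PosNum e2).
  have k0 : 0 < k.+1%:R^-1 :> R by rewrite invr_gt0.
  have [n hn] := wd z.1 _ k0; have [m hm] := qd z.2 _ k0.
  exists ((n, m), k) => /=; last by split; rewrite distrC.
  move=> t /= [t1 t2]; apply: eO; split; rewrite -ball_normE /=.
    apply: (le_lt_trans (ler_distD (w n) z.1 t.1)).
    by move: hk hn t1; set u := _^-1; lra.
  apply: (le_lt_trans (ler_distD (q m) z.2 t.2)).
  by move: hk hm t2; set u := _^-1; lra.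
rewrite bigcup_mkcond; apply: countable_bigcupT_measurable => [|i].
  exact: countableP.
case: ifPn => // _.
have -> : box i = ball (w i.1.1) (i.2.+1%:R^-1) `*` ball (q i.1.2) (i.2.+1%:R^-1).
  by rewrite -!ball_normE.
apply: measurableX.
  apply: sub_sigma_algebra; exact: ball_open.
by apply: open_measurable; exact: ball_open.
Qed.

Lemma continuous_prod_measurable (W' : normedModType R) (f : W * R -> W') :
  continuous f ->
  measurable_fun setT (f : borel W * measurableTypeR R -> borel W').
Proof.
move=> /continuousP cf.
apply: (@measurability _ _ _ (borel W') _ _ (@open W')) => //.
by move=> _ [U Uo <-]; rewrite setTI; apply: open_prod_measurable; exact: cf.
Qed.

End joint_measurability.

(** * Words of directions and the Taylor formula along them *)

Section words.
Context {T : eqType} (D : seq T).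

Fixpoint tuple_words i : seq (i.-tuple T) :=
  match i return seq (i.-tuple T) with
  | 0 => [:: [tuple]]
  | i'.+1 => [seq cons_tuple d u | d <- D, u <- tuple_words i']
  end.

Lemma mem_tuple_words i (u : i.-tuple T) :
  (u \in tuple_words i) = all [in D] u.
Proof.
elim: i u => [|i ih] u; first by rewrite tuple0 inE eqxx.
have [d [v ->]] : exists d (v : i.-tuple T), u = cons_tuple d v.
  by case/tupleP: u => d v; exists d, v.
rewrite /= -ih; apply/allpairsP/andP => [[[d' v'] /= [dD vD /eqP]]|[dD vD]].
  rewrite -val_eqE /= eqseq_cons => /andP[/eqP -> vv'].
  by rewrite (_ : v = v')//; exact/val_inj/eqP.
by exists (d, v).
Qed.

Lemma uniq_tuple_words i : uniq D -> uniq (tuple_words i).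
Proof.
move=> uD; elim: i => // i ih; apply: allpairs_uniq => // -[d u] [d' u'] _ _ /=.
move=> /(congr1 val) /= [-> uu'].
by congr pair; exact/val_inj.
Qed.

Lemma prod_tuple_words (R : comNzRingType) (c : T -> R) i :
  \sum_(u <- tuple_words i) \prod_(d <- u) c d = (\sum_(d <- D) c d) ^+ i.
Proof.
elim: i => [|i ih]; first by rewrite big_seq1 big_nil expr0.
rewrite /= big_allpairs_dep /= exprS -ih big_distrl /=; apply: eq_bigr => d _.
by rewrite big_distrr /=; apply: eq_bigr => u _; rewrite big_cons.
Qed.

End words.

Section multidirectional_taylor.
Context {R : realType} {V : normedModType R} {T : eqType}.
Variables (w : T -> V) (g : seq T -> V -> R) (n : nat).
Hypothesis dg : forall s d x, (size s <= n)%N -> derivable (g s) x (w d).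
Hypothesis gE : forall s d, (size s <= n)%N -> g (d :: s) = fun x => 'D_(w d) (g s) x.
Hypothesis cg : forall s, (size s <= n.+1)%N -> continuous (g s).
Variables (D : seq T) (c : T -> R) (x : V).

Let v := \sum_(d <- D) c d *: w d.
(** The i-th derivative of s -> g [::] (x + s v), expanded over words: each differentiation along v
    prepends one letter. *)
Let phi i (s : R) :=
  \sum_(u <- tuple_words D i) (\prod_(d <- u) c d) * g u (x + s *: v).

Let dphi i (s : R) : (i <= n)%N -> is_derive s (1 : R) (phi i) (phi i.+1 s).
Proof.
move=> ni.
have -> : phi i.+1 s = \sum_(u <- tuple_words D i) (\prod_(d <- u) c d) *
    \sum_(d <- D) c d * 'D_(w d) (g u) (x + s *: v).
  rewrite /phi /= big_allpairs_dep /= exchange_big /=; apply: eq_bigr => u _.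
  rewrite big_distrr /=; apply: eq_bigr => d _.
  by rewrite big_cons gE ?size_tuple//; ring.
rewrite /phi; elim: (tuple_words D i) => [|u us ih].
  rewrite big_nil (_ : (fun s : R => _) = cst 0); first exact: is_derive_cst.
  by apply/funext => t; rewrite big_nil.
rewrite big_cons (_ : (fun s : R => _) =
    (\prod_(d <- u) c d \*: (fun t : R => g u (x + t *: v))) +
    (fun t : R => \sum_(u <- us) (\prod_(d <- u) c d) * g u (x + t *: v))); last first.
  by apply/funext => t; rewrite big_cons.
apply: is_deriveD => //; apply: is_deriveZ; apply: is_derive_line.
have su : (size u <= n)%N by rewrite size_tuple.
apply: is_derive_direction_sum => [d z|d]; first exact: dg.
rewrite -(gE _ su); apply: cg; exact: su.
Qed.

Let cline u : (size u <= n.+1)%N -> continuous (fun s : R => g u (x + s *: v)).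
Proof.
move=> su s; apply: (@continuous_comp _ _ _ (fun s : R => x + s *: v) (g u)).
  by apply: cvgD; [exact: cvg_cst|apply: cvgZl; exact: cvg_id].
exact: cg.
Qed.

Let csum (us : seq (n.+1.-tuple T)) : continuous
  (fun s : R => \sum_(u <- us) (\prod_(d <- u) c d) * g u (x + s *: v)).
Proof.
elim: us => [|u us ih] s.
  rewrite (_ : (fun s : R => _) = cst 0); last by apply/funext => t; rewrite big_nil.
  exact: cvg_cst.
rewrite (_ : (fun s : R => _) = fun s : R => (\prod_(d <- u) c d) * g u (x + s *: v) +
  \sum_(u <- us) (\prod_(d <- u) c d) * g u (x + s *: v)).
  by apply: cvgD; [apply: cvgMr; apply: cline; rewrite size_tuple|exact: ih].
by apply/funext => t; rewrite big_cons.
Qed.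

Let rho (s : R) : R := (1 - s) ^+ n / n`!%:R.

Let crho : continuous rho.
Proof.
move=> s; apply: cvgMl.
apply: (@continuous_comp _ _ _ (fun t : R => 1 - t) (fun t : R => t ^+ n)).
  by apply: cvgB; [exact: cvg_cst|exact: cvg_id].
exact: exprn_continuous.
Qed.

Let integrable01 (f : R -> R) : continuous f ->
  lebesgue_measure.-integrable `[0, 1] (EFin \o f).
Proof.
move=> cf; apply: continuous_compact_integrable; first exact: segment_compact.
exact: continuous_subspaceT.
Qed.

Lemma multidirectional_taylor :
  g [::] (x + v) =
    \sum_(0 <= i < n.+1) i`!%:R^-1 *
      (\sum_(u <- tuple_words D i) (\prod_(d <- u) c d) * g u x) +
    \sum_(u <- tuple_words D n.+1) (\prod_(d <- u) c d) *
      (\int[lebesgue_measure]_(s in `[0%R, 1%R])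
         ((1 - s) ^+ n / n`!%:R * g u (x + s *: v)))%R.
Proof.
have cphi : continuous (phi n.+1) by exact: csum.
have := taylor_integral dphi cphi.
have -> : phi 0%N 1 = g [::] (x + v).
  by rewrite /phi /= big_seq1 big_nil mul1r scale1r.
move=> ->; congr (_ + _).
  by apply: eq_bigr => i _; congr (_ * _); apply: eq_bigr => u _; rewrite scale0r addr0.
rewrite -/rho /phi; elim: (tuple_words D n.+1) => [|u us ih].
  rewrite big_nil; under eq_Rintegral => s _ do rewrite big_nil mulr0.
  by rewrite /Rintegral integral0.
rewrite big_cons -ih -RintegralZl//; last first.
  apply: (integrable01 (f := fun s => rho s * g u (x + s *: v))) => s.
  by apply: cvgM; [exact: crho|apply: cline; rewrite size_tuple].
have cs : continuous (fun s => rho s * \sum_(u <- us) (\prod_(d <- u) c d) * g u (x + s *: v)).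
  move=> s; apply: cvgM; first exact: crho.
  exact: csum.
have cu : continuous (fun s => (\prod_(d <- u) c d) * (rho s * g u (x + s *: v))).
  move=> s; apply: cvgMr; apply: cvgM; first exact: crho.
  by apply: cline; rewrite size_tuple.
rewrite -RintegralD//; last 2 first.
- exact: (integrable01 cu).
- exact: (integrable01 cs).
by apply: eq_Rintegral => s _; rewrite big_cons /rho; ring.
Qed.

End multidirectional_taylor.

(** * Finite exhaustions of the index set and the associated frames *)

Section initial_segments.
Context {T : countType}.

(** The elements of code less than n. Passing from n to n + 1 adds at most one element, since some
    numbers are no codes. *)
Definition initial n : seq T := pmap (@pickle_inv T) (seq.iota 0 n).

Lemma mem_initial n d : (d \in initial n) = (choice.pickle d < n)%N.
Proof.
rewrite mem_pmap; apply/mapP/idP => [[j]|dn].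
  rewrite mem_iota /= add0n => iN /esym E.
  by have := @pickle_invK T j; rewrite E /= => ->.
by exists (choice.pickle d); rewrite ?mem_iota ?add0n// pickleK_inv.
Qed.

Lemma uniq_initial n : uniq (initial n).
Proof. by apply: (pmap_uniq (@pickle_invK T)); exact: iota_uniq. Qed.

Lemma initialS n : initial n.+1 = initial n ++ seq_of_opt (@pickle_inv T n).
Proof.
by rewrite /initial -addn1 iotaD pmap_cat /= add0n; case: (@pickle_inv T n).
Qed.

End initial_segments.

Section linear_spans.
Context {R : realType} {V : lmodType R}.
Implicit Types (s t : seq V) (u v : V).

Lemma lspan0 s : lspan s 0.
Proof. by exists (fun=> 0); rewrite big1// => i _; rewrite scale0r. Qed.

Lemma lspanZD s a u v : lspan s u -> lspan s v -> lspan s (a *: u + v).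
Proof.
move=> [c ->] [c' ->]; exists (fun i => a * c i + c' i).
rewrite scaler_sumr -big_split /=; apply: eq_bigr => i _.
by rewrite scalerDl scalerA.
Qed.

Lemma lspan_mem s v : v \in s -> lspan s v.
Proof.
move=> vs; exists (fun i => (i == index v s)%:R).
have vi : (index v s < size s)%N by rewrite index_mem.
rewrite (bigD1 (Ordinal vi)) //= eqxx scale1r nth_index// big1 ?addr0// => i.
by rewrite -val_eqE /= => /negPf ->; rewrite scale0r.
Qed.

Lemma lspan_subset s t : {subset s <= t} -> lspan s `<=` lspan t.
Proof.
move=> st _ [c ->]; elim/big_rec: _ => [|i v _ vt]; first exact: lspan0.
by apply: lspanZD => //; apply: lspan_mem; apply: st; rewrite mem_nth.
Qed.

End linear_spans.

Section orthonormal_frame.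
Context {R : realType} {V W : normedModType R} (ip : {dot V for idfun}).
Variable iota : V -> W.
Hypothesis iota_dense : dense (range iota).
Variable K : R.
Hypothesis normr_le : forall v, `|v| ^+ 2 <= ip v v.
Hypothesis ip_le : forall v, ip v v <= K * `|v| ^+ 2.
Context {T : countType}.
Variables (w : T -> V) (y : T -> W -> R).
Hypothesis ow : forall d d', ip (w d) (w d') = (d == d')%:R.
Hypothesis dw : dense [set v | exists s : seq T, lspan (map w s) v].
Hypothesis yw : forall d, dual_vector ip iota (y d) (w d).

Definition frame n : seq V := map w (initial n).

Definition frame_proj n (Y : W) : V := \sum_(d <- initial n) y d Y *: w d.

Lemma orthonormal_frame_map s : uniq s -> orthonormal ip (map w s).
Proof.
elim: s => // d s ih /= /andP[ds us]; apply/orthonormal_consP; split.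
- by rewrite ow eqxx.
- move=> _ /mapP[d' d's ->]; rewrite ow; case: eqVneq => // dd'.
  by move: ds; rewrite dd' d's.
- exact: ih.
Qed.

Lemma orthonormal_frame n : orthonormal ip (frame n).
Proof. by apply: orthonormal_frame_map; exact: uniq_initial. Qed.

Lemma lspan_frameS n : lspan (frame n) `<=` lspan (frame n.+1).
Proof.
apply: lspan_subset => _ /mapP[d dn ->]; apply: map_f.
by rewrite initialS mem_cat dn.
Qed.

Lemma dense_frame : dense (\bigcup_n lspan (frame n)).
Proof.
move=> O O0 oO; have [v [Ov [s sv]]] := dw O0 oO; exists v; split => //.
exists (\max_(d <- s) (choice.pickle d).+1)%N => //.
apply: lspan_subset sv => _ /mapP[d ds ->]; apply: map_f.
by rewrite mem_initial; exact: (leq_bigmax_seq (F := fun d => (choice.pickle d).+1) (P :=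
  xpredT)).
Qed.

Lemma cvg_frame X : \sum_(d <- initial n) ip (w d) X *: w d @[n --> \oo] --> X.
Proof.
have := @cvg_orthonormal_projection _ _ _ _ normr_le ip_le _ X orthonormal_frame
  lspan_frameS dense_frame.
by under eq_fun do rewrite big_map.
Qed.

Lemma frame_proj_continuous n : continuous (frame_proj n).
Proof.
rewrite /frame_proj; elim: (initial n) => [|d s ih] Y.
  rewrite (_ : (fun Y => _) = cst 0); last by apply/funext => Z; rewrite big_nil.
  exact: cvg_cst.
rewrite (_ : (fun Y => _) = fun Y => y d Y *: w d + \sum_(d <- s) y d Y *: w d).
  by apply: cvgD; [apply: cvgZl; have [_ + _] := yw d; exact|exact: ih].
by apply/funext => Z; rewrite big_cons.
Qed.

Lemma frame_proj_affine n X s Y : frame_proj n (iota X + s *: Y) =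
  \sum_(d <- initial n) ip (w d) X *: w d + s *: frame_proj n Y.
Proof.
rewrite /frame_proj scaler_sumr -big_split /=; apply: eq_bigr => d _.
have [ys _ ya] := yw d.
by rewrite (scalarD ys) (scalarZ ys) ya scalerDl scalerA.
Qed.

Section gaussian_frame.
Variables (h : R) (mu : probability (borel W) R).
Hypotheses (h0 : 0 < h) (gmu : gaussian_measure ip iota h mu).

(** [proj_ext] uses arbitrary representatives of the classes [ell], which agree with the functionals
    [y d] off null sets; only finitely many of them occur. The continuous [frame_proj], linear in Y
    at every point, can then take its place. *)
Lemma proj_ext_frame n :
  {ae mu, forall z : borel W, proj_ext ip iota mu (frame n) z = frame_proj n z}.
Proof.
have E z : proj_ext ip iota mu (frame n) z =
    \sum_(d <- initial n) ell ip iota mu (w d) z *: w d.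
  by rewrite /proj_ext -(big_mkord xpredT (fun k => ell ip iota mu (frame n)`_k z *: (frame
    n)`_k))
    -(big_nth 0 xpredT (fun v => ell ip iota mu v z *: v)) big_map.
have : {ae mu, forall z : borel W, forall d, d \in initial n -> ell ip iota mu (w d) z = y d z}.
  elim: (initial n) => [|d s ih]; first exact: nearW.
  apply: filterS2 ih (ell_dual_ae iota_dense h0 gmu ip_le (yw d)) => z zs zd d'.
  by rewrite inE => /predU1P[->|/zs].
apply: filterS => z zE; rewrite E /frame_proj big_seq [RHS]big_seq.
by apply: eq_bigr => d dn; rewrite zE.
Qed.

End gaussian_frame.

End orthonormal_frame.

(** * Extensions evaluated at translated and rescaled points *)

Section frame_limits.
Context {R : realType} {V W : normedModType R} (ip : {dot V for idfun}).
Variable iota : V -> W.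
Hypothesis iota_dense : dense (range iota).
Hypothesis W_separable :
  exists w : nat -> W, forall x e, 0 < e -> exists n, `|x - w n| < e.
Hypothesis W_dual : forall y : W -> R, scalar y -> continuous y ->
  exists a, forall x, y (iota x) = ip a x.
Variable K : R.
Hypothesis normr_le : forall v, `|v| ^+ 2 <= ip v v.
Hypothesis ip_le : forall v, ip v v <= K * `|v| ^+ 2.
Context {T : countType}.
Variables (w : T -> V) (y : T -> W -> R).
Hypothesis ow : forall d d', ip (w d) (w d') = (d == d')%:R.
Hypothesis dw : dense [set v | exists s : seq T, lspan (map w s) v].
Hypothesis yw : forall d, dual_vector ip iota (y d) (w d).
Variables (h : R) (mu : R -> probability (borel W) R).
Hypothesis h0 : 0 < h.
Hypothesis hmu : forall h', 0 < h' -> gaussian_measure ip iota h' (mu h').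

Variables (g : V -> R) (pg : W -> R) (C M E : R) (eps : T -> R).
Hypothesis cg : continuous g.
Hypothesis gC : forall x, `|g x| <= C.
Hypothesis dg : forall d x, derivable g x (w d).
Hypothesis gM : forall d x, `|'D_(w d) g x| <= M * eps d.
Hypothesis M0 : 0 <= M.
Hypothesis eps0 : forall d, 0 <= eps d.
Hypothesis epsE : forall n, \sum_(d <- initial n) eps d <= E.
Hypothesis mpg : measurable_fun setT (pg : borel W -> R).
Hypothesis gcvg : forall h', 0 < h' <= h ->
  (\int[mu h']_z (`|g (frame_proj w y n z) - pg z|)%:E)%E @[n --> \oo] --> 0%E.

Variable X : V.

Let piX n := \sum_(d <- initial n) ip (w d) X *: w d.
Let r := Num.sqrt (ip X X).

(* [X] need not be in the span of the frame: [X + u] is reached along [piX m + u],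
   adding one direction at a time. *)
Lemma frame_modulus : exists2 b : nat -> R, b n @[n --> \oo] --> (0 : R) &
  forall n u, `|g (X + u) - g (piX n + u)| <= b n.
Proof.
pose e n := \sum_(d <- initial n) eps d.
have eS n : e n <= e n.+1.
  by rewrite /e initialS big_cat /= lerDl sumr_ge0.
have end_ : nondecreasing_seq e by exact/nondecreasing_seqP.
have ce : cvgn e.
  by apply: nondecreasing_is_cvgn => //; exists E => _ [n _ <-]; exact: epsE.
pose l := limn e.
have el n : e n <= l by exact: nondecreasing_cvgn_le.
(* Adding the coordinate of [X] along w_d, at most r = |X| in modulus, changes [g] by at most M r
   eps_d. The bound is the tail of the resulting series. *)
exists (fun n => M * r * (l - e n)).
  rewrite [X in _ --> X](_ : 0 = M * r * (l - l)); last by rewrite subrr mulr0.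
  by apply: cvgMr; apply: cvgB => //; exact: cvg_cst.
have wX d : `|ip (w d) X| <= r.
  rewrite -sqrtr_sqr ler_sqrt ?dot_ge0//.
  have := @bessel _ _ ip [:: w d] X; rewrite big_seq1; apply.
  by apply/orthonormal_consP; split; rewrite ?ow ?eqxx.
have r0 : 0 <= r by exact: sqrtr_ge0.
have step n u : `|g (piX n.+1 + u) - g (piX n + u)| <= M * r * (e n.+1 - e n).
  rewrite /piX /e initialS !big_cat /= [X in _ <= _ * X]addrAC subrr add0r.
  case: (@pickle_inv T n) => [d|] /=; last first.
    by rewrite !big_nil addr0 subrr normr0 mulr0.
  rewrite !big_seq1 addrAC.
  have [c _ ->] := mean_value_direction
    (\sum_(d <- initial n) ip (w d) X *: w d + u) (ip (w d) X) (fun z => @dg d z).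
  by rewrite normrM mulrAC mulrC ler_pM.
have stepk n k u : `|g (piX (n + k)%N + u) - g (piX n + u)| <= M * r * (e (n + k)%N - e n).
  elim: k => [|k ih]; first by rewrite addn0 !subrr normr0 mulr0.
  apply: (le_trans (ler_distD (g (piX (n + k)%N + u)) _ _)).
  rewrite addnS; have := step (n + k)%N u; move: ih; rewrite !mulrBr; lra.
move=> n u.
have cX : `|g (piX m + u) - g (piX n + u)| @[m --> \oo] --> `|g (X + u) - g (piX n + u)|.
  apply: cvg_norm; apply: cvgB; last exact: cvg_cst.
  apply: (@continuous_cvg _ _ _ _ _ _ g); first exact: cg.
  have cp : piX m @[m --> \oo] --> X := cvg_frame normr_le ip_le ow dw (X := X).
  by apply: cvgD; [exact: cp|exact: cvg_cst].
rewrite -(cvg_lim _ cX)//; apply: limr_le; first exact: cvgP cX.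
exists n => // m /= /subnKC <-; apply: le_trans (stepk _ _ _) _.
by rewrite ler_wpM2l ?mulr_ge0// lerD2r.
Qed.

Let phi (s : R) (Y : borel W) : borel W := iota X + s *: Y.

Let mphi s : measurable_fun setT (phi s).
Proof. by apply: continuous_borel_measurable; exact: affine_continuous. Qed.

Let quasi (s lam : R) N : 0 < s -> 0 < lam -> measurable N ->
  (mu h (phi s @^-1` N) <= (lam * expR (ip X X / (s ^+ 2 * h)))%:E +
    lam^-1%:E * mu (s ^+ 2 * h) N)%E.
Proof.
move=> s0 lam0 mN.
apply: (gaussian_quasi_invariance iota_dense W_separable W_dual) => //.
  exact: hmu.
by apply: hmu; rewrite mulr_gt0// exprn_gt0.
Qed.

Let s2h (s : R) : 0 < s <= 1 -> 0 < s ^+ 2 * h <= h.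
Proof.
move=> /andP[s0 s1]; rewrite mulr_gt0 ?exprn_gt0//= ler_piMl ?(ltW h0)//.
by rewrite exprn_ile1// ltW.
Qed.

Let gp_measurable n : measurable_fun setT (fun z : borel W => g (frame_proj w y n z)).
Proof.
apply: continuous_borel_measurableR => z; apply: continuous_comp.
  exact: (frame_proj_continuous yw).
exact: cg.
Qed.

Lemma ae_translate_bounded (s : R) : 0 < s <= 1 ->
  {ae mu h, forall Y : borel W, `|pg (iota X + s *: Y)| <= C}.
Proof.
move=> s01; have /andP[s0 _] := s01.
exact: (ae_bounded_transport (mphi s) (fun lam N => @quasi s lam N s0)
  gp_measurable mpg (fun n z => gC _) (gcvg (s2h s01))).
Qed.

(** Transport along Y -> iota X + s Y gives convergence of [g] at the projection of that point,
    which is the projection of [X] plus s times that of Y. [frame_modulus] then replaces the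
    projection of [X] by [X], uniformly in Y. *)
Lemma cvg_translate (s : R) : 0 < s <= 1 ->
  (\int[mu h]_Y (`|g (X + s *: frame_proj w y n Y) - pg (iota X + s *: Y)|)%:E)%E
    @[n --> \oo] --> 0%E.
Proof.
move=> s01; have /andP[s0 _] := s01.
have c1 := cvg_L1_transport (mphi s) (fun lam N => @quasi s lam N s0)
  gp_measurable mpg (fun n z => gC _) (gcvg (s2h s01)).
have [b b0 gb] := frame_modulus.
have mg0 n : measurable_fun setT (fun Y : borel W => g (X + s *: frame_proj w y n Y)).
  apply: continuous_borel_measurableR => z.
  apply: (@continuous_comp _ _ _ (fun Y : W => X + s *: frame_proj w y n Y) g).
    by apply: cvgD; [exact: cvg_cst|apply: cvgZr; exact: (frame_proj_continuous yw)].
  exact: cg.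
have mpgs : measurable_fun setT (fun Y : borel W => pg (iota X + s *: Y)).
  exact: (measurableT_comp mpg (mphi s)).
apply: (@squeeze_cvge _ _ _ _ (cst 0%E) _ (fun n => (b n)%:E +
    \int[mu h]_Y (`|g (frame_proj w y n (iota X + s *: Y)) - pg (iota X + s *: Y)|)%:E)%E).
- apply: nearW => n; rewrite integral_ge0//=.
  have bn0 : 0 <= b n by apply: le_trans (gb n 0).
  have mgn : measurable_fun setT
      (fun Y : borel W => g (frame_proj w y n (iota X + s *: Y))).
    exact: (measurableT_comp (gp_measurable n) (mphi s)).
  have -> : (b n)%:E = (\int[mu h]_Y (cst (b n)%:E Y))%E.
    by rewrite integral_cst// [X in (_ * X)%E]probability_setT mule1.
  rewrite -ge0_integralD//; last first.
    by apply/measurable_EFinP; apply: measurableT_comp => //; exact: measurable_funB.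
  apply: ge0_le_integral => //.
  + by apply/measurable_EFinP; apply: measurableT_comp => //; exact: measurable_funB.
  + apply: emeasurable_funD => //; apply/measurable_EFinP; apply: measurableT_comp => //;
    exact: measurable_funB.
  + move=> Y _; rewrite -EFinD lee_fin.
    apply: (le_trans (ler_distD (g (frame_proj w y n (iota X + s *: Y))) _ _)).
    by rewrite lerD2r (frame_proj_affine yw); exact: gb.
- exact: cvg_cst.
rewrite -[X in _ --> X]adde0; apply: cvgeD => //.
by apply/fine_cvgP; split => //; exact: nearW.
Qed.

Variable rho : R -> R.
Hypothesis crho : continuous rho.
Hypothesis rho1 : forall s, 0 <= s <= 1 -> `|rho s| <= 1.

Let L := @lebesgue_measure R.
Let I01 : set (measurableTypeR R) := `[0, 1]%classic.

Let A (z : borel W * measurableTypeR R) := rho z.2 * pg (iota X + z.2 *: z.1).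
Let An n (z : borel W * measurableTypeR R) :=
  rho z.2 * g (X + z.2 *: frame_proj w y n z.1).

Let mI01 : measurable I01.
Proof. exact: measurable_itv. Qed.

Let LI01 : L I01 = 1%E.
Proof. by rewrite /L /I01 lebesgue_measure_itv /= lte_fin ltr01 oppr0 adde0. Qed.

Let mrho : measurable_fun setT (fun z : borel W * measurableTypeR R => rho z.2).
Proof.
apply: (measurableT_comp _ measurable_snd).
exact: continuous_measurable_fun.
Qed.

Let mA : measurable_fun setT A.
Proof.
apply: measurable_funM; first exact: mrho.
apply: (measurableT_comp mpg).
apply: (@continuous_prod_measurable _ _ W_separable _ (fun z : W * R => iota X + z.2 *: z.1)).
move=> z; apply: cvgD; first exact: cvg_cst.
by apply: cvgZ; [exact: cvg_snd|exact: cvg_fst].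
Qed.

Let mAn n : measurable_fun setT (An n).
Proof.
apply: measurable_funM; first exact: mrho.
apply: (@measurableT_comp _ _ _ _ (borel V) _ g).
  exact: continuous_borel_measurableR.
apply: (@continuous_prod_measurable _ _ W_separable _
  (fun z : W * R => X + z.2 *: frame_proj w y n z.1)).
move=> z; apply: cvgD; first exact: cvg_cst.
apply: cvgZ; first exact: cvg_snd.
apply: (@continuous_comp _ _ _ fst (frame_proj w y n)); first exact: cvg_fst.
exact: (frame_proj_continuous yw).
Qed.

(** At s = 0 the law of [iota X + s *: Y] is a point mass, about which the hypotheses on [pg] say
    nothing; a single time is negligible. *)
Let ae_pos : {ae L, forall s : measurableTypeR R, I01 s -> 0 < s <= 1}.
Proof.
exists [set 0]; split => //; first exact: lebesgue_measure_set1.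
move=> s /= /not_implyP[]; rewrite /I01 /= in_itv /= => /andP[s0 s1] /negP.
by rewrite s1 andbT -leNgt => s0'; apply/eqP; rewrite eq_le s0 s0'.
Qed.

Let AC : {ae L, forall s, I01 s -> {ae mu h, forall Y, `|A (Y, s)| <= C}}.
Proof.
apply: filterS ae_pos => s s01 /s01 {}s01.
apply: filterS (ae_translate_bounded s01) => Y YC; rewrite /A /= normrM.
apply: le_trans YC; rewrite ler_piMl// rho1//.
by case/andP: s01 => /ltW -> ->.
Qed.

Let AnC n Y s : I01 s -> `|An n (Y, s)| <= C.
Proof.
rewrite /I01 /= in_itv /= => s01; rewrite /An /= normrM.
apply: (le_trans _ (gC (X + s *: frame_proj w y n Y))).
by rewrite ler_piMl// rho1.
Qed.

Let Acvg : {ae L, forall s, I01 s ->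
  (\int[mu h]_Y (`|An n (Y, s) - A (Y, s)|)%:E)%E @[n --> \oo] --> 0%E}.
Proof.
apply: filterS ae_pos => s s01 /s01 {}s01.
have := cvg_translate s01.
have rs : `|rho s| <= 1 by apply: rho1; case/andP: s01 => /ltW -> ->.
have mAs : measurable_fun setT (fun Y : borel W => A (Y, s)).
  exact: measurableT_comp mA (measurable_pair2 s).
have mAns n : measurable_fun setT (fun Y : borel W => An n (Y, s)).
  exact: measurableT_comp (mAn n) (measurable_pair2 s).
have mg0 n : measurable_fun setT (fun Y : borel W => g (X + s *: frame_proj w y n Y)).
  apply: continuous_borel_measurableR => z.
  apply: (@continuous_comp _ _ _ (fun Y : W => X + s *: frame_proj w y n Y) g).
    by apply: cvgD; [exact: cvg_cst|apply: cvgZr; exact: (frame_proj_continuous yw)].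
  exact: cg.
have mpgs : measurable_fun setT (fun Y : borel W => pg (iota X + s *: Y)).
  exact: (measurableT_comp mpg (mphi s)).
apply: squeeze_cvge (cvg_cst _); apply: nearW => n; rewrite integral_ge0//=.
apply: ge0_le_integral => //.
- by apply/measurable_EFinP; apply: measurableT_comp => //; exact: measurable_funB.
- by apply/measurable_EFinP; apply: measurableT_comp => //; exact: measurable_funB.
- by move=> Y _; rewrite /An /A /= lee_fin -mulrBr normrM ler_piMl.
Qed.

Lemma time_average_integrable : {ae mu h, forall Y : borel W,
  lebesgue_measure.-integrable `[0, 1]
    (fun s : R => (rho s * pg (iota X + s *: Y))%:E)}.
Proof. exact: (ae_section_integrable mI01 LI01 mA AC). Qed.

Lemma time_average_measurable : measurable_fun setT (fun Y : borel W =>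
  \int[lebesgue_measure]_(s in `[0%R, 1%R]) (rho s * pg (iota X + s *: Y)))%R.
Proof. exact: (measurable_section_Rintegral L mI01 mA). Qed.

Lemma time_average_bounded : {ae mu h, forall Y : borel W,
  `|\int[lebesgue_measure]_(s in `[0%R, 1%R]) (rho s * pg (iota X + s *: Y))|%R <= C}.
Proof.
have C0 : 0 <= C by apply: le_trans (gC 0).
by rewrite -[C]ger0_norm//; exact: (ae_section_Rintegral_le mI01 LI01 mA AC).
Qed.

Lemma time_average_approx_measurable n : measurable_fun setT (fun Y : borel W =>
  \int[lebesgue_measure]_(s in `[0%R, 1%R])
    (rho s * g (X + s *: frame_proj w y n Y)))%R.
Proof. exact: (measurable_section_Rintegral L mI01 (mAn n)). Qed.

Lemma time_average_approx_bounded n : {ae mu h, forall Y : borel W,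
  `|\int[lebesgue_measure]_(s in `[0%R, 1%R])
     (rho s * g (X + s *: frame_proj w y n Y))|%R <= C}.
Proof.
have C0 : 0 <= C by apply: le_trans (gC 0).
rewrite -[C]ger0_norm//; apply: (ae_section_Rintegral_le mI01 LI01 (mAn n)).
by apply: nearW => s Is; apply: nearW => Y; exact: AnC.
Qed.

Lemma cvg_time_average : (\int[mu h]_Y
  (`|\int[lebesgue_measure]_(s in `[0%R, 1%R]) (rho s * g (X + s *: frame_proj w y n Y)) -
     \int[lebesgue_measure]_(s in `[0%R, 1%R]) (rho s * pg (iota X + s *: Y))|%R)%:E)%E
  @[n --> \oo] --> 0%E.
Proof. exact: (cvg_section_Rintegral mI01 LI01 mA AC mAn AnC Acvg). Qed.

End frame_limits.

(** * Limits in L^1 of sums over words *)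

Section L1_convergence.
Context {d : measure_display} {T : measurableType d} {R : realType}.
Variable mu : probability T R.
Implicit Types (fs gs : nat -> T -> R) (f g : T -> R).

Definition L1_cvg fs f := [/\ forall n, measurable_fun setT (fs n),
  measurable_fun setT f &
  (\int[mu]_x (`|fs n x - f x|)%:E)%E @[n --> \oo] --> 0%E].

Let mdist f g : measurable_fun setT f -> measurable_fun setT g ->
  measurable_fun setT (fun x => (`|f x - g x|)%:E).
Proof.
by move=> mf mg; apply/measurable_EFinP; apply: measurableT_comp => //; exact: measurable_funB.
Qed.

Lemma L1_cvg_cst (c : R) : L1_cvg (fun=> cst c) (cst c).
Proof.
split => //.
under eq_fun => n do under eq_integral => x _ do rewrite subrr normr0.
under eq_fun => n do rewrite integral0.
exact: cvg_cst.
Qed.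

Lemma L1_cvgD fs f gs g : L1_cvg fs f -> L1_cvg gs g ->
  L1_cvg (fun n x => fs n x + gs n x) (fun x => f x + g x).
Proof.
move=> [mf_ mf cf] [mg_ mg cg]; split => [n||]; try exact: measurable_funD.
apply: (@squeeze_cvge _ _ _ _ (cst 0%E) _ (fun n => \int[mu]_x (`|fs n x - f x|)%:E +
   \int[mu]_x (`|gs n x - g x|)%:E)%E).
- apply: nearW => n; rewrite integral_ge0//= -ge0_integralD//; [|exact: mdist|exact: mdist].
  apply: ge0_le_integral => //.
  + by apply: mdist; exact: measurable_funD.
  + by apply: emeasurable_funD; exact: mdist.
  + move=> x _; rewrite -EFinD lee_fin; apply: le_trans (ler_normD _ _).
    by rewrite opprD addrACA.
- exact: cvg_cst.
by rewrite -[X in _ --> X]adde0; apply: cvgeD.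
Qed.

Lemma L1_cvgZ (c : R) fs f : L1_cvg fs f ->
  L1_cvg (fun n x => c * fs n x) (fun x => c * f x).
Proof.
move=> [mf_ mf cf]; split => [n||]; try exact: measurable_funM.
rewrite (_ : (fun n => _) = fun n => (`|c|%:E * \int[mu]_x (`|fs n x - f x|)%:E)%E).
  by rewrite -[X in _ --> X](mule0 `|c|%:E); apply: cvgeZl.
apply/funext => n; rewrite -ge0_integralZl//; last exact: mdist.
by apply: eq_integral => x _; rewrite -EFinM -normrM mulrBr.
Qed.

Lemma L1_cvg_sum (I : eqType) (s : seq I) (fs : I -> nat -> T -> R) (f : I -> T -> R) :
  (forall i, i \in s -> L1_cvg (fs i) (f i)) ->
  L1_cvg (fun n x => \sum_(i <- s) fs i n x) (fun x => \sum_(i <- s) f i x).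
Proof.
elim: s => [|i s ih] hs.
  rewrite (_ : (fun n x => _) = (fun=> cst 0)); last first.
    by apply/funext => n; apply/funext => x; rewrite big_nil.
  rewrite (_ : (fun x => _) = cst 0); first exact: L1_cvg_cst.
  by apply/funext => x; rewrite big_nil.
rewrite (_ : (fun n x => _) = (fun n x => fs i n x + \sum_(i <- s) fs i n x)); last first.
  by apply/funext => n; apply/funext => x; rewrite big_cons.
rewrite (_ : (fun x => _) = (fun x => f i x + \sum_(i <- s) f i x)).
  apply: L1_cvgD; first by apply: hs; rewrite mem_head.
  by apply: ih => j js; apply: hs; rewrite inE js orbT.
by apply/funext => x; rewrite big_cons.
Qed.

Lemma L1_cvg_trans fs gs f : (forall n, measurable_fun setT (gs n)) ->
  (\int[mu]_x (`|gs n x - fs n x|)%:E)%E @[n --> \oo] --> 0%E ->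
  L1_cvg fs f -> L1_cvg gs f.
Proof.
move=> mg_ gf [mf_ mf cf].
have gf0 : L1_cvg (fun n x => gs n x - fs n x) (cst 0).
  split => // [n|]; first exact: measurable_funB.
  by under eq_fun => n do under eq_integral => x _ do rewrite subr0.
have := L1_cvgD gf0 (And3 mf_ mf cf).
have -> : (fun n x => gs n x - fs n x + fs n x) = gs.
  by apply/funext => n; apply/funext => x; rewrite subrK.
by have -> : (fun x => cst 0 x + f x) = f by apply/funext => x; rewrite add0r.
Qed.

Lemma L1_cvg_unique fs f g : L1_cvg fs f -> L1_cvg fs g ->
  {ae mu, forall x, f x = g x}.
Proof.
move=> [mf_ mf cf] [_ mg cg].
have h : (\int[mu]_x (`|f x - g x|)%:E = 0)%E.
  apply/eqP; rewrite eq_le integral_ge0// andbT.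
  have c0 : ((\int[mu]_x (`|fs n x - f x|)%:E + \int[mu]_x (`|fs n x - g x|)%:E)%E
      @[n --> \oo] --> 0%E) by rewrite -[X in _ --> X]adde0; apply: cvgeD.
  rewrite -(cvg_lim _ c0)//; apply: lime_ge; first exact: cvgP c0.
  apply: nearW => n; rewrite -ge0_integralD//; [|exact: mdist|exact: mdist].
  apply: ge0_le_integral => //.
  - exact: mdist.
  - by apply: emeasurable_funD; exact: mdist.
  - move=> x _; rewrite -EFinD lee_fin (distrC (fs n x) (f x)).
    exact: ler_distD.
have : ae_eq mu setT (fun x => (f x - g x)%:E) (cst 0%E).
  apply/ae_eq_integral_abs => //.
  by apply/measurable_EFinP; exact: measurable_funB.
by apply: filterS => x /(_ Logic.I) /= [] /eqP; rewrite subr_eq0 => /eqP.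
Qed.

(** In the remainder an unbounded product of linear functionals multiplies a difference of time
    averages that is bounded and tends to 0 in L^1. A bound on the second moment of the unbounded
    factor is enough to conclude. *)
Lemma cvg_product_L1 (a : T -> R) (b : nat -> T -> R) (B C : R) :
  measurable_fun setT a -> (forall n, measurable_fun setT (b n)) ->
  (\int[mu]_x (a x ^+ 2)%:E <= C%:E)%E ->
  (forall n, {ae mu, forall x, `|b n x| <= B}) ->
  (\int[mu]_x (`|b n x|)%:E)%E @[n --> \oo] --> 0%E ->
  (\int[mu]_x (`|a x * b n x|)%:E)%E @[n --> \oo] --> 0%E.
Proof.
move=> ma mb aC bB cb.
pose B' := `|B| + 1; have B'0 : 0 < B' by rewrite ltr_wpDl.
pose C' := `|C| + 1; have C'0 : 0 < C' by rewrite ltr_wpDl.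
(* [|a b| <= k |b| + B' a^2 / k], by comparing [|a|] with [k]. *)
have bound k n : 0 < k -> (\int[mu]_x (`|a x * b n x|)%:E <=
    k%:E * \int[mu]_x (`|b n x|)%:E + (B' * C' / k)%:E)%E.
  move=> k0.
  have mb1 : measurable_fun setT (fun x => (`|b n x|)%:E).
    by apply/measurable_EFinP; exact: measurableT_comp.
  have ma2 : measurable_fun setT (fun x => (a x ^+ 2)%:E).
    by apply/measurable_EFinP; exact: measurable_funX.
  apply: (@le_trans _ _ (\int[mu]_x (k%:E * (`|b n x|)%:E + (B' / k)%:E * (a x ^+ 2)%:E))%E).
    apply: ae_ge0_le_integral => //.
    - by apply/measurable_EFinP; apply: measurableT_comp => //; exact: measurable_funM.
    - by move=> x _; rewrite -!EFinM -EFinD lee_fin addr_ge0// mulr_ge0 ?divr_ge0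
      ?sqr_ge0// ltW.
    - by apply: emeasurable_funD; apply: emeasurable_funM.
    apply: filterS (bB n) => x bx _; rewrite -!EFinM -EFinD lee_fin normrM.
    have {}bx : `|b n x| <= B' by have := ler_norm B; rewrite /B'; lra.
    have [ak|ak] := leP `|a x| k.
      rewrite ler_wpDr ?ler_wpM2r// mulr_ge0 ?divr_ge0 ?sqr_ge0// ltW//.
    rewrite ler_wpDl ?mulr_ge0 ?(ltW k0)//.
    rewrite mulrAC ler_pdivlMr// -[X in B' * X]real_normK ?num_real//.
    rewrite expr2 mulrA mulrAC (mulrC _ (`|b n x|)).
    by rewrite -mulrA ler_pM// ?mulr_ge0 ?(ltW k0)// ler_wpM2l// ltW.
  rewrite ge0_integralD//; last 4 first.
  - by move=> x _; rewrite -EFinM lee_fin mulr_ge0// ltW.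
  - exact: emeasurable_funM.
  - by move=> x _; rewrite -EFinM lee_fin mulr_ge0 ?divr_ge0 ?sqr_ge0// ltW.
  - exact: emeasurable_funM.
  rewrite !ge0_integralZl//; last 3 first.
  - by rewrite lee_fin ltW.
  - by move=> x _; rewrite lee_fin sqr_ge0.
  - by rewrite lee_fin divr_ge0// ltW.
  rewrite leeD2l// mulrAC (EFinM (B' / k)); apply: lee_wpmul2l.
    by rewrite lee_fin divr_ge0// ltW.
  apply: le_trans aC _; rewrite lee_fin /C'; have := ler_norm C; lra.
apply: cvge0P => [n|e e0]; first exact: integral_ge0.
have e2 : 0 < e / 2 by rewrite divr_gt0.
(* Makes the second term of [bound] equal to e / 2, whatever n. *)
pose k := B' * C' / (e / 2).
have k0 : 0 < k by rewrite divr_gt0// mulr_gt0.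
have := cvge0_lt cb (divr_gt0 e2 k0); apply: filterS => n hn.
apply: le_trans (bound k n k0) _.
apply: (@le_trans _ _ ((e / 2)%:E + (e / 2)%:E)%E); last by rewrite -EFinD lee_fin; lra.
apply: leeD.
  apply: le_trans (lee_wpmul2l _ (ltW hn)) _; first by rewrite lee_fin ltW.
  by rewrite -EFinM lee_fin mulrC divfK// gt_eqF.
rewrite lee_fin /k invf_div mulrC divfK// gt_eqF// mulr_gt0//.
Qed.

End L1_convergence.

Section word_sums.
Context {R : realType} {T : countType}.
Variables (eps : T -> R) (E : R).
Hypothesis eps0 : forall d, 0 <= eps d.
Hypothesis epsE : forall n, \sum_(d <- initial n) eps d <= E.

Let e n := \sum_(d <- initial n) eps d.

Let e0 n : 0 <= e n.
Proof. by apply: sumr_ge0. Qed.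

Lemma words_initial_subset k N n (u : k.-tuple T) : (N <= n)%N ->
  u \in tuple_words (initial N) k -> u \in tuple_words (initial n) k.
Proof.
move=> Nn; rewrite !mem_tuple_words; apply: sub_all => d /=.
by rewrite !mem_initial => /leq_trans; exact.
Qed.

Lemma big_words_split k (f : k.-tuple T -> R) N n : (N <= n)%N ->
  \sum_(u <- tuple_words (initial n) k) f u =
  \sum_(u <- tuple_words (initial N) k) f u +
  \sum_(u <- tuple_words (initial n) k | u \notin tuple_words (initial N) k) f u.
Proof.
move=> Nn; rewrite (bigID (mem (tuple_words (initial N) k))) /=; congr (_ + _).
rewrite -big_filter; apply: perm_big; apply: uniq_perm.
- by apply: filter_uniq; apply: uniq_tuple_words; exact: uniq_initial.
- by apply: uniq_tuple_words; exact: uniq_initial.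
by move=> u; rewrite mem_filter andb_idr//; exact: words_initial_subset.
Qed.

(** Both the terms and the set of words depend on n. The words not over [initial N] weigh at most a
    constant times [ek n - ek N], small uniformly in n because [ek] converges; the words over
    [initial N] are finitely many. *)
Lemma tannery_words k (tau : nat -> k.-tuple T -> R) (B : R) :
  (forall n u, 0 <= tau n u <= B * \prod_(d <- u) eps d) ->
  (forall u, tau n u @[n --> \oo] --> (0 : R)) ->
  \sum_(u <- tuple_words (initial n) k) tau n u @[n --> \oo] --> (0 : R).
Proof.
move=> tB t0; pose ek n := e n ^+ k.
have ekS : nondecreasing_seq ek.
  move=> N n Nn; apply: lerXn2r; rewrite ?nnegrE//.
  have /nondecreasing_seqP h : forall n, e n <= e n.+1.
    by move=> m; rewrite /e initialS big_cat /= lerDl sumr_ge0.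
  exact: h.
have cek : cvgn ek.
  apply: nondecreasing_is_cvgn => //; exists (E ^+ k) => _ [n _ <-].
  by apply: lerXn2r; rewrite ?nnegrE//; [exact: le_trans (e0 0) (epsE 0)|exact: epsE].
pose B' := `|B| + 1; have B'0 : 0 < B' by rewrite ltr_wpDl.
apply/cvgrPdist_lt => r r0.
have r2 : 0 < r / 2 by rewrite divr_gt0.
have /cvgrPdist_lt/(_ _ (divr_gt0 r2 B'0))[N _ hN] := cek.
have cN : \sum_(u <- tuple_words (initial N) k) tau n u @[n --> \oo] --> (0 : R).
  elim: (tuple_words _ _) => [|u us ih].
    by under eq_fun do rewrite big_nil; exact: cvg_cst.
  have h := cvgD (t0 u) ih; rewrite addr0 in h.
  rewrite (_ : (fun n => _) = (fun n => tau n u + \sum_(v <- us) tau n v)); first exact: h.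
  by apply/funext => n; rewrite big_cons.
have /cvgrPdist_lt/(_ _ r2)[N' _ hN'] := cN.
exists (maxn N N') => // n /=; rewrite geq_max => /andP[Nn N'n].
have t00 u : 0 <= tau n u by have /andP[] := tB n u.
rewrite sub0r normrN ger0_norm ?sumr_ge0//.
rewrite (big_words_split (tau n) Nn).
have h1 : \sum_(u <- tuple_words (initial N) k) tau n u < r / 2.
  by have := hN' n N'n; rewrite /= sub0r normrN ger0_norm// sumr_ge0.
have h2 : \sum_(u <- tuple_words (initial n) k | u \notin tuple_words (initial N) k) tau n u
    <= B' * (ek n - ek N).
  rewrite /ek /e -!prod_tuple_words.
  rewrite (big_words_split (fun u => \prod_(d <- u) eps d) Nn) [X in _ * X]addrAC subrr add0r.
  rewrite big_distrr /=; apply: ler_sum => u _; have /andP[_ /le_trans] := tB n u; apply.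
  rewrite ler_wpM2r ?prodr_ge0//; have := ler_norm B; rewrite /B'; lra.
have h3 : B' * (ek n - ek N) < r / 2.
  rewrite mulrC -ltr_pdivlMr//; have := hN N (leqnn N); rewrite /= ger0_norm.
    have := nondecreasing_cvgn_le ekS cek n; lra.
  by rewrite subr_ge0; exact: nondecreasing_cvgn_le.
by lra.
Qed.

End word_sums.

Section dual_products.
Context {R : realType} {V W : normedModType R} (ip : {dot V for idfun}).
Variable iota : V -> W.
Hypothesis iota_dense : dense (range iota).
Variables (h : R) (mu : probability (borel W) R).
Hypotheses (h0 : 0 < h) (gmu : gaussian_measure ip iota h mu).
Context {T : countType}.
Variables (w : T -> V) (y : T -> W -> R).
Hypothesis ow : forall d d', ip (w d) (w d') = (d == d')%:R.
Hypothesis yw : forall d, dual_vector ip iota (y d) (w d).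

Lemma measurable_dual_product (u : seq T) :
  measurable_fun setT (fun z : borel W => \prod_(d <- u) y d z).
Proof.
elim: u => [|d u ih].
  by rewrite (_ : (fun z => _) = cst 1)//; apply/funext => z; rewrite big_nil.
rewrite (_ : (fun z => _) = (fun z => y d z * \prod_(d <- u) y d z)).
  by apply: measurable_funM => //; exact: (dual_vector_measurable (yw d)).
by apply/funext => z; rewrite big_cons.
Qed.

(** With B the right-hand side, each factor is at most B^(1/(2N)). The q-th power of the product is
    then at most B^(size u * q / (2N)), hence at most B, as B >= 1. Repeated letters are thus
    treated like distinct ones, without any independence. *)
Lemma prod_powR_le (u : seq T) (z : W) (q : R) N : 0 < q -> (0 < N)%N ->
  (size u)%:R * q <= N.*2%:R ->
  `|\prod_(d <- u) y d z| `^ q <= 1 + \sum_(d <- u) y d z ^+ N.*2.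
Proof.
move=> q0 N0 uqN.
have prod_le (v : seq T) (b : R) : 0 <= b -> (forall d, d \in v -> `|y d z| <= b) ->
    `|\prod_(d <- v) y d z| <= b ^+ size v.
  move=> b0; elim: v => [|d v ih] le1; first by rewrite big_nil normr1.
  rewrite big_cons normrM exprS ler_pM//; first by apply: le1; rewrite mem_head.
  by apply: ih => // d' dv; apply: le1; rewrite inE dv orbT.
set B := 1 + _.
have even t : 0 <= t ^+ N.*2 :> R by rewrite -mul2n exprM exprn_ge0// sqr_ge0.
have B1 : 1 <= B by rewrite lerDl sumr_ge0.
have B0 : 0 < B by exact: lt_le_trans B1.
have N2 : 0 < N.*2%:R :> R by rewrite ltr0n double_gt0.
have le1 d : d \in u -> `|y d z| <= B `^ (N.*2%:R^-1).
  move=> du; rewrite -(@ler_pXn2r _ N.*2) ?double_gt0 ?nnegrE ?powR_ge0//.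
  rewrite -[leRHS]powR_mulrn ?powR_ge0// -powRrM mulVf ?gt_eqF// powRr1 ?(ltW B0)//.
  rewrite -normrX ger0_norm// /B (big_rem d)//= addrCA lerDl addr_ge0// sumr_ge0//.
have b1 : 1 <= B `^ (N.*2%:R^-1).
  have h1 : 1 `^ (N.*2%:R^-1) = 1 :> R by rewrite powR1.
  rewrite -[leLHS]h1; apply: ge0_ler_powR; rewrite ?nnegrE ?invr_ge0//; lra.
move: le1; set b := B `^ _ in b1 * => le1.
have b0 : 0 <= b by lra.
have le2 := prod_le u b b0 le1.
apply: (@le_trans _ _ (b `^ N.*2%:R)); last first.
  by rewrite -powRrM mulVf ?gt_eqF// powRr1// ltW.
apply: (@le_trans _ _ (b `^ ((size u)%:R * q))); last exact: ler_powR.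
rewrite powRrM powR_mulrn//; apply: ge0_ler_powR; rewrite ?nnegrE ?exprn_ge0//.
exact: ltW.
Qed.

(** The bound is uniform in the word: all the [y d] have the same moments, their vectors being of
    length one. The condition [1 <= c] later gives c <= c^q, so that the same constant bounds the
    norm. *)
Lemma dual_product_moment (q : R) k : 0 < q -> exists2 c : R, 1 <= c &
  forall u : k.-tuple T,
  (\int[mu]_z (`|\prod_(d <- u) y d z| `^ q)%:E <= c%:E)%E.
Proof.
(* An even exponent 2 N >= k q, as [prod_powR_le] demands. *)
move=> q0; pose N := (Num.truncn (k%:R * q)).+1.
have kN : k%:R * q <= N.*2%:R.
  apply: (@le_trans _ _ N%:R); first by rewrite ltW// truncnS_gt.
  by rewrite ler_nat -addnn leq_addr.
have mfin := gauss_moment_fin_num N h0.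
have even t : 0 <= t ^+ N.*2 :> R by rewrite -mul2n exprM exprn_ge0// sqr_ge0.
have m0 : (0 <= gauss_moment h N)%E by apply: integral_ge0 => t _; rewrite lee_fin.
exists (1 + k%:R * fine (gauss_moment h N)).
  by rewrite lerDl mulr_ge0// fine_ge0.
move=> u.
have my d : measurable_fun setT (fun z : borel W => (y d z ^+ N.*2)%:E).
  apply/measurable_EFinP; apply: measurable_funX.
  exact: (dual_vector_measurable (yw d)).
apply: (@le_trans _ _ (\int[mu]_z (1 + \sum_(d <- u) (y d z ^+ N.*2)%:E))%E).
  apply: ge0_le_integral => //.
  - apply/measurable_EFinP; apply: measurable_normr_powR.
    exact: measurable_dual_product.
  - by apply: emeasurable_funD => //; apply: emeasurable_sum.
  - move=> z _; rewrite sumEFin -EFinD lee_fin; apply: prod_powR_le => //.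
    by rewrite size_tuple.
rewrite ge0_integralD//; last 2 first.
- by move=> z _; apply: sume_ge0 => d _; rewrite lee_fin.
- exact: emeasurable_sum.
rewrite integral_cst// [X in (_ * X + _)%E]probability_setT mule1 EFinD leeD2l//.
rewrite ge0_integral_sum//; last by move=> d z _; rewrite lee_fin.
under eq_bigr => d _ do
  rewrite (dual_moment iota_dense h0 gmu (yw d))// ow eqxx expr1n mul1e -(fineK mfin).
rewrite sumEFin lee_fin big_const_seq count_predT size_tuple.
by rewrite iter_addr_0 mulr_natl.
Qed.

End dual_products.

(** * The symbol classes and the product Wiener space *)

Section symbol_words.
Context {R : realType} {H : normedModType R} {Gamma : countType}.
Variable e : Gamma -> H.
Implicit Types (s t : seq (Gamma * bool)) (F : H * H -> R[i]).

(** Links the weights of multi-indices, in which symbol classes are stated, to products over the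
    letters of a word, in which the sums are estimated. *)
Lemma fsbig_word_weight (eps : Gamma -> R) s :
  \big[*%R/1]_(j \in [set: Gamma])
    eps j ^+ (count_mem (j, false) s + count_mem (j, true) s) =
  \prod_(d <- s) eps d.1.
Proof.
have cE j : (count_mem (j, false) s + count_mem (j, true) s)%N = count_mem j (map fst s).
  elim: s => // -[j' b] s ih /=; rewrite !xpair_eqE /= addnACA -ih.
  by case: b; case: eqVneq.
transitivity (\prod_(j <- undup (map fst s)) eps j ^+ count_mem j (map fst s)).
  rewrite (fsbigE (undup (map fst s))) ?undup_uniq//; last first.
    by move=> j _; rewrite mem_undup cE => js; rewrite (count_memPn js).
  apply: eq_big => [j|j _]; [exact: mem_setT|by rewrite cE].
rewrite -(big_map fst xpredT eps) -[RHS]big_undup_iterop_count.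
by apply: eq_bigr => j _.
Qed.

Lemma iter_deriv_cat (V : normedModType R) (s t : seq V) (F : V -> R[i]) :
  iter_deriv (s ++ t) F = iter_deriv s (iter_deriv t F).
Proof. by rewrite /iter_deriv foldr_cat. Qed.

Lemma iter_derivable_cat (V : normedModType R) (s t : seq V) (F : V -> R[i]) :
  iter_derivable (s ++ t) F -> iter_derivable s (iter_deriv t F).
Proof.
elim: s => [|v s ih]; first by [].
move=> [hs hv]; split; first exact: ih.
by move: hv; rewrite -/(cat s t) iter_deriv_cat.
Qed.

Lemma symbol_word_bound m M eps F s : symbol_bound e m M eps F ->
  (forall d, count_mem d s <= m)%N ->
  [/\ iter_derivable (map (wdir e) s) F,
      ccontinuous (iter_deriv (map (wdir e) s) F) &
      forall x, Normc.normc (iter_deriv (map (wdir e) s) F x) <=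
        M * \prod_(d <- s) eps d.1].
Proof.
move=> [_ _ hF] sm; rewrite -fsbig_word_weight.
by apply: hF => j; split.
Qed.

Lemma symbol_word_derivable m M eps F d s : symbol_bound e m M eps F ->
  (forall d', count_mem d' (d :: s) <= m)%N ->
  forall x, cderivable (iter_deriv (map (wdir e) s) F) x (wdir e d).
Proof. by move=> hF /(symbol_word_bound hF)[[_]]. Qed.

(** A letter occurs at most once in a word [t] of order 1 and at most [size s] times in [s], so
    [t ++ s] stays within the order m exactly because [size s < m]. The weight of [s] goes into the
    constant. *)
Lemma iter_deriv_symbol_class m eps F s : (forall j, 0 <= eps j) ->
  (size s < m)%N -> symbol_class e m eps F ->
  symbol_class e 1 eps (iter_deriv (map (wdir e) s) F).
Proof.
move=> eps0 sm [M M0 hF].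
have hs d : (count_mem d s <= m)%N by exact: leq_trans (count_size _ _) (ltnW sm).
exists (M * \prod_(d <- s) eps d.1); first by rewrite mulr_ge0// prodr_ge0.
have [dF cF bF] := symbol_word_bound hF hs; split => //;
  first by exists (M * \prod_(d <- s) eps d.1).
move=> alpha beta t ab tab.
have ht d : (count_mem d (t ++ s) <= m)%N.
  rewrite count_cat; apply: leq_trans sm; rewrite -add1n leq_add ?count_size//.
  by case: d => j b; have [a1 b1] := ab j; have [ta tb] := tab j; case: b; rewrite ?ta ?tb.
have [] := symbol_word_bound hF ht.
rewrite map_cat iter_deriv_cat big_cat /= => dt ct bt; split => //.
  exact: iter_derivable_cat dt.
have E : \prod_(d <- t) eps d.1 =
    \big[*%R/1]_(j \in [set: Gamma]) eps j ^+ (alpha j + beta j).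
  rewrite -fsbig_word_weight; apply: eq_fsbigr => j _.
  by have [-> ->] := tab j.
by move=> x; rewrite -E -mulrA (mulrC (\prod_(d <- s) _)); exact: bt.
Qed.

End symbol_words.

Section product_wiener_space.
Context {R : realType} {H B : completeNormedModType R} {Gamma : countType}.
Variables (ip : {dot H for idfun}) (iota : {linear H -> B}) (e : Gamma -> H).
Hypothesis hW : wiener_space ip iota.
Hypothesis he : hilbert_basis ip e.

Let ipE x : `|x| = Num.sqrt (ip x x).
Proof. exact: hilbert_norm (wiener_hilbert hW) x. Qed.

Let sqn x : `|x| ^+ 2 = ip x x.
Proof. by rewrite ipE sqr_sqrtr// dot_ge0. Qed.

Lemma normr_prod_dot_le (v : H * H) : `|v| ^+ 2 <= prod_dot ip v v.
Proof.
rewrite /prod_dot -!sqn prod_normE; have [_|_] := leP `|v.1| `|v.2|.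
  by rewrite lerDr sqr_ge0.
by rewrite lerDl sqr_ge0.
Qed.

Lemma prod_dot_le_normr (v : H * H) : prod_dot ip v v <= 2 * `|v| ^+ 2.
Proof.
rewrite /prod_dot -!sqn prod_normE mulrDl mul1r.
by rewrite lerD// lerXn2r ?nnegrE// ?le_max ?lexx ?orbT.
Qed.

Lemma map_pair_dense : dense (range (map_pair iota)).
Proof.
move=> O [z Oz] oO.
have /nbhs_ballP[r /= r0 rO] : nbhs z O by exact: open_nbhs_nbhs.
have near (x : B) : exists a, ball x r (iota a).
  have [||t [xa [a _ tE]]] := wiener_dense hW (O := ball x r).
  - by exists x; exact: ballxx.
  - exact: ball_open.
  - by exists a; rewrite tE.
have [a1 h1] := near z.1; have [a2 h2] := near z.2.
by exists (iota a1, iota a2); split; [apply: rO; split|exists (a1, a2)].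
Qed.

Lemma prod_dense_sequence : exists w : nat -> B * B,
  forall x r, 0 < r -> exists n, `|x - w n| < r.
Proof.
have [A cA dA] := hilbert_separable (wiener_hilbert hW).
have [a ad] := dense_sequence cA dA.
have adB (x : B) r : 0 < r -> exists n, `|x - iota (a n)| < r.
  move=> r0; have r2 : 0 < r / 2 by rewrite divr_gt0.
  have [||t [xb [b _ tE]]] := wiener_dense hW (O := ball x (r / 2)).
  - by exists x; exact: ballxx.
  - exact: ball_open.
  have /cvgrPdist_lt/(_ _ r2)/nbhs_normP[dl /= dl0 hd] := wiener_continuous hW (x := b).
  have [n hn] := ad b _ dl0; exists n.
  apply: (le_lt_trans (ler_distD (iota b) _ _)).
  have := hd (a n) hn; move: xb; rewrite -tE -ball_normE /=; lra.
exists (fun n => if @choice.unpickle (nat * nat)%type n is Some ij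
  then (iota (a ij.1), iota (a ij.2)) else 0) => x r r0.
have [i hi] := adB x.1 r r0; have [j hj] := adB x.2 r r0.
exists (choice.pickle (i, j)); rewrite choice.pickleK prod_normE /=.
by rewrite gt_max hi hj.
Qed.

(** Riesz representation is applied to the restrictions to the two factors, since the norm of
    [H * H] is the maximum norm and not that of [prod_dot]. *)
Lemma prod_dual_representation (y : B * B -> R) : scalar y -> continuous y ->
  exists a, forall x, y (map_pair iota x) = prod_dot ip a x.
Proof.
move=> ys yc.
have c1 : continuous (fun x : H => y (iota x, 0)).
  move=> x; apply: (@continuous_comp _ _ _ (fun x : H => (iota x, 0 : B)) y); last exact: yc.
  by apply: cvg_pair; [exact: (wiener_continuous hW)|exact: cvg_cst].
have c2 : continuous (fun x : H => y (0, iota x)).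
  move=> x; apply: (@continuous_comp _ _ _ (fun x : H => (0 : B, iota x)) y); last exact: yc.
  by apply: cvg_pair; [exact: cvg_cst|exact: (wiener_continuous hW)].
have [|a1 h1] := riesz_representation ipE _ c1.
  move=> c u v; rewrite -ys; congr y; rewrite linearP.
  by congr pair; rewrite /= scaler0 addr0.
have [|a2 h2] := riesz_representation ipE _ c2.
  move=> c u v; rewrite -ys; congr y; rewrite linearP.
  by congr pair; rewrite /= scaler0 addr0.
exists (a1, a2) => x; rewrite /prod_dot /= -h1 -h2 -(scalarD ys).
by congr y; congr pair; rewrite /= ?addr0 ?add0r.
Qed.

Lemma prod_dot_wdir d d' : prod_dot ip (wdir e d) (wdir e d') = (d == d')%:R.
Proof.
have [eo _] := he; case: d => j b; case: d' => j' b'; rewrite /wdir /prod_dot xpair_eqE.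
by case: b; case: b' => /=; rewrite ?dot0l ?dot0r ?eo ?addr0 ?add0r ?andbT ?andbF.
Qed.

Lemma dense_wdir :
  dense [set v | exists s : seq (Gamma * bool), lspan (map (wdir e) s) v].
Proof.
have [_ ed] := he; move=> O [z Oz] oO.
have /nbhs_ballP[r /= r0 rO] : nbhs z O by exact: open_nbhs_nbhs.
have near (x : H) : exists v, ball x r v /\ exists s : seq Gamma, lspan (map e s) v.
  have [||v [xv sv]] := ed (ball x r).
  - by exists x; exact: ballxx.
  - exact: ball_open.
  - by exists v.
have [v1 [h1 [s1 [c1 v1E]]]] := near z.1; have [v2 [h2 [s2 [c2 v2E]]]] := near z.2.
exists (v1, v2); split; first by apply: rO; split.
exists ([seq (j, false) | j <- s1] ++ [seq (j, true) | j <- s2]).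
set S := map _ _.
have hS d : d \in [seq (j, false) | j <- s1] ++ [seq (j, true) | j <- s2] ->
    lspan S (wdir e d) by move=> dS; apply: lspan_mem; exact: map_f.
have l1 : lspan S (v1, 0).
  rewrite v1E; elim/big_rec: _ => [|i v _ vS]; first exact: lspan0.
  have -> : (c1 i *: (map e s1)`_i + v, 0 : H) = c1 i *: ((map e s1)`_i, 0 : H) + (v, 0 : H).
    by congr pair; rewrite /= scaler0 addr0.
  apply: lspanZD => //.
  have /mapP[j js1 ->] : (map e s1)`_i \in map e s1 by apply: mem_nth; exact: ltn_ord.
  apply: (hS (j, false)); rewrite mem_cat map_f//.
have l2 : lspan S (0, v2).
  rewrite v2E; elim/big_rec: _ => [|i v _ vS]; first exact: lspan0.
  have -> : (0 : H, c2 i *: (map e s2)`_i + v) = c2 i *: (0 : H, (map e s2)`_i) + (0 : H, v).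
    by congr pair; rewrite /= scaler0 addr0.
  apply: lspanZD => //.
  have /mapP[j js2 ->] : (map e s2)`_i \in map e s2 by apply: mem_nth; exact: ltn_ord.
  by apply: (hS (j, true)); rewrite mem_cat orbC map_f.
have := lspanZD 1 l1 l2; rewrite scale1r.
by congr (lspan _ _); congr pair; rewrite /= ?addr0 ?add0r.
Qed.

Lemma dual_vector_wdir (z : Gamma -> B -> R) :
  (forall j, dual_vector ip iota (z j) (e j)) ->
  forall d, dual_vector (prod_dot ip) (map_pair iota)
    (fun Y => if d.2 then z d.1 Y.2 else z d.1 Y.1) (wdir e d).
Proof.
move=> ze [j b]; have [zs zc za] := ze j; split => /=.
- by move=> c u v; case: b => /=; exact: zs.
- move=> Y; case: b.
    by apply: (@continuous_comp _ _ _ snd (z j)); [exact: cvg_snd|exact: zc].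
  by apply: (@continuous_comp _ _ _ fst (z j)); [exact: cvg_fst|exact: zc].
- move=> x; rewrite /prod_dot /wdir /=.
  by case: b => /=; rewrite za dot0l ?addr0 ?add0r.
Qed.

End product_wiener_space.

Section split_words.
Context {G : countType}.

Definition split_word i (u : i.-tuple (G * bool)) : i.-tuple G * i.-tuple bool :=
  (map_tuple fst u, map_tuple snd u).

Definition join_word i (l : i.-tuple G * i.-tuple bool) : i.-tuple (G * bool) :=
  zip_tuple l.1 l.2.

Lemma join_wordK i : cancel (@join_word i) (@split_word i).
Proof.
move=> [l1 l2]; congr pair; apply/val_inj => /=.
  by rewrite -/unzip1 unzip1_zip// !size_tuple.
by rewrite -/unzip2 unzip2_zip// !size_tuple.
Qed.

Lemma split_wordK i : cancel (@split_word i) (@join_word i).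
Proof. by move=> u; apply/val_inj => /=; exact: zip_unzip. Qed.

End split_words.

Section summable_weights.
Context {R : realType} {G : countType}.
Variable eps : G -> R.
Hypothesis eps0 : forall j, 0 <= eps j.
Hypothesis eps_sum : summable [set: G] (fun j => (eps j)%:E).

(** Each j gives two letters, one for each value of the boolean, whence twice the sum of [eps]. *)
Lemma summable_initial_bound : exists E : R,
  forall n, \sum_(d <- @initial (G * bool)%type n) eps d.1 <= E.
Proof.
pose E0 := (\esum_(j in [set: G]) `|(eps j)%:E|)%E.
have E0fin : E0 \is a fin_num by rewrite ge0_fin_numE// esum_ge0.
have h (s : seq G) : uniq s -> \sum_(j <- s) eps j <= fine E0.
  move=> us; rewrite -lee_fin fineK//; apply: esum_ge.
  exists [set` s]; first by split => //; exact: finite_seq.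
  rewrite -fsbig_seq// -sumEFin; apply: lee_sum => j _.
  by rewrite abse_EFin ger0_norm.
exists (fine E0 + fine E0) => n.
rewrite (bigID snd) /= lerD//.
  rewrite -big_filter -(big_map fst xpredT eps); apply: h.
  rewrite map_inj_in_uniq ?filter_uniq ?uniq_initial//.
  by move=> [j c] [j' c']; rewrite !mem_filter /= => /andP[-> _] /andP[-> _] ->.
rewrite -big_filter -(big_map fst xpredT eps); apply: h.
rewrite map_inj_in_uniq ?filter_uniq ?uniq_initial//.
by move=> [j c] [j' c']; rewrite !mem_filter /= => /andP[/negPf -> _] /andP[/negPf -> _] ->.
Qed.

End summable_weights.

(** * Summability in L^p of series over words *)

Section word_series.
Context {R : realType} {V W : normedModType R} (ip : {dot V for idfun}).
Variable iota : V -> W.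
Hypothesis iota_dense : dense (range iota).
Variables (h : R) (mu : probability (borel W) R).
Hypotheses (h0 : 0 < h) (gmu : gaussian_measure ip iota h mu).
Context {G : countType}.
Let T := (G * bool)%type.
Variables (w : T -> V) (y : T -> W -> R).
Hypothesis ow : forall d d', ip (w d) (w d') = (d == d')%:R.
Hypothesis yw : forall d, dual_vector ip iota (y d) (w d).
Variables (eps : T -> R) (E : R).
Hypothesis eps0 : forall d, 0 <= eps d.
Hypothesis epsE : forall n, \sum_(d <- initial n) eps d <= E.

(** The constant depends neither on the word nor on the function, so that only the weights [C]
    remain to be summed. *)
Lemma Lnorm_dual_product_le (q : R) i : 1 <= q -> exists2 c : R, 1 <= c &
  forall (u : i.-tuple T) (f : W -> R[i]) (C : R), 0 <= C ->
  (forall b, measurable_fun setT (fun Y : borel W => cpart b (f Y))) ->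
  {ae mu, forall Y : borel W, Normc.normc (f Y) <= `|\prod_(d <- u) y d Y| * C} ->
  ('N[mu]_q%:E[(fun Y : borel W => (Normc.normc (f Y))%:E)] <= (c * C)%:E)%E.
Proof.
move=> q1; have q0 : 0 < q by exact: lt_le_trans q1.
have [c c1 hc] := @dual_product_moment _ _ _ _ _ iota_dense _ _ h0 gmu _ _ _ ow yw q i q0.
exists c => // u f C C0 mf fC.
have mp : measurable_fun setT (fun Y : borel W => \prod_(d <- u) y d Y).
  exact: (measurable_dual_product yw).
apply: (@le_trans _ _ ('N[mu]_q%:E[(fun Y : borel W => (`|\prod_(d <- u) y d Y| * C)%:E)])%E).
  apply: Lnorm_mono => //.
  - exact: measurable_normc.
  - by apply: measurable_funM => //; exact: measurableT_comp.
  apply: filterS fC => Y YC; rewrite ger0_norm ?normc_ge0//.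
  exact: le_trans (ler_norm _).
have c0 : 0 <= c by lra.
apply: Lnorm_le_of_integral => //; first exact: mulr_ge0.
under eq_integral => Y _ do rewrite normrM normr_id (ger0_norm C0) powRM// EFinM muleC.
rewrite ge0_integralZl//; last 2 first.
- by apply/measurable_EFinP; exact: measurable_normr_powR.
- by rewrite lee_fin powR_ge0.
rewrite powRM// mulrC EFinM; apply: lee_wpmul2l; first by rewrite lee_fin powR_ge0.
(* As c >= 1 and q >= 1, the moment bound c is at most c^q. *)
apply: le_trans (hc u) _; rewrite lee_fin -[leLHS]powRr1//.
exact: ler_powR.
Qed.

Variables (i : nat) (f : i.-tuple G * i.-tuple bool -> W -> R[i]) (C : R).
Hypothesis C0 : 0 <= C.
Hypothesis mf : forall b l, measurable_fun setT (fun Y : borel W => cpart b (f l Y)).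
Hypothesis fC : forall l, {ae mu, forall Y : borel W, Normc.normc (f l Y) <=
  `|\prod_(d <- join_word l) y d Y| * (C * \prod_(d <- join_word l) eps d)}.

Let Bl (l : i.-tuple G * i.-tuple bool) := C * \prod_(d <- join_word l) eps d.

Let Bl0 l : 0 <= Bl l.
Proof. by rewrite mulr_ge0// prodr_ge0. Qed.

Let words_fset n : {fset i.-tuple G * i.-tuple bool} :=
  seq_fset tt (map (@split_word G i) (tuple_words (initial n) i)).

Let mem_words_fset n l :
  (l \in words_fset n) = all (fun d => choice.pickle d < n)%N (join_word l).
Proof.
rewrite seq_fsetE -[l in LHS]join_wordK mem_map; last exact: can_inj (@split_wordK _ _).
by rewrite mem_tuple_words; apply: eq_all => d; rewrite /= mem_initial.
Qed.

Let big_words_fset (K : nmodType) n (g : i.-tuple G * i.-tuple bool -> K) :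
  \sum_(l <- words_fset n) g l =
  \sum_(u <- tuple_words (initial n) i) g (split_word u).
Proof.
rewrite (perm_big _ (seq_fset_perm _ _)) undup_id ?big_map// map_inj_uniq.
  by apply: uniq_tuple_words; exact: uniq_initial.
exact: can_inj (@split_wordK _ _).
Qed.

(** The sets of words over [initial n] are cofinal among finite index sets: the limit of the net of
    finite sums is also the limit along this sequence. *)
Let fset_sub_words (A : {fset i.-tuple G * i.-tuple bool}) :
  exists N, forall n, (N <= n)%N -> (A `<=` words_fset n)%fset.
Proof.
exists (\max_(l <- A) \max_(d <- join_word l) (choice.pickle d).+1)%N => n Nn.
apply/fsubsetP => l lA; rewrite mem_words_fset; apply/allP => d dl.
apply: leq_trans Nn; apply: (@leq_trans (\max_(d <- join_word l) (choice.pickle d).+1)%N).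
  exact: (leq_bigmax_seq (F := fun d => (choice.pickle d).+1) (P := xpredT)).
exact: (leq_bigmax_seq (F := fun l => (\max_(d <- join_word l) (choice.pickle d).+1)%N) (P
  := xpredT)).
Qed.

Let BlBd (c : R) (A : {fset i.-tuple G * i.-tuple bool}) : 0 <= c ->
  \sum_(l <- A) c * Bl l <= c * (C * E ^+ i).
Proof.
move=> c0; have [N /(_ N (leqnn N)) AN] := fset_sub_words A.
have sub (S : {fset i.-tuple G * i.-tuple bool}) : (A `<=` S)%fset ->
    \sum_(l <- A) c * Bl l <= \sum_(l <- S) c * Bl l.
  move=> AS; rewrite [leRHS](bigID (mem A)) /= ler_wpDr//.
    by apply: sumr_ge0 => l _; rewrite mulr_ge0.
  rewrite -[leRHS]big_filter; apply/le_of_eq/perm_big.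
  apply: uniq_perm; rewrite ?fset_uniq ?filter_uniq ?fset_uniq// => l.
  by rewrite mem_filter /= andb_idr// => /(fsubsetP AS).
apply: le_trans (sub _ AN) _.
rewrite big_words_fset -big_distrr /= ler_wpM2l//.
rewrite -big_distrr /= ler_wpM2l//.
rewrite (eq_bigr (fun u : i.-tuple T => \prod_(d <- u) eps d)) => [|u _]; last first.
  by rewrite -[in RHS](split_wordK u).
rewrite prod_tuple_words lerXn2r ?nnegrE ?sumr_ge0//.
by apply: le_trans (epsE 0); rewrite sumr_ge0.
Qed.

Lemma cLsum_words (q : R) : 1 <= q -> cLsum mu q f (unordered_sum f).
Proof.
move=> q1; have [c c1 hc] := Lnorm_dual_product_le i q1.
have [c' c'1 hc'] := Lnorm_dual_product_le i (lexx 1).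
(* [c] serves for L^q and [c'] for L^1; their sum gives the one family of bounds valid for both
   exponents that [cLsum_unordered_sum] expects. *)
have cc0 : 0 <= c + c' by lra.
apply: (@cLsum_unordered_sum _ _ mu _ f (fun l => (c + c') * Bl l) ((c + c') * (C * E ^+
  i))) => //.
- by move=> l; rewrite mulr_ge0.
- by move=> A; exact: BlBd.
- move=> l; apply: le_trans (hc' _ _ _ (Bl0 l) (mf^~ l) (fC l)) _.
  by rewrite lee_fin ler_wpM2r//; lra.
- move=> l; apply: le_trans (hc _ _ _ (Bl0 l) (mf^~ l) (fC l)) _.
  by rewrite lee_fin ler_wpM2r//; lra.
Qed.

Variables (b : bool) (r : i.-tuple T -> W -> R).
Hypothesis mr : forall u, measurable_fun setT (r u : borel W -> R).
Hypothesis fr : forall u, {ae mu, forall Y : borel W,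
  cpart b (f (split_word u) Y) = r u Y}.

(** Replaces the unordered sum of complex functions built from [ell] by a limit of finite sums of
    real functions [r] built from genuine functionals, equal to them almost everywhere. *)
Lemma L1_cvg_words : L1_cvg (T := borel W) mu
  (fun n Y => \sum_(u <- tuple_words (initial n) i) r u Y)
  (fun Y => cpart b (unordered_sum f Y)).
Proof.
have [_ [mSre mSim _] hS] := cLsum_words (lexx 1).
have mS b' : measurable_fun setT (fun Y : borel W => cpart b' (unordered_sum f Y)).
  by case: b'; [exact: mSim|exact: mSre].
have msum (s : seq (i.-tuple T)) : measurable_fun setT (fun Y : borel W => \sum_(u <- s) r u Y).
  by apply: measurable_sum => u; exact: mr.
split => //.
apply: cvge0P => [n|e e0]; first exact: integral_ge0.
have [A0 hA0] := hS e e0; have [N hN] := fset_sub_words A0.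
exists N => // n /= Nn; apply: le_trans (ltW (hA0 _ (hN n Nn))).
rewrite /cLdist Lnorm1.
have aer : {ae mu, forall Y : borel W, \sum_(u <- tuple_words (initial n) i) r u Y =
    cpart b (\sum_(l <- words_fset n) f l Y)}.
  suff : {ae mu, forall Y : borel W, \sum_(u <- tuple_words (initial n) i) r u Y =
      \sum_(u <- tuple_words (initial n) i) cpart b (f (split_word u) Y)}.
    by apply: filterS => Y ->; rewrite big_words_fset cpart_sum.
  elim: (tuple_words _ _) => [|u s ih]; first by apply: nearW => Y; rewrite !big_nil.
  by apply: filterS2 ih (fr u) => Y sY uY; rewrite !big_cons uY sY.
apply: ae_ge0_le_integral => //.
- by apply/measurable_EFinP; apply: measurableT_comp => //; exact: measurable_funB.
- apply: measurableT_comp => //; apply/measurable_EFinP; apply: measurable_normc => b'.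
  under eq_fun do rewrite cpartB cpart_sum.
  by apply: measurable_funB => //; apply: measurable_sum => l; exact: mf.
apply: filterS aer => Y -> _; rewrite abse_EFin lee_fin -cpartB.
by apply: le_trans (cpart_le _ _) _; exact: ler_norm.
Qed.

End word_series.

(** * The Taylor formula for the stochastic extension of a symbol *)

Section stochastic_taylor.
Context {R : realType} {H B : completeNormedModType R} {Gamma : countType}.
Variables (ip : {dot H for idfun}) (iota : {linear H -> B}) (e : Gamma -> H).
Hypothesis hW : wiener_space ip iota.
Hypothesis he : hilbert_basis ip e.
Let W2 : normedModType R := (B * B)%type.
Variable mu : R -> probability (borel W2) R.
Hypothesis hmu : forall h, 0 < h ->
  gaussian_measure (prod_dot ip) (map_pair iota) h (mu h).
Variable z : Gamma -> B -> R.
Hypothesis ze : forall j, dual_vector ip iota (z j) (e j).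
Variables (eps : Gamma -> R) (E : R).
Hypothesis eps0 : forall j, 0 <= eps j.
Hypothesis epsE : forall n, \sum_(d <- @initial (Gamma * bool)%type n) eps d.1 <= E.
Variables (m : nat) (M : R) (F : H * H -> R[i]).
Hypotheses (M0 : 0 <= M) (hF : symbol_bound e m M eps F).
Variables (X : H * H) (h : R).
Hypothesis h0 : 0 < h.
Variable P : (H * H -> R[i]) -> (B * B -> R[i]).
Hypothesis hP : forall G, symbol_class e 1 eps G ->
  forall h' q : R, 0 < h' <= 2 * h -> 1 <= q ->
  stoch_ext (prod_dot ip) (map_pair iota) (mu h') q G (P G).

Let T := (Gamma * bool)%type.
Let y (d : T) (Y : B * B) : R := if d.2 then z d.1 Y.2 else z d.1 Y.1.
Let D (s : seq T) : H * H -> R[i] := iter_deriv (map (wdir e) s) F.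
Let g b s x := cpart b (D s x).
Let pg b s Y := cpart b (P (D s) Y).
Let Cs (s : seq T) := M * \prod_(d <- s) eps d.1.
Let epsT (d : T) := eps d.1.
Let pi n (Y : B * B) := frame_proj (wdir e) y n Y.

Let yw : forall d, dual_vector (prod_dot ip) (map_pair iota) (y d) (wdir e d).
Proof. exact: (dual_vector_wdir ze). Qed.

Let idense := map_pair_dense hW.
Let Wsep := prod_dense_sequence hW.
Let Wdual := prod_dual_representation hW.
Let nle := normr_prod_dot_le hW.
Let ile := prod_dot_le_normr hW.
Let ow := prod_dot_wdir he.
Let dw := dense_wdir he.

Let epsT0 d : 0 <= epsT d. Proof. exact: eps0. Qed.

Let Cs0 s : 0 <= Cs s.
Proof. by rewrite mulr_ge0// prodr_ge0. Qed.

Let cnt (s : seq T) : (size s <= m)%N -> forall d, (count_mem d s <= m)%N.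
Proof. by move=> sm d; exact: leq_trans (count_size _ _) sm. Qed.

Let g_cont b s : (size s <= m)%N -> continuous (g b s).
Proof.
move=> /cnt sm; have [_ [c1 c2] _] := symbol_word_bound hF sm.
by rewrite /g /cpart; case: b; [exact: c2|exact: c1].
Qed.

Let g_le b s : (size s <= m)%N -> forall x, `|g b s x| <= Cs s.
Proof.
move=> /cnt sm x; have [_ _ bx] := symbol_word_bound hF sm.
exact: le_trans (cpart_le b _) (bx x).
Qed.

Let g_der b s : (size s < m)%N -> forall d x, derivable (g b s) x (wdir e d).
Proof.
move=> sm d x; have ds : (size (d :: s) <= m)%N by [].
have [d1 d2] := symbol_word_derivable hF (cnt ds) x.
by rewrite /g /cpart; case: b; [exact: d2|exact: d1].
Qed.

Let gE b s d : g b (d :: s) = fun x => 'D_(wdir e d) (g b s) x.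
Proof. by rewrite /g /cpart; case: b. Qed.

Let g_dle b s : (size s < m)%N ->
  forall d x, `|'D_(wdir e d) (g b s) x| <= Cs s * epsT d.
Proof.
move=> sm d x; have ds : (size (d :: s) <= m)%N by [].
have := g_le b ds x; rewrite gE /Cs big_cons /epsT.
by rewrite mulrCA mulrC.
Qed.

Let stoch s h' q : (size s < m)%N -> 0 < h' <= 2 * h -> 1 <= q ->
  stoch_ext (prod_dot ip) (map_pair iota) (mu h') q (D s) (P (D s)).
Proof.
by move=> sm; apply: hP; apply: (iter_deriv_symbol_class eps0 sm); exists M.
Qed.

Let h2h : 0 < h <= 2 * h.
Proof. by rewrite h0 ler_peMl ?ler1n// ltW. Qed.

Let mpg b s : (size s < m)%N ->
  measurable_fun setT (pg b s : borel W2 -> R).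
Proof.
move=> sm; have [_ _ [m1 m2 _] _] := stoch sm h2h (lexx 1).
by rewrite /pg /cpart; case: b; [exact: m2|exact: m1].
Qed.

(** The frame is one of the sequences allowed in [stoch_ext], and by [proj_ext_frame] the continuous
    projection may be used in it. *)
Let gcvg b s : (size s < m)%N -> forall h', 0 < h' <= h ->
  (\int[mu h']_Y (`|g b s (pi n Y) - pg b s Y|)%:E)%E @[n --> \oo] --> 0%E.
Proof.
move=> sm h' /andP[h'0 h'h]; have h'2 : 0 < h' <= 2 * h by rewrite h'0 /=; lra.
have [_ _ [mP1 mP2 _] /(_ (frame (wdir e)))] := stoch sm h'2 (lexx 1).
move=> /(_ (orthonormal_frame ow) (@lspan_frameS _ _ _ _) (dense_frame dw))[mG cG].
apply: (@squeeze_cvge _ _ _ _ (cst 0%E) _ _ _ _ _ cG); last exact: cvg_cst.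
apply: nearW => n; rewrite integral_ge0//= /cLdist Lnorm1.
have [mG1 mG2 _] := mG n.
have gp : measurable_fun setT (fun Y : borel W2 => g b s (pi n Y)).
  apply: continuous_borel_measurableR => Y; apply: continuous_comp.
    exact: (frame_proj_continuous yw).
  by apply: g_cont; exact: ltnW.
apply: ae_ge0_le_integral => //.
- apply/measurable_EFinP; apply: measurableT_comp => //; apply: measurable_funB => //.
  exact: mpg.
- apply: measurableT_comp => //; apply/measurable_EFinP; apply: measurable_normc => b'.
  under eq_fun do rewrite cpartB; apply: measurable_funB.
    by case: b'; [exact: mG2|exact: mG1].
  by case: b'; [exact: mP2|exact: mP1].
apply: filterS (proj_ext_frame idense ile yw h'0 (hmu h'0) n) => Y YE _.
rewrite abse_EFin lee_fin /= YE /g /pg -cpartB.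
by apply: le_trans (cpart_le _ _) _; exact: ler_norm.
Qed.

Variable n : nat.
Hypothesis nm : (n.+1 < m)%N.

Let rho (s : R) : R := (1 - s) ^+ n / n`!%:R.

Let crho : continuous rho.
Proof.
move=> s; apply: cvgMl.
apply: (@continuous_comp _ _ _ (fun t : R => 1 - t) (fun t : R => t ^+ n)).
  by apply: cvgB; [exact: cvg_cst|exact: cvg_id].
exact: exprn_continuous.
Qed.

Let rho1 s : 0 <= s <= 1 -> `|rho s| <= 1.
Proof.
move=> /andP[s0 s1]; have s2 : 0 <= 1 - s by lra.
rewrite ger0_norm ?divr_ge0 ?exprn_ge0// ler_pdivrMr ?ltr0n ?fact_gt0// mul1r.
apply: (@le_trans _ _ 1); last by rewrite ler1n fact_gt0.
by apply: exprn_ile1 => //; lra.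
Qed.

Let c b s Y := (\int[lebesgue_measure]_(t in `[0%R, 1%R])
  (rho t * pg b s (map_pair iota X + t *: Y)))%R.
Let ca b s k Y := (\int[lebesgue_measure]_(t in `[0%R, 1%R])
  (rho t * g b s (X + t *: pi k Y)))%R.

Let u1 : 0 < (1 : R) <= 1. Proof. by rewrite ltr01 lexx. Qed.

Let Lc b s : (size s < m)%N ->
  [/\ measurable_fun setT (c b s : borel W2 -> R),
      {ae mu h, forall Y : borel W2, `|c b s Y| <= Cs s},
      forall k, measurable_fun setT (ca b s k : borel W2 -> R),
      forall k, {ae mu h, forall Y : borel W2, `|ca b s k Y| <= Cs s} &
      (\int[mu h]_Y (`|ca b s k Y - c b s Y|)%:E)%E @[k --> \oo] --> 0%E].
Proof.
move=> sm; have sm' := ltnW sm; split.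
- exact: (time_average_measurable (map_pair iota) Wsep (@mpg b s sm) X crho).
- exact: (time_average_bounded idense Wsep Wdual yw h0 hmu
    (@g_cont b s sm') (@g_le b s sm') (@mpg b s sm) (@gcvg b s sm) X crho rho1).
- by move=> k; exact: (time_average_approx_measurable Wsep yw (@g_cont b s sm') X crho k).
- by move=> k; exact: (time_average_approx_bounded Wsep yw h mu
    (@g_cont b s sm') (@g_le b s sm') X crho rho1 k).
- exact: (cvg_time_average idense Wsep Wdual nle ile ow dw yw h0 hmu
    (@g_cont b s sm') (@g_le b s sm') (@g_der b s sm) (@g_dle b s sm) (Cs0 s) epsT0 epsE
    (@mpg b s sm) (@gcvg b s sm) X crho rho1).
Qed.

(** The left-hand side of the formula: the translation results at s = 1. *)
Let Le b : [/\ {ae mu h, forall Y : borel W2,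
      `|pg b [::] (map_pair iota X + Y)| <= Cs [::]} &
    L1_cvg (T := borel W2) (mu h) (fun k Y => g b [::] (X + pi k Y))
      (fun Y => pg b [::] (map_pair iota X + Y))].
Proof.
have m0 : (size ([::] : seq T) < m)%N by exact: leq_ltn_trans nm.
have mt : measurable_fun setT
    (fun Y : borel W2 => (map_pair iota X + Y : borel W2)).
  apply: continuous_borel_measurable => Y.
  by apply: cvgD; [exact: cvg_cst|exact: cvg_id].
split.
  apply: filterS (ae_translate_bounded idense Wsep Wdual yw h0 hmu
    (@g_cont b [::] (ltnW m0)) (@g_le b [::] (ltnW m0)) (@mpg b [::] m0) (@gcvg b [::] m0)
      X u1) => Y.
  by rewrite scale1r.
split.
- move=> k; apply: continuous_borel_measurableR => Y.
  apply: (@continuous_comp _ _ _ (fun Y => X + pi k Y) (g b [::])).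
    by apply: cvgD; [exact: cvg_cst|exact: (frame_proj_continuous yw)].
  by apply: g_cont; exact: ltnW.
- exact: (measurableT_comp (@mpg b [::] m0) mt).
have := cvg_translate idense Wsep Wdual nle ile ow dw yw h0 hmu
    (@g_cont b [::] (ltnW m0)) (@g_le b [::] (ltnW m0)) (@g_der b [::] m0) (@g_dle b [::] m0)
    (Cs0 [::]) epsT0 epsE (@mpg b [::] m0) (@gcvg b [::] m0) X u1.
by under eq_fun => k do under eq_integral => Y _ do rewrite !scale1r.
Qed.

(** For a fixed word, [cvg_product_L1] applies, with the second moment [k2] of the product of
    functionals. The domination in Tannery's theorem comes from the first moment [k1] and from
    [2 * Cs u], each of the two time averages being bounded by [Cs u]. *)
Let Lrem b : (\int[mu h]_Y (`|\sum_(u <- tuple_words (initial k) n.+1)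
     (\prod_(d <- u) y d Y) * ca b u k Y -
   \sum_(u <- tuple_words (initial k) n.+1) (\prod_(d <- u) y d Y) * c b u Y|)%:E)%E
  @[k --> \oo] --> 0%E.
Proof.
have sz (u : n.+1.-tuple T) : (size u < m)%N by rewrite size_tuple.
have [k1 k11 hk1] := @dual_product_moment _ _ _ _ _ idense _ _ h0 (hmu h0) _ _ _ ow yw 1
  n.+1 ltr01.
have [k2 _ hk2] := @dual_product_moment _ _ _ _ _ idense _ _ h0 (hmu h0) _ _ _ ow yw 2 n.+1
  (ltr0Sn _ 1).
pose pr (u : n.+1.-tuple T) (Y : borel W2) := \prod_(d <- u) y d Y.
have mpr u : measurable_fun setT (pr u) by exact: (measurable_dual_product yw).
have mc (u : n.+1.-tuple T) k :
    measurable_fun setT (fun Y : borel W2 => ca b u k Y - c b u Y).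
  by have [m1 _ m2 _ _] := @Lc b u (sz u); apply: measurable_funB.
have mprc u k : measurable_fun setT (fun Y => (`|pr u Y * (ca b u k Y - c b u Y)|)%:E).
  by apply/measurable_EFinP; apply: measurableT_comp => //; apply: measurable_funM.
have cC (u : n.+1.-tuple T) k : {ae mu h, forall Y : borel W2,
    `|ca b u k Y - c b u Y| <= 2 * Cs u}.
  have [_ b1 _ b2 _] := @Lc b u (sz u).
  apply: filterS2 b1 (b2 k) => Y cY caY; apply: le_trans (ler_normB _ _) _; lra.
pose I k u := (\int[mu h]_Y (`|pr u Y * (ca b u k Y - c b u Y)|)%:E)%E.
have Ile k u : (I k u <= (2 * k1 * M * \prod_(d <- u) epsT d)%:E)%E.
  have -> : 2 * k1 * M * \prod_(d <- u) epsT d = 2 * Cs u * k1 by rewrite /Cs /epsT; ring.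
  have C20 : 0 <= 2 * Cs u by rewrite mulr_ge0.
  apply: (@le_trans _ _ (\int[mu h]_Y ((2 * Cs u)%:E * (`|pr u Y| `^ 1)%:E))%E).
    apply: ae_ge0_le_integral => //.
    - by move=> Y _; rewrite -EFinM lee_fin mulr_ge0// powR_ge0.
    - by apply: emeasurable_funM => //; apply/measurable_EFinP; exact: measurable_normr_powR.
    apply: filterS (cC u k) => Y cY _.
    by rewrite -EFinM lee_fin normrM powRr1// mulrC ler_wpM2r.
  rewrite ge0_integralZl//; last first.
    by apply/measurable_EFinP; exact: measurable_normr_powR.
  by rewrite (EFinM (2 * Cs u) k1); apply: lee_wpmul2l; [rewrite lee_fin|exact: hk1].
have I0 k u : (0 <= I k u)%E by exact: integral_ge0.
have Ifin k u : I k u \is a fin_num by rewrite ge0_fin_numE// (le_lt_trans (Ile k u))// ltry.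
have cI u : fine (I k u) @[k --> \oo] --> (0 : R).
  have [_ _ _ _ cu] := @Lc b u (sz u).
  have cI0 := @cvg_product_L1 _ _ _ (mu h) (pr u) (fun k Y => ca b u k Y - c b u Y)
    (2 * Cs u) k2 (mpr u) (mc u).
  apply: (@fine_cvg _ _ _ _ (fun k => I k u) 0); apply: cI0 => //.
  apply: le_trans (hk2 u); apply: le_of_eq.
  by apply: eq_integral => Y _; rewrite powR_mulrn// real_normK// num_real.
have tann := @tannery_words _ _ epsT E epsT0 epsE n.+1 (fun k u => fine (I k u)) (2 * k1 * M).
have cT : \sum_(u <- tuple_words (initial k) n.+1) fine (I k u) @[k --> \oo] --> (0 : R).
  by apply: tann => // k u; rewrite fine_ge0//= -lee_fin fineK// Ile.
apply: (@squeeze_cvge _ _ _ _ (cst 0%E) _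
  (fun k => (\sum_(u <- tuple_words (initial k) n.+1) fine (I k u))%:E)).
- apply: nearW => k; rewrite integral_ge0//= -sumEFin.
  under eq_bigr => u _ do rewrite fineK//.
  rewrite -ge0_integral_sum//.
  apply: ge0_le_integral => //.
  + apply/measurable_EFinP; apply: measurableT_comp => //; apply: measurable_funB.
      apply: measurable_sum => u; apply: measurable_funM; first exact: mpr.
      by have [_ _ m2 _ _] := @Lc b u (sz u).
    apply: measurable_sum => u; apply: measurable_funM; first exact: mpr.
    by have [m1 _ _ _ _] := @Lc b u (sz u).
  + by apply: emeasurable_sum => u; exact: mprc.
  + move=> Y _; rewrite sumEFin lee_fin -sumrB.
    apply: le_trans (ler_norm_sum _ _ _) _; apply: ler_sum => u _.
    by rewrite -mulrBr.
- exact: cvg_cst.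
- by apply: cvg_EFin; [exact: nearW|].
Qed.

Let multi_dirE i (l : i.-tuple Gamma * i.-tuple bool) :
  multi_dir e l = map_tuple (wdir e) (join_word l).
Proof.
apply: eq_from_tnth => r; rewrite tnth_mktuple tnth_map; congr wdir.
rewrite [in RHS](tnth_nth (tnth l.1 r, tnth l.2 r)) /= nth_zip ?size_tuple//.
by rewrite -!tnth_nth.
Qed.

Let partialE i (l : i.-tuple Gamma * i.-tuple bool) : partial e l F = D (join_word l).
Proof. by rewrite /partial multi_dirE. Qed.

Let ell_prodE i (l : i.-tuple Gamma * i.-tuple bool) Y :
  ell_prod ip iota e (mu h) l Y =
  \prod_(d <- join_word l) ell (prod_dot ip) (map_pair iota) (mu h) (wdir e d) Y.
Proof.
rewrite /ell_prod multi_dirE -(big_map (wdir e) xpredT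
  (fun v => ell (prod_dot ip) (map_pair iota) (mu h) v Y)).
by rewrite (big_tuple _ _ (map_tuple (wdir e) (join_word l))).
Qed.

Let ell_prod_ae i (l : i.-tuple Gamma * i.-tuple bool) :
  {ae mu h, forall Y : borel W2,
    ell_prod ip iota e (mu h) l Y = \prod_(d <- join_word l) y d Y}.
Proof.
suff : {ae mu h, forall Y : borel W2,
  \prod_(d <- join_word l) ell (prod_dot ip) (map_pair iota) (mu h) (wdir e d) Y =
  \prod_(d <- join_word l) y d Y} by apply: filterS => Y <-; exact: ell_prodE.
elim: (tval (join_word l)) => [|d s ih].
  by apply: nearW => Y; rewrite !big_nil.
apply: filterS2 ih (ell_dual_ae idense h0 (hmu h0) ile (yw d)) => Y sY dY.
by rewrite !big_cons sY dY.
Qed.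

Let ell_prod_measurable i (l : i.-tuple Gamma * i.-tuple bool) :
  measurable_fun setT (ell_prod ip iota e (mu h) l : borel W2 -> R).
Proof.
rewrite (_ : ell_prod _ _ _ _ _ = fun Y => \prod_(d <- join_word l)
  ell (prod_dot ip) (map_pair iota) (mu h) (wdir e d) Y); last first.
  by apply/funext => Y; exact: ell_prodE.
elim: (tval (join_word l)) => [|d s ih].
  by rewrite (_ : (fun Y => _) = cst 1)//; apply/funext => Y; rewrite big_nil.
rewrite (_ : (fun Y => _) = fun Y => ell (prod_dot ip) (map_pair iota) (mu h) (wdir e d) Y *
  \prod_(d <- s) ell (prod_dot ip) (map_pair iota) (mu h) (wdir e d) Y).
  apply: measurable_funM; last exact: ih.
  exact: (measurable_ell idense h0 (hmu h0) ile (yw d)).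
by apply/funext => Y; rewrite big_cons.
Qed.

Let fS i (l : i.-tuple Gamma * i.-tuple bool) (Y : B * B) : R[i] :=
  (ell_prod ip iota e (mu h) l Y)%:C * partial e l F X.

Let fI (l : n.+1.-tuple Gamma * n.+1.-tuple bool) (Y : B * B) : R[i] :=
  cintegral01 (fun s : R => (rho s)%:C * P (partial e l F) (map_pair iota X + s *: Y)).

Let fT (l : n.+1.-tuple Gamma * n.+1.-tuple bool) (Y : B * B) : R[i] :=
  (ell_prod ip iota e (mu h) l Y)%:C * fI l Y.

Let cpart_fI b l Y : cpart b (fI l Y) = c b (join_word l) Y.
Proof.
rewrite /fI /c /pg partialE; under [RHS]eq_Rintegral => s _ do rewrite -cpartZ.
by case: b.
Qed.

Let mfS i (l : i.-tuple Gamma * i.-tuple bool) b :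
  measurable_fun setT (fun Y : borel W2 => cpart b (fS l Y)).
Proof. by under eq_fun do rewrite cpartZ; apply: measurable_funM. Qed.

Let jsz (l : n.+1.-tuple Gamma * n.+1.-tuple bool) : (size (join_word l) < m)%N.
Proof. by rewrite size_tuple. Qed.

Let mfT l b : measurable_fun setT (fun Y : borel W2 => cpart b (fT l Y)).
Proof.
under eq_fun do rewrite cpartZ cpart_fI; apply: measurable_funM => //.
by have [mc _ _ _ _] := @Lc b _ (jsz l).
Qed.

Let fSC i (l : i.-tuple Gamma * i.-tuple bool) : (i <= m)%N ->
  {ae mu h, forall Y : borel W2, Normc.normc (fS l Y) <=
    `|\prod_(d <- join_word l) y d Y| * (M * \prod_(d <- join_word l) epsT d)}.
Proof.
move=> im; apply: filterS (ell_prod_ae l) => Y YE.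
rewrite /fS normcZ YE ler_wpM2l// partialE.
have sl : (size (join_word l) <= m)%N by rewrite size_tuple.
by have [_ _ bx] := symbol_word_bound hF (cnt sl); exact: bx.
Qed.

(** The real and imaginary parts of the time average are each bounded by M times the weight, whence
    the factor 2. *)
Let fTC l : {ae mu h, forall Y : borel W2, Normc.normc (fT l Y) <=
    `|\prod_(d <- join_word l) y d Y| * ((2 * M) * \prod_(d <- join_word l) epsT d)}.
Proof.
have [_ b1 _ _ _] := @Lc true _ (jsz l); have [_ b2 _ _ _] := @Lc false _ (jsz l).
apply: filterS3 (ell_prod_ae l) b1 b2 => Y YE h1 h2.
rewrite /fT normcZ YE ler_wpM2l// -mulrA mulrDl mul1r.
by apply: normc_le_cparts => -[]; rewrite cpart_fI.
Qed.

Let Sum i := unordered_sum (@fS i).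
Let Rem := unordered_sum fT.

Let Sum_cvg i b : (i <= m)%N -> L1_cvg (T := borel W2) (mu h)
  (fun k Y => \sum_(u <- tuple_words (initial k) i) (\prod_(d <- u) y d Y) * g b u X)
  (fun Y => cpart b (Sum i Y)).
Proof.
move=> im; apply: (L1_cvg_words idense h0 (hmu h0) ow yw epsT0 epsE M0
  (fun b' l => mfS l b') (fun l => @fSC i l im)).
- by move=> u; apply: measurable_funM => //; exact: (measurable_dual_product yw).
move=> u; apply: filterS (ell_prod_ae (split_word u)) => Y YE.
by rewrite /fS cpartZ YE partialE /g split_wordK.
Qed.

Let M20 : 0 <= 2 * M. Proof. by rewrite mulr_ge0. Qed.

Let Rem_cvg b : L1_cvg (T := borel W2) (mu h)
  (fun k Y => \sum_(u <- tuple_words (initial k) n.+1) (\prod_(d <- u) y d Y) * c b u Y)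
  (fun Y => cpart b (Rem Y)).
Proof.
have sz (u : n.+1.-tuple T) : (size u < m)%N by rewrite size_tuple.
apply: (L1_cvg_words idense h0 (hmu h0) ow yw epsT0 epsE M20
  (fun b' l => mfT l b') fTC).
- move=> u; apply: measurable_funM; first exact: (measurable_dual_product yw).
  by have [mc _ _ _ _] := @Lc b u (sz u).
move=> u; apply: filterS (ell_prod_ae (split_word u)) => Y YE.
by rewrite /fT cpartZ YE cpart_fI split_wordK.
Qed.

(** Two L^1 limits of one sequence: g (X + pi k Y) tends to the left-hand side by [Le], and its
    classical Taylor expansion along [pi k Y] tends to the right-hand side term by term. *)
Let formula b : {ae mu h, forall Y : borel W2,
  pg b [::] (map_pair iota X + Y) =
  g b [::] X + \sum_(1 <= i < n.+1) i`!%:R^-1 * cpart b (Sum i Y) + cpart b (Rem Y)}.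
Proof.
have [_ cL] := Le b.
have cQ : L1_cvg (T := borel W2) (mu h)
    (fun k Y => \sum_(u <- tuple_words (initial k) n.+1) (\prod_(d <- u) y d Y) * ca b u k Y)
    (fun Y => cpart b (Rem Y)).
  apply: (L1_cvg_trans _ (@Lrem b) (Rem_cvg b)) => k.
  apply: measurable_sum => u; apply: measurable_funM; first exact: (measurable_dual_product yw).
  have sz : (size u < m)%N by rewrite size_tuple.
  by have [_ _ mca _ _] := @Lc b u sz.
have cS : L1_cvg (T := borel W2) (mu h)
    (fun k Y => \sum_(1 <= i < n.+1) i`!%:R^-1 *
      \sum_(u <- tuple_words (initial k) i) (\prod_(d <- u) y d Y) * g b u X)
    (fun Y => \sum_(1 <= i < n.+1) i`!%:R^-1 * cpart b (Sum i Y)).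
  apply: (@L1_cvg_sum _ _ _ (mu h) _ (index_iota 1 n.+1)
    (fun i k Y => i`!%:R^-1 * \sum_(u <- tuple_words (initial k) i) (\prod_(d <- u) y d Y)
      * g b u X)
    (fun i Y => i`!%:R^-1 * cpart b (Sum i Y))) => i.
  rewrite mem_index_iota => /andP[_ iN]; apply: L1_cvgZ; apply: Sum_cvg.
  exact: ltnW (ltn_trans iN nm).
have cR := L1_cvgD (L1_cvgD (L1_cvg_cst (mu h) (g b [::] X)) cS) cQ.
apply: (L1_cvg_unique cL).
rewrite (_ : (fun k Y => g b [::] (X + pi k Y)) = fun k Y => cst (g b [::] X) Y +
  (\sum_(1 <= i < n.+1) i`!%:R^-1 *
     \sum_(u <- tuple_words (initial k) i) (\prod_(d <- u) y d Y) * g b u X) +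
  \sum_(u <- tuple_words (initial k) n.+1) (\prod_(d <- u) y d Y) * ca b u k Y).
  exact: cR.
apply/funext => k; apply/funext => Y.
rewrite (@multidirectional_taylor _ _ _ (wdir e) (g b) n _ _ _ (initial k) (fun d => y d Y) X).
(* The term i = 0 is the sum over the single empty word, that is, the value at [X]. *)
- congr (_ + _); rewrite big_nat_recl//= big_add1 /=.
  by rewrite big_seq1 big_nil invr1 !mul1r.
- by move=> s d x sn; apply: g_der; exact: leq_ltn_trans sn (ltnW nm).
- by move=> s d _; exact: gE.
- by move=> s sn; apply: g_cont; exact: leq_trans (ltnW nm).
Qed.

Lemma stochastic_taylor_integrable (l : n.+1.-tuple Gamma * n.+1.-tuple bool) :
  {ae mu h, forall Y : B * B,
    cintegrable01 (fun t : R => ((1 - t) ^+ n / n`!%:R)%:C *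
      P (partial e l F) (map_pair iota X + t *: Y))}.
Proof.
pose s := tval (join_word l); have sm : (size s < m)%N := jsz l.
have sm' := ltnW sm; rewrite partialE -/s.
have ib b := time_average_integrable idense Wsep Wdual yw h0 hmu
  (@g_cont b s sm') (@g_le b s sm') (@mpg b s sm) (@gcvg b s sm) X crho rho1.
apply: filterS2 (ib false) (ib true) => Y i1 i2.
have cE b : (fun t => (rho t * pg b s (map_pair iota X + t *: Y))%:E) =
    fun t => (cpart b ((rho t)%:C * P (D s) (map_pair iota X + t *: Y)))%:E.
  by apply/funext => t; rewrite cpartZ.
by rewrite cE in i1; rewrite cE in i2.
Qed.

Lemma stochastic_taylor_expansion (p : R) : 1 <= p ->
  exists (S : nat -> B * B -> R[i]) (T : B * B -> R[i]),
  [/\ cLfun (mu h) p (fun Y => P F (map_pair iota X + Y)),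
      forall i : nat, (1 <= i <= n)%N ->
        cLsum (mu h) p
          (fun (l : i.-tuple Gamma * i.-tuple bool) (Y : B * B) =>
             (ell_prod ip iota e (mu h) l Y)%:C * partial e l F X)
          (S i),
      cLsum (mu h) p
        (fun (l : n.+1.-tuple Gamma * n.+1.-tuple bool) (Y : B * B) =>
           (ell_prod ip iota e (mu h) l Y)%:C *
           cintegral01 (fun s : R => ((1 - s) ^+ n / n`!%:R)%:C *
             P (partial e l F) (map_pair iota X + s *: Y)))
        T &
      {ae mu h, forall Y : B * B,
        P F (map_pair iota X + Y) =
        F X + \sum_(1 <= i < n.+1) (i`!%:R)^-1 * S i Y + T Y}].
Proof.
move=> p1; exists Sum, Rem; split.
- have [b1 [_ m1 _]] := Le true; have [b2 [_ m2 _]] := Le false.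
  split; [exact: m2|exact: m1|].
  (* The empty word has product 1, so the bound for words applies to the translated extension, which
     is bounded almost everywhere. *)
  have [k k1 hk] := Lnorm_dual_product_le idense h0 (hmu h0) ow yw 0 p1.
  have C20 : 0 <= 2 * Cs [::] by rewrite mulr_ge0.
  apply: (@le_lt_trans _ _ (k * (2 * Cs [::]))%:E); last exact: ltry.
  apply: (hk [tuple] (fun Y => P F (map_pair iota X + Y)) (2 * Cs [::])) => //.
    by case; [exact: m1|exact: m2].
  apply: filterS2 b1 b2 => Y c1 c2; rewrite big_nil normr1 mul1r mulrDl mul1r.
  by apply: normc_le_cparts => -[].
- move=> i /andP[_ iN].
  have im : (i <= m)%N by apply: leq_trans (ltnW nm); exact: leqW.
  exact: (cLsum_words idense h0 (hmu h0) ow yw epsT0 epsE M0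
    (fun b' l => mfS l b') (fun l => @fSC i l im) p1).
- exact: (cLsum_words idense h0 (hmu h0) ow yw epsT0 epsE M20
    (fun b' l => mfT l b') fTC p1).
apply: filterS2 (formula false) (formula true) => Y f0 f1.
apply: cpart_inj => b; rewrite !cpartD cpart_sum.
rewrite (eq_bigr (fun i => i`!%:R^-1 * cpart b (Sum i Y))) => [|i _].
  by case: b; [exact: f1|exact: f0].
by rewrite -cpartZ; congr (cpart b (_ * _)); rewrite fmorphV rmorph_nat.
Qed.

End stochastic_taylor.

Theorem proposition4p10
  (R : realType) (H B : completeNormedModType R)
  (ip : {dot H for idfun}) (iota : {linear H -> B})
  (hW : wiener_space ip iota)
  (mu : R -> probability (borel (B * B)%type) R)
  (hmu : forall h : R, 0 < h ->
     gaussian_measure (prod_dot ip) (map_pair iota) h (mu h))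
  (Gamma : countType) (e : Gamma -> H)
  (he : hilbert_basis ip e) (heB : forall j, in_dual ip iota (e j))
  (eps : Gamma -> R) (eps_ge0 : forall j, 0 <= eps j)
  (eps_sum : summable [set: Gamma] (fun j => (eps j)%:E))
  (m : nat) (hm : (2 <= m)%N)
  (F : H * H -> R[i]) (hF : symbol_class e m eps F)
  (X : H * H)
  (k : nat) (hk1 : (1 <= k)%N) (hkm : (k <= m - 1)%N)
  (h : R) (hh : 0 < h) (p : R) (hp : 1 <= p)
  (P : (H * H -> R[i]) -> (B * B -> R[i]))
  (hP : forall G, symbol_class e 1 eps G ->
     forall h' q : R, 0 < h' <= 2 * h -> 1 <= q ->
     stoch_ext (prod_dot ip) (map_pair iota) (mu h') q G (P G)) :
  (forall l : k.-tuple Gamma * k.-tuple bool,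
     {ae mu h, forall Y : B * B, cintegrable01 (fun s : R =>
        ((1 - s) ^+ (k - 1) / (k - 1)`!%:R)%:C *
        P (partial e l F) (map_pair iota X + s *: Y))}) /\
  exists (S : nat -> B * B -> R[i]) (T : B * B -> R[i]),
  [/\ cLfun (mu h) p (fun Y => P F (map_pair iota X + Y)),
      forall i : nat, (1 <= i <= k - 1)%N ->
        cLsum (mu h) p
          (fun (l : i.-tuple Gamma * i.-tuple bool) (Y : B * B) =>
             (ell_prod ip iota e (mu h) l Y)%:C * partial e l F X)
          (S i),
      cLsum (mu h) p
        (fun (l : k.-tuple Gamma * k.-tuple bool) (Y : B * B) =>
           (ell_prod ip iota e (mu h) l Y)%:C *
           cintegral01 (fun s : R =>
             ((1 - s) ^+ (k - 1) / (k - 1)`!%:R)%:C *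
             P (partial e l F) (map_pair iota X + s *: Y)))
        T &
      {ae mu h, forall Y : B * B,
        P F (map_pair iota X + Y) =
        F X + \sum_(1 <= i < k) (i`!%:R)^-1 * S i Y + T Y}].
Proof.
(* Continuous functionals representing the basis vectors are fixed once and for all; the classes
   [ell] occurring in the statement agree with them almost everywhere. *)
have [z ze] := choice heB.
have [E epsE] := summable_initial_bound eps_ge0 eps_sum.
have [M M0 hFM] := hF.
case: k hk1 hkm => // n _ nm.
have {nm}nm : (n.+1 < m)%N by rewrite -(subnK (ltnW hm)) addn1 ltnS.
have nE : (n.+1 - 1 = n)%N by rewrite subn1.
rewrite nE; split.
  by move=> l; exact: (stochastic_taylor_integrable hW he hmu ze eps_ge0 M0 hFM X hh hP nm l).
exact: (stochastic_taylor_expansion hW he hmu ze eps_ge0 epsE M0 hFM X hh hP nm hp).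
Qed.
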